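(* Let $(\Sigma,g)$ be a connected smooth (i.e. $C^\infty$) closed Riemannian surface. Then there exist constants $C_1,C_2,C_3>0$, depending only on $(\Sigma,g)$, such that for every $\mu>0$, every nonzero real-valued eigenfunction $\phi_\mu$ with $\Delta\phi_\mu+\mu^2\phi_\mu=0$ on $\Sigma$, and every $\delta>0$ with $\mu\delta\le C_3$, $$C_1\,\mu\delta\;\le\;\operatorname{Vol}(T_{\mu,\delta})\;\le\;C_2\,\operatorname{length}(\mathcal N_\mu)\,\delta .$$
   Context: $\Delta$ is the Laplace--Beltrami operator of $(\Sigma,g)$. The nodal set of $\phi_\mu$ is $\mathcal N_\mu=\{x\in\Sigma:\phi_\mu(x)=0\}$, $\operatorname{length}(\mathcal N_\mu)$ is its one-dimensional Hausdorff measure, and $T_{\mu,\delta}=\{x\in \Sigma:\operatorname{dist}(x,\mathcal N_\mu)<\delta\}$. $\operatorname{Vol}$ is Riemannian area. *)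

(* Defs.v *)
From HB Require Import structures.
From mathcomp Require Import all_boot all_order all_algebra.
From mathcomp Require Import all_classical all_reals all_analysis.

Set Implicit Arguments.
Unset Strict Implicit.
Unset Printing Implicit Defensive.

Import Order.TTheory GRing.Theory Num.Theory.
Import numFieldNormedType.Exports.

Local Open Scope classical_set_scope.
Local Open Scope ring_scope.

(** * Calculus on open subsets of the plane *)

Section Plane.
Context {R : realType}.

Definition plane_basis (k : 'I_2) : R * R :=
  if k == ord0 then (1, 0) else (0, 1).

Definition coordinate (k : 'I_2) (x : R * R) : R :=
  if k == ord0 then x.1 else x.2.

Definition partial (k : 'I_2) (f : R * R -> R) : R * R -> R :=
  fun x => 'D_(plane_basis k) f x.

(* The values of [f] and of its partial derivatives outside the open set [U]
   play no role. *)
Fixpoint Ck_on (n : nat) (U : set (R * R)) (f : R * R -> R) : Prop :=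
  (forall x, U x -> {for x, continuous f}) /\
  (if n is m.+1 then
     forall k : 'I_2, (forall x, U x -> derivable f x (plane_basis k)) /\
                      Ck_on m U (partial k f)
   else True).

Definition smooth_on (U : set (R * R)) (f : R * R -> R) : Prop :=
  forall n, Ck_on n U f.

Definition jacobian (f : R * R -> R * R) (x : R * R) : 'M[R]_2 :=
  \matrix_(k, l) partial l (coordinate k \o f) x.

Definition area_measure :
    {measure set (measurableTypeR R * measurableTypeR R) -> \bar R} :=
  (@lebesgue_measure R \x @lebesgue_measure R)%E.

End Plane.

(** * Closed smooth surfaces *)

(* A chart is a homeomorphism from the open set [chart_dom] onto an open subset
   of the plane; both maps are extended arbitrarily to total functions. *)
Record chart (R : realType) (M : topologicalType) := Chart {
  chart_dom : set M ;
  chart_map : M -> R * R ;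
  chart_inv : R * R -> M ;
  chart_dom_open : open chart_dom ;
  chart_img_open : open (chart_map @` chart_dom) ;
  chart_mapK : forall p, chart_dom p -> chart_inv (chart_map p) = p ;
  chart_map_continuous :
    forall p, chart_dom p -> {for p, continuous chart_map} ;
  chart_inv_continuous :
    forall x, (chart_map @` chart_dom) x -> {for x, continuous chart_inv} }.

Definition chart_img (R : realType) (M : topologicalType) (c : chart R M) :
  set (R * R) := chart_map c @` chart_dom c.

Definition transition (R : realType) (M : topologicalType) (c c' : chart R M) :
  R * R -> R * R := chart_map c' \o chart_inv c.

Definition overlap (R : realType) (M : topologicalType) (c c' : chart R M) :
  set (R * R) := chart_map c @` (chart_dom c `&` chart_dom c').

(* By compactness the smooth structure of a closed surface is always generated
   by a finite atlas, so presenting it by one is no restriction. *)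
Record closed_surface (R : realType) := ClosedSurface {
  surface_carrier :> topologicalType ;
  surface_hausdorff : hausdorff_space surface_carrier ;
  surface_compact : compact [set: surface_carrier] ;
  atlas_size : nat ;
  atlas : 'I_atlas_size -> chart R surface_carrier ;
  atlas_cover : forall p, exists i, chart_dom (atlas i) p ;
  atlas_smooth : forall i j (k : 'I_2),
    smooth_on (overlap (atlas i) (atlas j))
              (coordinate k \o transition (atlas i) (atlas j)) }.

Definition smooth_function (R : realType) (S : closed_surface R) (f : S -> R) :=
  forall i : 'I_(atlas_size S),
    smooth_on (chart_img (atlas i)) (f \o chart_inv (atlas i)).

(* [metric_coef i x] is the matrix of the metric at the point with coordinates
   [x] in the i-th chart; [metric_tensorial] is the transformation law of a
   covariant 2-tensor. *)
Record riemannian_metric (R : realType) (S : closed_surface R) :=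
  RiemannianMetric {
  metric_coef :> 'I_(atlas_size S) -> R * R -> 'M[R]_2 ;
  metric_smooth : forall i k l,
    smooth_on (chart_img (atlas i)) (fun x => metric_coef i x k l) ;
  metric_sym : forall i x, chart_img (atlas i) x ->
    (metric_coef i x)^T = metric_coef i x ;
  metric_posdef : forall i x, chart_img (atlas i) x ->
    forall v : 'cV[R]_2, v != 0 ->
      0 < (v^T *m metric_coef i x *m v) ord0 ord0 ;
  metric_tensorial : forall i j x, overlap (atlas i) (atlas j) x ->
    let tau := transition (atlas i) (atlas j) in
    metric_coef i x =
      (jacobian tau x)^T *m metric_coef j (tau x) *m jacobian tau x }.

Section RiemannianSurface.
Context {R : realType} {S : closed_surface R} (g : riemannian_metric S).

(* The quantities computed below in the chart [chart_at p] do not depend on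
   which chart around [p] is chosen. *)
Definition chart_at (p : S) : 'I_(atlas_size S) :=
  projT1 (cid (atlas_cover p)).

(** ** Laplace-Beltrami operator *)

Definition area_density (i : 'I_(atlas_size S)) (x : R * R) : R :=
  Num.sqrt (\det (g i x)).

Definition chart_laplacian (i : 'I_(atlas_size S)) (u : R * R -> R)
    (x : R * R) : R :=
  (area_density i x)^-1 *
  \sum_(k < 2) partial k
    (fun y => \sum_(l < 2)
       area_density i y * invmx (g i y) k l * partial l u y) x.

Definition laplace_beltrami (f : S -> R) : S -> R := fun p =>
  let i := chart_at p in
  chart_laplacian i (f \o chart_inv (atlas i)) (chart_map (atlas i) p).

Definition eigenfunction (mu : R) (phi : S -> R) : Prop :=
  [/\ smooth_function phi,
      exists p, phi p != 0
    & forall p, laplace_beltrami phi p + mu ^+ 2 * phi p = 0].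

(** ** Riemannian distance *)

Definition local_curve (i : 'I_(atlas_size S)) (c : R -> S) (k : 'I_2) :
  R -> R := fun t => coordinate k (chart_map (atlas i) (c t)).

Definition C1_curve (c : R -> S) : Prop :=
  continuous c /\
  forall i t, chart_dom (atlas i) (c t) -> forall k : 'I_2,
    derivable (local_curve i c k) t 1 /\
    {for t, continuous (derive1 (local_curve i c k))}.

(* A map on a compact interval is C^1 up to the end points iff it is the
   restriction of a C^1 curve defined on the whole line. *)
Definition piecewise_C1_curve (c : R -> S) : Prop :=
  exists s : seq R,
    [/\ path <%R 0 s, last 0 s = 1
      & forall k, (k < size s)%N ->
          exists2 c' : R -> S, C1_curve c' &
            forall t, nth 0 (0 :: s) k <= t <= nth 0 s k -> c t = c' t].

Definition speed (c : R -> S) (t : R) : R :=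
  let i := chart_at (c t) in
  let v := \col_k derive1 (local_curve i c k) t in
  Num.sqrt ((v^T *m g i (chart_map (atlas i) (c t)) *m v) ord0 ord0).

Definition curve_length (c : R -> S) : \bar R :=
  (\int[lebesgue_measure]_(t in `[0%R, 1%R]) (speed c t)%:E)%E.

Definition riemannian_dist (p q : S) : \bar R :=
  ereal_inf [set curve_length c | c in
    [set c | [/\ piecewise_C1_curve c, c 0 = p & c 1 = q]]].

Definition dist_to_set (p : S) (A : set S) : \bar R :=
  ereal_inf [set riemannian_dist p q | q in A].

(** ** One-dimensional Hausdorff measure *)

(* The maximum with 0 gives the empty set diameter 0. *)
Definition diam (A : set S) : \bar R :=
  maxe 0%E (ereal_sup [set riemannian_dist pq.1 pq.2 | pq in A `*` A]).

Definition hausdorff1_pre (e : R) (A : set S) : \bar R :=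
  ereal_inf [set (\sum_(0 <= n <oo) diam (U n))%E | U in
    [set U : nat -> set S |
      A `<=` \bigcup_n U n /\ forall n, (diam (U n) <= e%:E)%E]].

Definition hausdorff1 (A : set S) : \bar R :=
  ereal_sup [set hausdorff1_pre e A | e in [set e : R | 0 < e]].

(** ** Riemannian area *)

(* The sets [chart_piece i] partition the surface. *)
Definition chart_piece (i : 'I_(atlas_size S)) : set S :=
  chart_dom (atlas i) `\`
    \bigcup_(j in [set j : 'I_(atlas_size S) | (j < i)%N]) chart_dom (atlas j).

Definition riemannian_area (A : set S) : \bar R :=
  (\sum_(i < atlas_size S)
     \int[area_measure]_(x in chart_map (atlas i) @` (A `&` chart_piece i))
       (area_density i x)%:E)%E.

(** ** Nodal sets *)

Definition nodal_set (phi : S -> R) : set S := [set p | phi p = 0].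

Definition nodal_tube (phi : S -> R) (delta : R) : set S :=
  [set p | (dist_to_set p (nodal_set phi) < delta%:E)%E].

End RiemannianSurface.

(* Main.v *)
(** The lower and upper bounds both come from two properties of the nodal set that
    follow from the maximum principle alone.  In a chart where the coefficients of
    the Laplacian are controlled by [K], comparison with explicit quadratic and
    quartic barriers shows that (a) a solution vanishing at the centre of a small
    coordinate square vanishes somewhere on the boundary of every concentric smaller
    square, as long as [mu * s] is small, and (b) a solution vanishes somewhere in a
    square of size [s] as soon as [mu * s] is large.

    Compactness gives charts of uniform size and bounds, in which the Riemannian
    distance and area are comparable with the Euclidean ones.  By (a), a nodal set
    meeting the centre of a square has Hausdorff measure at least comparable to the
    size of the square; summing over a maximal family of disjoint squares of size
    [delta] centred on the nodal set, whose enlargements cover the tube, gives the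
    upper bound.  Again by (a), the tube around a nodal point contains about
    [s / delta] disjoint squares of size [delta] within distance [s]; by (b) the
    surface contains about [mu ^ 2] disjoint squares of size [s ~ 1 / mu] each
    containing a nodal point, and their contributions add up to [mu * delta]. *)
From HB Require Import structures.
Require Import Defs.
From mathcomp Require Import all_boot all_order all_algebra.
From mathcomp Require Import all_classical all_reals all_analysis.
From mathcomp Require Import measurable_realfun ring lra.
Set Implicit Arguments.
Unset Strict Implicit.
Unset Printing Implicit Defensive.
Import Order.TTheory GRing.Theory Num.Theory.
Import numFieldNormedType.Exports.
Local Open Scope classical_set_scope.
Local Open Scope ring_scope.

(** * Differential calculus in the plane *)

(** The Laplacian, the speed and the area are defined through arbitrarily chosen charts, so each
    must be freed from that choice. For the Laplacian this is done in divergence form; the result is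
    then expanded into the form [lap_coef], to which the second-derivative test applies. For the
    area an inequality up to a constant is enough: it is checked on small squares, where a
    transition map is almost linear, and reaches larger sets by bisection and countable additivity.
    Neither the speed of a curve nor the tube is shown to be measurable; their integrals are handled
    by monotonicity and superadditivity alone. A single number [K] bounds the metric data and,
    through [K^-1], the size of the charts. The choice [C3 = 1 / (4 K)] gives
    [(mu s)^2 (8 K) <= 1 / (2 K)] whenever [mu s <= C3], which is the smallness required in (a).
    When [mu] is small this leaves [delta] unbounded; large [delta] is treated by monotonicity of
    the tube and by the total area. *)

Section PlaneCalculus.
Context {R : realType}.
Implicit Types (f g : R * R -> R) (x y : R * R).

(** Total differentiability with the gradient displayed as two numbers, so that the rules below
    compute gradients by ring algebra. [partial] only sees the two axes, whereas the chain rule uses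
    the total differential. *)
Definition has_grad f x (a b : R) : Prop :=
  is_diff x f (fun h => a * h.1 + b * h.2).

Definition linear_form (a b : R) (h : R * R) : R := a * h.1 + b * h.2.

Lemma linear_form_is_linear a b : linear (linear_form a b).
Proof. by move=> k u v; rewrite /linear_form /= /GRing.scale /=; ring. Qed.

HB.instance Definition _ a b := GRing.isLinear.Build _ _ _ _
  (linear_form a b) (linear_form_is_linear a b).

Lemma linear_form_continuous a b : continuous (linear_form a b).
Proof.
move=> x; apply: cvgD; (apply: cvgM; first exact: cvg_cst);
  [exact: cvg_fst | exact: cvg_snd].
Qed.

Lemma has_gradP f x a b : has_grad f x a b <->
  forall e : R, 0 < e -> \forall h \near (0 : R * R),
    `|f (h + x) - f x - (a * h.1 + b * h.2)| <= e * `|h|.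
Proof.
split=> [[df dfE] e e0|H].
  have /diff_locallyP[_ /eqaddoP] := df.
  rewrite dfE => /(_ _ e0); apply: filterS => h.
  by rewrite !fctE /= opprD addrA.
have H2 : f \o shift x = cst (f x) + linear_form a b +o_ (0 : R * R) id.
  apply/eqaddoP => e e0; have := H e e0; apply: filterS => h Hh.
  rewrite [X in `|X|](_ : _ = f (h + x) - f x - (a * h.1 + b * h.2)) //.
  by rewrite !fctE /= opprD addrA.
have dE := diff_unique (@linear_form_continuous a b) H2.
apply: DiffDef => //.
by apply/diff_locallyP; rewrite dE; split => //; exact: linear_form_continuous.
Qed.

Lemma has_grad_derive f x a b v : has_grad f x a b ->
  derivable f x v /\ 'D_v f x = a * v.1 + b * v.2.
Proof.
move=> [df dE]; split; first exact: diff_derivable.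
by rewrite deriveE // dE.
Qed.

Lemma has_grad_partial0 f x a b : has_grad f x a b -> partial ord0 f x = a.
Proof.
move=> /(has_grad_derive (plane_basis ord0))[_].
by rewrite /partial => ->; rewrite /plane_basis /= mulr1 mulr0 addr0.
Qed.

Lemma has_grad_partial1 f x a b : has_grad f x a b -> partial ord_max f x = b.
Proof.
move=> /(has_grad_derive (plane_basis ord_max))[_].
by rewrite /partial => ->; rewrite /plane_basis /= mulr1 mulr0 add0r.
Qed.

Lemma has_grad_eq f x a b a' b' : has_grad f x a b -> a = a' -> b = b' ->
  has_grad f x a' b'.
Proof. by move=> H <- <-. Qed.

Lemma has_grad_continuous f x a b : has_grad f x a b -> {for x, continuous f}.
Proof. by move=> [df _]; exact: differentiable_continuous. Qed.

Lemma near_has_grad f g x a b : (\forall y \near x, f y = g y) ->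
  has_grad f x a b -> has_grad g x a b.
Proof.
move=> fg /has_gradP H; apply/has_gradP => e e0.
have fgx : f x = g x by exact: nbhs_singleton fg.
have fg0 : \forall h \near (0 : R * R), f (h + x) = g (h + x).
  have := fg; rewrite (near_shift 0 x) /= subr0; apply: filterS => h /=.
  by [].
near=> h; rewrite -fgx -(near fg0 h) //; near: h; exact: H.
Unshelve. all: by end_near. Qed.

Lemma has_grad_cst c x : has_grad (fun=> c) x 0 0.
Proof.
apply: (is_diff_eq (is_diff_cst c x)); by apply/funext => h; rewrite [LHS](_ : _ = 0) //; ring.
Qed.

Lemma has_grad_fst x : has_grad fst x 1 0.
Proof.
apply/has_gradP => e e0; near=> h.
have -> : fst (h + x) - fst x - (1 * h.1 + 0 * h.2) = 0 :> R.
  by rewrite [fst (h + x)](_ : _ = fst h + fst x :> R) //; ring.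
by rewrite normr0 mulr_ge0 // ltW.
Unshelve. all: by end_near. Qed.

Lemma has_grad_snd x : has_grad snd x 0 1.
Proof.
apply/has_gradP => e e0; near=> h.
have -> : snd (h + x) - snd x - (0 * h.1 + 1 * h.2) = 0 :> R.
  by rewrite [snd (h + x)](_ : _ = snd h + snd x :> R) //; ring.
by rewrite normr0 mulr_ge0 // ltW.
Unshelve. all: by end_near. Qed.

Lemma has_gradD f g x a b c d : has_grad f x a b -> has_grad g x c d ->
  has_grad (fun y => f y + g y) x (a + c) (b + d).
Proof.
move=> Hf Hg; apply: (is_diff_eq (is_diffD Hf Hg)).
by apply/funext => h; rewrite !fctE; ring.
Qed.

Lemma has_gradN f x a b : has_grad f x a b ->
  has_grad (fun y => - f y) x (- a) (- b).
Proof.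
move=> Hf; apply: (is_diff_eq (is_diffN Hf)).
by apply/funext => h; rewrite !fctE; ring.
Qed.

Lemma has_gradB f g x a b c d : has_grad f x a b -> has_grad g x c d ->
  has_grad (fun y => f y - g y) x (a - c) (b - d).
Proof. by move=> Hf Hg; apply: has_gradD => //; exact: has_gradN. Qed.

Lemma has_gradM f g x a b c d : has_grad f x a b -> has_grad g x c d ->
  has_grad (fun y => f y * g y) x (f x * c + g x * a) (f x * d + g x * b).
Proof.
move=> Hf Hg; apply: (is_diff_eq (is_diffM Hf Hg)).
by apply/funext => h; rewrite !fctE /GRing.scale /=; ring.
Qed.

Lemma has_grad_comp1 (phi : R -> R) f x a b l :
  is_derive (f x) (1 : R) phi l -> has_grad f x a b ->
  has_grad (fun y => phi (f y)) x (l * a) (l * b).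
Proof.
move=> [dphi Dphi] Hf.
have dphi' : differentiable phi (f x) by apply/derivable1_diffP.
have H := is_diff_comp Hf (differentiableP dphi').
apply: (is_diff_eq H); apply/funext => h /=.
by rewrite deriv1E // /= /GRing.scale /= derive1E Dphi; ring.
Qed.

Lemma has_grad_comp f (p q : R * R -> R) x a b p1 p2 q1 q2 :
  has_grad f (p x, q x) a b -> has_grad p x p1 p2 -> has_grad q x q1 q2 ->
  has_grad (fun y => f (p y, q y)) x (a * p1 + b * q1) (a * p2 + b * q2).
Proof.
move=> Hf Hp Hq.
apply: (is_diff_eq (is_diff_comp (is_diff_pair Hp Hq) Hf)).
by apply/funext => h /=; ring.
Qed.

Lemma has_grad_curve f (c1 c2 : R -> R) t a b d1 d2 :
  has_grad f (c1 t, c2 t) a b -> is_derive t (1 : R) c1 d1 ->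
  is_derive t (1 : R) c2 d2 ->
  is_derive t (1 : R) (fun s => f (c1 s, c2 s)) (a * d1 + b * d2).
Proof.
move=> Hf [e1 E1] [e2 E2].
have D1 : differentiable c1 t by apply/derivable1_diffP.
have D2 : differentiable c2 t by apply/derivable1_diffP.
have [H1 H2] := is_diff_comp (is_diff_pair (differentiableP D1) (differentiableP D2)) Hf.
apply: DeriveDef; first exact: diff_derivable.
rewrite deriveE // H2 /= !deriv1E // /GRing.scale /= !derive1E E1 E2; ring.
Qed.

(** The hypothesis is symmetric around [t0], so it can be checked without knowing on which side [t1]
    lies. *)
Lemma mvt_bound (k dk : R -> R) (t0 t1 l e : R) :
  (forall t : R, `|t - t0| <= `|t1 - t0| ->
     is_derive t (1 : R) k (dk t) /\ `|dk t - l| <= e) ->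
  `|k t1 - k t0 - l * (t1 - t0)| <= e * `|t1 - t0|.
Proof.
move=> H.
have main (a b : R) : a <= b -> (forall t : R, a <= t <= b ->
     is_derive t (1 : R) k (dk t) /\ `|dk t - l| <= e) ->
   `|k b - k a - l * (b - a)| <= e * `|b - a|.
  move=> ab K; have [||c] := @MVT_segment R k dk a b ab.
  - by move=> z; rewrite in_itv /= => /andP[z1 z2]; apply: (K z _).1; rewrite !ltW.
  - apply: derivable_within_continuous => z; rewrite in_itv /= => zab.
    by have [[]] := K z zab.
  rewrite in_itv /= => cab ->; rewrite -mulrBl normrM ler_wpM2r //.
  exact: (K c cab).2.
have [t01|/ltW t10] := leP t0 t1.
  apply: main => // t /andP[ta tb]; apply: H.
  by rewrite !ger0_norm ?subr_ge0 // lerB.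
have M := main t1 t0 t10.
rewrite (distrC t1 t0) (_ : _ - _ = - (k t0 - k t1 - l * (t0 - t1))); last ring.
rewrite normrN; apply: M => t /andP[ta tb]; apply: H.
by rewrite !ler0_norm ?subr_le0 // lerN2 lerB.
Qed.

Lemma derivable_fst f (s y : R) : derivable f (s, y) (1, 0) ->
  is_derive s (1 : R) (fun t => f (t, y)) ('D_(1, 0) f (s, y)).
Proof.
rewrite /derivable /derive => H.
have E : (fun h : R => h^-1 *: (f (h *: (1, 0) + (s, y)) - f (s, y))) =
   (fun h : R => h^-1 *: ((fun t => f (t, y)) (h *: 1 + s) - (fun t => f (t, y)) s)).
  apply/funext => h; congr (_ *: (f _ - _)).
  by congr pair => /=; rewrite /GRing.scale /=; ring.
by apply: DeriveDef; rewrite /derivable /derive -E.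
Qed.

Lemma derivable_snd f (s y : R) : derivable f (y, s) (0, 1) ->
  is_derive s (1 : R) (fun t => f (y, t)) ('D_(0, 1) f (y, s)).
Proof.
rewrite /derivable /derive => H.
have E : (fun h : R => h^-1 *: (f (h *: (0, 1) + (y, s)) - f (y, s))) =
   (fun h : R => h^-1 *: ((fun t => f (y, t)) (h *: 1 + s) - (fun t => f (y, t)) s)).
  apply/funext => h; congr (_ *: (f _ - _)).
  by congr pair => /=; rewrite /GRing.scale /=; ring.
by apply: DeriveDef; rewrite /derivable /derive -E.
Qed.

Lemma ball_pair x (d : R) y : ball x d y <-> `|y.1 - x.1| < d /\ `|y.2 - x.2| < d.
Proof.
rewrite -ball_normE /= distrC.
split=> [|[h1 h2]].
  by rewrite /Num.norm /= num_gt_max => /andP.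
by rewrite /Num.norm /= num_gt_max; apply/andP.
Qed.

Lemma norm_pair x : `|x| = Num.max `|x.1| `|x.2|.
Proof. by []. Qed.

Lemma norm_fst_le x : `|x.1| <= `|x|.
Proof. by rewrite norm_pair le_max lexx. Qed.

Lemma norm_snd_le x : `|x.2| <= `|x|.
Proof. by rewrite norm_pair le_max lexx orbT. Qed.

(** An increment is split into a horizontal and a vertical step, and [mvt_bound] controls each by
    the oscillation of one partial derivative near [x]. *)
Lemma C1_has_grad (U : set (R * R)) f x : open U -> Ck_on 1 U f -> U x ->
  has_grad f x (partial ord0 f x) (partial ord_max f x).
Proof.
move=> oU [_ H] Ux.
have [D0 [C0 _]] := H ord0; have [D1 [C1 _]] := H ord_max.
set a := partial ord0 f x; set b := partial ord_max f x.
apply/has_gradP => e e0; have e2 : 0 < e / 2 by rewrite divr_gt0.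
have nU : nbhs x U by exact: open_nbhs_nbhs.
have na : \forall y \near x, `|partial ord0 f y - a| <= e / 2.
  have /cvgrPdist_le/(_ _ e2) := C0 x Ux; apply: filterS => y.
  by rewrite distrC.
have nb : \forall y \near x, `|partial ord_max f y - b| <= e / 2.
  have /cvgrPdist_le/(_ _ e2) := C1 x Ux; apply: filterS => y.
  by rewrite distrC.
have : nbhs x (U `&` ((fun y => `|partial ord0 f y - a| <= e / 2) `&`
    (fun y => `|partial ord_max f y - b| <= e / 2))).
  by apply: filterI nU _; exact: filterI na nb.
move=> /nbhs_ballP[d /= d0 dP].
near=> h; have hd : `|h| < d.
  near: h; apply/nbhs_ballP; exists d => // h; rewrite -ball_normE /= sub0r normrN.
  by [].
have h1 := le_lt_trans (norm_fst_le h) hd.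
have h2 := le_lt_trans (norm_snd_le h) hd.
pose k1 t := f (t, x.2 + h.2); pose k2 t := f (x.1, t).
have B1 : `|k1 (x.1 + h.1) - k1 x.1 - a * (x.1 + h.1 - x.1)| <= e / 2 * `|x.1 + h.1 - x.1|.
  apply: (@mvt_bound k1 (fun t => partial ord0 f (t, x.2 + h.2))) => t.
  rewrite addrAC subrr add0r => th.
  have [/= UU [Ua _]] : (U `&` ((fun y => `|partial ord0 f y - a| <= e / 2) `&`
    (fun y => `|partial ord_max f y - b| <= e / 2))) (t, x.2 + h.2).
    apply: dP; apply/ball_pair => /=; split; first exact: le_lt_trans h1.
    by rewrite addrAC subrr add0r.
  by split => //; apply: derivable_fst; exact: (D0 _ UU).
have B2 : `|k2 (x.2 + h.2) - k2 x.2 - b * (x.2 + h.2 - x.2)| <= e / 2 * `|x.2 + h.2 - x.2|.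
  apply: (@mvt_bound k2 (fun t => partial ord_max f (x.1, t))) => t.
  rewrite addrAC subrr add0r => th.
  have [/= UU [_ Ub]] : (U `&` ((fun y => `|partial ord0 f y - a| <= e / 2) `&`
    (fun y => `|partial ord_max f y - b| <= e / 2))) (x.1, t).
    apply: dP; apply/ball_pair => /=; split; first by rewrite subrr normr0.
    exact: le_lt_trans h2.
  by split => //; apply: derivable_snd; exact: (D1 _ UU).
move: B1 B2; rewrite ![x.1 + h.1 - x.1]addrAC ![x.2 + h.2 - x.2]addrAC !subrr !add0r.
rewrite /k1 /k2 => B1 B2.
have -> : f (h + x) = f (x.1 + h.1, x.2 + h.2) by congr f; congr pair => /=; rewrite addrC.
have -> : f (x.1 + h.1, x.2 + h.2) - f x - (a * h.1 + b * h.2) =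
  (f (x.1 + h.1, x.2 + h.2) - f (x.1, x.2 + h.2) - a * h.1) +
  (f (x.1, x.2 + h.2) - f (x.1, x.2) - b * h.2) by rewrite -(surjective_pairing x); ring.
apply: le_trans (ler_normD _ _) _.
have -> : e * `|h| = e / 2 * `|h| + e / 2 * `|h| by field.
apply: lerD.
  by apply: le_trans B1 _; rewrite ler_wpM2l ?(ltW e2) // norm_fst_le.
by apply: le_trans B2 _; rewrite ler_wpM2l ?(ltW e2) // norm_snd_le.
Unshelve. all: by end_near. Qed.

Lemma is_derive_bound (k : R -> R) (t l : R) : is_derive t (1 : R) k l ->
  forall e : R, 0 < e ->
  exists2 d : R, 0 < d & forall s, `|s - t| < d ->
    `|k s - k t - l * (s - t)| <= e * `|s - t|.
Proof.
move=> [D E] e e0; move: D; rewrite /derivable => /cvg_ex[/= m Hm].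
have ml : m = l by rewrite -E /derive; apply/esym/cvg_lim.
rewrite ml in Hm; have /cvgrPdist_le/(_ _ e0) := Hm.
move=> /nbhs_ballP[d /= d0 dP]; exists d => // s sd.
have [->|st] := eqVneq s t; first by rewrite !subrr mulr0 subrr normr0 mulr0.
have st0 : s - t != 0 by rewrite subr_eq0.
have /= := dP (s - t); rewrite -ball_normE /= sub0r normrN => /(_ sd st0).
rewrite /GRing.scale /= mulr1 subrK => H.
have -> : k s - k t - l * (s - t) = - ((l - (s - t)^-1 * (k s - k t)) * (s - t)).
  by field.
by rewrite normrN normrM ler_wpM2r.
Qed.

(** If [c] were negative, [k1] would be negative just to the right of its zero [t0], and the mean
    value theorem would bring [k] below its minimum. *)
Lemma min_second_derivative (k k1 : R -> R) (t0 c : R) :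
  (\forall t \near t0, is_derive t (1 : R) k (k1 t)) ->
  is_derive t0 (1 : R) k1 c -> (\forall t \near t0, k t0 <= k t) ->
  k1 t0 = 0 /\ 0 <= c.
Proof.
move=> Hk Hk1 Hm.
have /nbhs_ballP[d /= d0 dP] : nbhs t0 ((fun t => is_derive t (1 : R) k (k1 t)) `&`
   (fun t => k t0 <= k t)) by apply: filterI.
have dP1 t : `|t - t0| < d -> is_derive t (1 : R) k (k1 t) /\ k t0 <= k t.
  by rewrite distrC => td; apply: dP; rewrite -ball_normE.
have k10 : k1 t0 = 0.
  have [] := @derive1_at_min R k (t0 - d) (t0 + d) t0.
  - lra.
  - move=> t; rewrite in_itv /= => /andP[h1 h2].
    by have [|[]] := dP1 t; first by rewrite ltr_norml; lra.
  - by rewrite in_itv /=; lra.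
  - move=> t; rewrite in_itv /= => /andP[h1 h2].
    by have [|] := dP1 t; first by rewrite ltr_norml; lra.
  have [|[_ E]] := dP1 t0; first by rewrite subrr normr0.
  by move=> _ _; rewrite E.
split => //; rewrite leNgt; apply/negP => c0.
have [|d2 d20 H2] := is_derive_bound Hk1 (_ : 0 < - c / 2); first lra.
pose s := Num.min d d2 / 2.
have s0 : 0 < s by rewrite divr_gt0 // lt_min d0.
have sd : s < d /\ s < d2.
  have : Num.min d d2 <= d by rewrite ge_min lexx.
  have : Num.min d d2 <= d2 by rewrite ge_min lexx orbT.
  by rewrite /s in s0 *; lra.
have [|||z] := @MVT R k k1 t0 (t0 + s); first lra.
- move=> t; rewrite in_itv /= => /andP[h1 h2].
  by have [|] := dP1 t; first by rewrite ltr_norml; lra.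
- apply: derivable_within_continuous => t; rewrite in_itv /= => /andP[h1 h2].
  by have [|[]] := dP1 t; first by rewrite ltr_norml; lra.
rewrite in_itv /= => /andP[z1 z2] E.
have zd : z - t0 < d2 by lra.
have := H2 z; rewrite k10 subr0 [`|z - t0|]ger0_norm; last lra.
move=> /(_ zd); rewrite ler_norml => /andP[_ h3].
have [|_] := dP1 (t0 + s); first by rewrite ltr_norml; lra.
have : k1 z * s < 0 by rewrite pmulr_llt0 //; nra.
rewrite (_ : t0 + s - t0 = s) in E; last ring.
lra.
Qed.

Lemma near_line (P : set (R * R)) x (v : R * R) : nbhs x P ->
  \forall t \near (0 : R), P (x.1 + t * v.1, x.2 + t * v.2).
Proof.
move=> xP.
have C (a b : R) : (fun t : R => a + t * b) @ (0 : R) --> a + 0 * b.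
  by apply: cvgD; [exact: cvg_cst|apply: cvgM; [exact: cvg_id|exact: cvg_cst]].
have c := cvg_pair (C x.1 v.1) (C x.2 v.2).
apply: (c _ _ _) => {c C}; rewrite !mul0r !addr0; case: x xP => x1 x2 xP.
have /nbhs_ballP[d d0 dP] := xP.
exists (ball x1 d, ball x2 d); first by split; exact: nbhsx_ballx.
by move=> [y1 y2] /= [h1 h2]; apply: dP.
Qed.

Lemma is_derive_affine (a b t : R) : is_derive t (1 : R) (fun s => a + s * b) b.
Proof.
have -> : (fun s : R => a + s * b) = cst a + id * cst b by apply/funext.
apply: (@is_derive_eq _ _ _ _ _ _ _ _
  (is_deriveD (is_derive_cst a t 1) (is_deriveM (is_derive_id t 1) (is_derive_cst b t 1)))).
by rewrite /GRing.scale /= mulr0 mulr1 add0r add0r.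
Qed.

(** The one-variable test on each line through [x]; the second derivative along [(p, q)] contains
    the mixed terms through their sum. *)
Lemma min_hessian (u u1 u2 : R * R -> R) x h11 h12 h21 h22 :
  (\forall y \near x, has_grad u y (u1 y) (u2 y)) ->
  has_grad u1 x h11 h12 -> has_grad u2 x h21 h22 ->
  (\forall y \near x, u x <= u y) ->
  [/\ u1 x = 0, u2 x = 0 &
    forall p q : R, 0 <= h11 * (p * p) + (h12 + h21) * (p * q) + h22 * (q * q)].
Proof.
move=> Hu H1 H2 Hm.
have main (p q : R) : p * u1 x + q * u2 x = 0 /\
   0 <= h11 * (p * p) + (h12 + h21) * (p * q) + h22 * (q * q).
  pose c1 (t : R) := x.1 + t * p; pose c2 (t : R) := x.2 + t * q.
  have x0 : (c1 0, c2 0) = x.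
    by rewrite /c1 /c2 !mul0r !addr0 -surjective_pairing.
  pose k t := u (c1 t, c2 t); pose k1 t := u1 (c1 t, c2 t) * p + u2 (c1 t, c2 t) * q.
  have [||| ] := @min_second_derivative k k1 0 ((h11 * p + h12 * q) * p + (h21 * p + h22 * q) * q).
  - have := near_line (p, q) Hu; apply: filterS => t /= Ht.
    by apply: has_grad_curve => //; exact: is_derive_affine.
  - have D1 : is_derive (0 : R) (1 : R) (fun s => u1 (c1 s, c2 s)) (h11 * p + h12 * q).
      by apply: has_grad_curve; rewrite ?x0 //; exact: is_derive_affine.
    have D2 : is_derive (0 : R) (1 : R) (fun s => u2 (c1 s, c2 s)) (h21 * p + h22 * q).
      by apply: has_grad_curve; rewrite ?x0 //; exact: is_derive_affine.
    have -> : k1 = (fun s => u1 (c1 s, c2 s)) * cst p + (fun s => u2 (c1 s, c2 s)) * cst q.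
      by apply/funext.
    by apply: is_derive_eq; rewrite /GRing.scale /=; ring.
  - have := near_line (p, q) Hm; apply: filterS => t /= Ht.
    by rewrite /k x0.
  rewrite /k1 x0 => E1 E2; split; first lra.
  by apply: le_trans E2 _; rewrite le_eqVlt; apply/orP; left; apply/eqP; ring.
have [e1 _] := main 1 0; have [e2 _] := main 0 1.
split; [lra|lra|by move=> p q; have [] := main p q].
Qed.

(** The trace of the product of a positive definite and a positive semidefinite matrix is
    nonnegative. Multiplied by [a11], the expression is the semidefinite form at [(a11, a12)] plus
    the determinant times [h22]. *)
Lemma elliptic_min (a11 a12 a22 h11 h12 h22 : R) :
  0 < a11 -> 0 < a11 * a22 - a12 * a12 ->
  (forall p q : R, 0 <= h11 * (p * p) + h12 * (p * q) + h22 * (q * q)) ->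
  0 <= a11 * h11 + a12 * h12 + a22 * h22.
Proof.
move=> a0 d0 H.
have H1 := H a11 a12; have H2 := H 0 1.
have h22_ge0 : 0 <= h22 by lra.
have : 0 <= a11 * (a11 * h11 + a12 * h12 + a22 * h22).
  have := mulr_ge0 (ltW d0) h22_ge0; nra.
by rewrite pmulr_rge0.
Qed.

(** The mean value theorem is applied in the first variable to the difference of [f] over a vertical
    step [t]; the derivative of that difference is estimated by the differentiability of [f1] at the
    single point [x]. *)
Lemma schwarz_increment (f f1 f2 : R * R -> R) x h11 h12 :
  (\forall y \near x, has_grad f y (f1 y) (f2 y)) -> has_grad f1 x h11 h12 ->
  forall e : R, 0 < e -> \forall t \near (0 : R),
  `|f (x.1 + t, x.2 + t) - f (x.1 + t, x.2) - (f (x.1, x.2 + t) - f (x.1, x.2))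
    - h12 * (t * t)| <= e * (t * t).
Proof.
move=> Hf /has_gradP H1 e e0.
have e2 : 0 < e / 2 by rewrite divr_gt0.
have /nbhs_ballP[d1 /= d10 dP1] := Hf.
have /nbhs_ballP[d2 /= d20 dP2] := H1 _ e2.
pose d := Num.min d1 d2.
have d0 : 0 < d by rewrite lt_min d10.
have dd1 : d <= d1 by rewrite ge_min lexx.
have dd2 : d <= d2 by rewrite ge_min lexx orbT.
apply/nbhs_ballP; exists d => // t; rewrite -ball_normE /= sub0r normrN => td.
pose k (s : R) := f (s, x.2 + t) - f (s, x.2).
have := @mvt_bound k (fun s => f1 (s, x.2 + t) - f1 (s, x.2)) x.1 (x.1 + t) (h12 * t) (e * `|t|).
rewrite (_ : x.1 + t - x.1 = t); last ring.
rewrite /k -!mulrA -expr2 -normrM ger0_norm -?expr2 ?sqr_ge0 //; apply => s st.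
have hyp (y2 : R) : `|y2 - x.2| <= `|t| ->
    has_grad f (s, y2) (f1 (s, y2)) (f2 (s, y2)) /\
    `|f1 (s, y2) - f1 x - (h11 * (s - x.1) + h12 * (y2 - x.2))| <= e / 2 * `|t|.
  move=> yt; split.
    apply: dP1; apply/ball_pair => /=; split.
      by apply: le_lt_trans st _; apply: lt_le_trans td _.
    by apply: le_lt_trans yt _; apply: lt_le_trans td _.
  have := dP2 (s - x.1, y2 - x.2).
  have hmax : `|(s - x.1, y2 - x.2)| <= `|t| by rewrite norm_pair ge_max /= st.
  rewrite -ball_normE /= sub0r normrN => /(_ (le_lt_trans hmax (lt_le_trans td dd2))).
  rewrite (_ : (s - x.1, y2 - x.2) + x = (s, y2)); last first.
    by rewrite [x in LHS]surjective_pairing; congr pair => /=; rewrite subrK.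
  by move=> /le_trans; apply; rewrite ler_wpM2l // ltW.
have [|G1 B1] := hyp (x.2 + t); first by rewrite (_ : x.2 + t - x.2 = t) //; ring.
have [|G2 B2] := hyp x.2; first by rewrite subrr normr0.
split; last first.
  rewrite (_ : _ - _ = (f1 (s, x.2 + t) - f1 x - (h11 * (s - x.1) + h12 * (x.2 + t - x.2)))
    - (f1 (s, x.2) - f1 x - (h11 * (s - x.1) + h12 * (x.2 - x.2)))); last ring.
  apply: le_trans (ler_normB _ _) _.
  by rewrite (_ : e * `|t| = e / 2 * `|t| + e / 2 * `|t|) ?lerD //; field.
have aux (y2 : R) : has_grad f (s, y2) (f1 (s, y2)) (f2 (s, y2)) ->
    is_derive s (1 : R) (fun r => f (r, y2)) (f1 (s, y2)).
  move=> G; have [_ E] := has_grad_derive (1, 0) G.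
  have := derivable_fst (has_grad_derive (1, 0) G).1.
  by rewrite E /= mulr1 mulr0 addr0.
exact: is_deriveB (aux _ G1) (aux _ G2).
Qed.

(** The second difference over a small square is unchanged when the coordinates are exchanged;
    [schwarz_increment] for [f] and for [f] composed with the swap identifies it with [h12 t^2] and
    with [h21 t^2], up to [o(t^2)]. *)
Lemma schwarz (f f1 f2 : R * R -> R) x h11 h12 h21 h22 :
  (\forall y \near x, has_grad f y (f1 y) (f2 y)) ->
  has_grad f1 x h11 h12 -> has_grad f2 x h21 h22 -> h12 = h21.
Proof.
move=> Hf H1 H2.
pose w (y : R * R) := (y.2, y.1).
have swapg (k : R * R -> R) y a b : has_grad k (w y) a b -> has_grad (k \o w) y b a.
  move=> H; apply: has_grad_eq (has_grad_comp H (has_grad_snd y) (has_grad_fst y)) _ _; ring.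
have Hg : \forall y \near w x, has_grad (f \o w) y ((f2 \o w) y) ((f1 \o w) y).
  have /nbhs_ballP[d d0 dP] := Hf.
  apply/nbhs_ballP; exists d => // y /ball_pair[h1 h2].
  by apply: swapg; apply: dP; apply/ball_pair.
have Hg2 : has_grad (f2 \o w) (w x) h22 h21.
  by apply: swapg; rewrite /w /= -surjective_pairing.
apply/eqP; rewrite -subr_eq0 -normr_le0; apply/ler_addgt0Pr => e e0; rewrite add0r.
have e2 : 0 < e / 2 by rewrite divr_gt0.
have /nbhs_ballP[d1 /= d10 dP1] := schwarz_increment Hf H1 e2.
have /nbhs_ballP[d2 /= d20 dP2] := schwarz_increment Hg Hg2 e2.
pose t := Num.min d1 d2 / 2.
have t0 : 0 < t by rewrite divr_gt0 // lt_min d10.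
have [td1 td2] : t < d1 /\ t < d2.
  have : Num.min d1 d2 <= d1 by rewrite ge_min lexx.
  have : Num.min d1 d2 <= d2 by rewrite ge_min lexx orbT.
  by rewrite /t in t0 *; lra.
have := dP1 t; rewrite -ball_normE /= sub0r normrN gtr0_norm // => /(_ td1).
have := dP2 t; rewrite -ball_normE /= sub0r normrN gtr0_norm // => /(_ td2).
rewrite /w /= => B2 B1.
have : `|(h12 - h21) * (t * t)| <= e * (t * t).
  rewrite (_ : e * (t * t) = e / 2 * (t * t) + e / 2 * (t * t)); last by field.
  apply: le_trans (lerD B2 B1); apply: le_trans (ler_normB _ _).
  by rewrite le_eqVlt; apply/orP; left; apply/eqP; congr `|_|; ring.
have tt : 0 < t * t by rewrite mulr_gt0.
by rewrite normrM (gtr0_norm tt) ler_pM2r.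
Qed.

End PlaneCalculus.

(** * The Laplacian in charts *)

Section SmoothFunctions.
Context {R : realType}.
Implicit Types (f g : R * R -> R) (x y : R * R).

Lemma smooth_has_grad (U : set (R * R)) f x : open U -> smooth_on U f -> U x ->
  has_grad f x (partial ord0 f x) (partial ord_max f x).
Proof. by move=> oU /(_ 1%N) sf Ux; exact: C1_has_grad oU sf Ux. Qed.

Lemma smooth_partial (U : set (R * R)) f k :
  smooth_on U f -> smooth_on U (partial k f).
Proof. by move=> sf n; have [_ /(_ k)[]] := sf n.+1. Qed.

Lemma smooth_continuous (U : set (R * R)) f x :
  smooth_on U f -> U x -> {for x, continuous f}.
Proof. by move=> /(_ 0%N)[+ _] Ux; exact. Qed.

Lemma near_eq_partial f g x k : (\forall y \near x, f y = g y) ->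
  partial k f x = partial k g x.
Proof.
move=> fg; by rewrite /partial; apply: near_eq_derive.
Qed.

Lemma det22 (M : 'M[R]_2) :
  \det M = M ord0 ord0 * M ord_max ord_max - M ord0 ord_max * M ord_max ord0.
Proof.
rewrite (expand_det_row _ ord0) !big_ord_recl big_ord0 /cofactor !det_mx11 !mxE /=.
rewrite (_ : lift ord0 ord0 = ord_max); last exact: val_inj.
rewrite (_ : lift ord_max ord0 = ord0); last exact: val_inj.
by rewrite /= expr0 expr1; ring.
Qed.

Lemma sum2 (F : 'I_2 -> R) : \sum_(k < 2) F k = F ord0 + F ord_max.
Proof.
by rewrite !big_ord_recl big_ord0 addr0; congr (_ + F _); apply: val_inj.
Qed.

Lemma invmx22 (M : 'M[R]_2) : \det M != 0 ->
  [/\ invmx M ord0 ord0 = M ord_max ord_max / \det M,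
      invmx M ord0 ord_max = - M ord0 ord_max / \det M,
      invmx M ord_max ord0 = - M ord_max ord0 / \det M &
      invmx M ord_max ord_max = M ord0 ord0 / \det M].
Proof.
move=> d0; have uM : M \in unitmx by rewrite unitmxE unitfE.
have l1 : lift ord0 ord0 = ord_max :> 'I_2 by exact: val_inj.
have l2 : lift ord_max ord0 = ord0 :> 'I_2 by exact: val_inj.
by split; rewrite /invmx uM !mxE /cofactor det_mx11 !mxE /= ?l1 ?l2 ?expr0 ?expr1 ?sqrr_sign /=
  ?mul1r ?mulN1r ?expr2 ?mulrNN ?mul1r mulrC.
Qed.

Lemma quad22 (M : 'M[R]_2) (v : 'cV[R]_2) :
  (v^T *m M *m v) ord0 ord0 =
    M ord0 ord0 * (v ord0 ord0 * v ord0 ord0) +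
    (M ord0 ord_max + M ord_max ord0) * (v ord0 ord0 * v ord_max ord0) +
    M ord_max ord_max * (v ord_max ord0 * v ord_max ord0).
Proof. by rewrite !mxE sum2 !mxE !sum2 !mxE; ring. Qed.

End SmoothFunctions.

Section Charts.
Context {R : realType} {M : topologicalType}.
Implicit Types (c : chart R M).

Lemma chart_image_open c (A : set M) : open A ->
  open (chart_map c @` (chart_dom c `&` A)).
Proof.
move=> oA; rewrite openE => x [p [cp Ap] <-{x}].
have imgp : (chart_map c @` chart_dom c) (chart_map c p) by exists p.
have n1 : nbhs (chart_map c p) (chart_map c @` chart_dom c).
  by apply: open_nbhs_nbhs; split => //; exact: chart_img_open.
have n2 : nbhs (chart_map c p) (chart_inv c @^-1` A).
  apply: (chart_inv_continuous imgp); rewrite chart_mapK //.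
  exact: open_nbhs_nbhs.
apply: filterS (filterI n1 n2) => _ [[q cq <-]] /=.
by rewrite chart_mapK // => Aq; exists q.
Qed.

Lemma chart_preimage_open c (V : set (R * R)) : open V ->
  open (chart_dom c `&` chart_map c @^-1` V).
Proof.
move=> oV; rewrite openE => p [cp Vp].
have n1 : nbhs p (chart_dom c) by apply: open_nbhs_nbhs; split => //; exact: chart_dom_open.
have n2 : nbhs p (chart_map c @^-1` V).
  by apply: (chart_map_continuous cp); exact: open_nbhs_nbhs.
exact: filterI n1 n2.
Qed.

Lemma chart_invK c x : chart_img c x ->
  chart_dom c (chart_inv c x) /\ chart_map c (chart_inv c x) = x.
Proof. by move=> [p cp <-]; rewrite chart_mapK. Qed.

Lemma overlap_open c c' : open (overlap c c').
Proof. exact/chart_image_open/chart_dom_open. Qed.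

Lemma overlapP c c' p : chart_dom c p -> chart_dom c' p ->
  overlap c c' (chart_map c p).
Proof. by move=> cp c'p; exists p. Qed.

Lemma transitionE c c' p : chart_dom c p ->
  transition c c' (chart_map c p) = chart_map c' p.
Proof. by move=> cp; rewrite /transition /= chart_mapK. Qed.

Lemma overlap_img c c' x : overlap c c' x ->
  chart_img c x /\ chart_img c' (transition c c' x).
Proof. by move=> [p [cp c'p] <-]; rewrite transitionE //; split; exists p. Qed.

End Charts.

(** * The Laplace-Beltrami operator in divergence and non-divergence form *)

Section Laplacian.
Context {R : realType} {S : closed_surface R} (g : riemannian_metric S).
Implicit Types (i j : 'I_(atlas_size S)) (x y : R * R).

(** The coefficients E, F, G of the first fundamental form. The lower left entry agrees with [gB] on
    the chart image, where symmetry holds. *)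
Definition gA i x := g i x ord0 ord0.
Definition gB i x := g i x ord0 ord_max.
Definition gD i x := g i x ord_max ord_max.
Definition gdet i x := gA i x * gD i x - gB i x * gB i x.
Definition gquad i x (p q : R) :=
  gA i x * (p * p) + (gB i x + gB i x) * (p * q) + gD i x * (q * q).

Lemma metric_symE i x : chart_img (atlas i) x -> g i x ord_max ord0 = gB i x.
Proof. by move=> ix; rewrite -[in LHS](Defs.metric_sym g ix) mxE. Qed.

Lemma metric_detE i x : chart_img (atlas i) x -> \det (g i x) = gdet i x.
Proof. by move=> ix; rewrite det22 metric_symE. Qed.

Lemma metric_quadE i x (v : 'cV[R]_2) : chart_img (atlas i) x ->
  (v^T *m g i x *m v) ord0 ord0 = gquad i x (v ord0 ord0) (v ord_max ord0).
Proof. by move=> ix; rewrite quad22 metric_symE. Qed.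

Lemma gquad_gt0 i x p q : chart_img (atlas i) x -> p != 0 \/ q != 0 ->
  0 < gquad i x p q.
Proof.
move=> ix pq; pose v : 'cV[R]_2 := \col_k (if k == ord0 then p else q).
have := metric_posdef g ix (v := v); rewrite metric_quadE // !mxE /=; apply.
apply/eqP => /matrixP v0; have := v0 ord0 ord0; have := v0 ord_max ord0.
by rewrite !mxE /= => q0 p0; case: pq; rewrite ?q0 ?p0 eqxx.
Qed.

Lemma gA_gt0 i x : chart_img (atlas i) x -> 0 < gA i x.
Proof.
move=> ix; have := @gquad_gt0 i x 1 0 ix (or_introl (oner_neq0 _)).
by rewrite /gquad; lra.
Qed.

Lemma gD_gt0 i x : chart_img (atlas i) x -> 0 < gD i x.
Proof.
move=> ix; have := @gquad_gt0 i x 0 1 ix (or_intror (oner_neq0 _)).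
by rewrite /gquad; lra.
Qed.

Lemma gdet_gt0 i x : chart_img (atlas i) x -> 0 < gdet i x.
Proof.
move=> ix; have A0 := gA_gt0 ix.
have := @gquad_gt0 i x (gB i x) (- gA i x) ix.
rewrite oppr_eq0 (gt_eqF A0) => /(_ (or_intror isT)).
rewrite (_ : gquad _ _ _ _ = gA i x * gdet i x); last by rewrite /gquad /gdet; ring.
by rewrite pmulr_rgt0.
Qed.

Lemma area_densityE i x : chart_img (atlas i) x ->
  area_density g i x = Num.sqrt (gdet i x).
Proof. by move=> ix; rewrite /area_density metric_detE. Qed.

Lemma area_density_gt0 i x : chart_img (atlas i) x -> 0 < area_density g i x.
Proof. by move=> ix; rewrite area_densityE // sqrtr_gt0 gdet_gt0. Qed.

Lemma area_density_sqr i x : chart_img (atlas i) x ->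
  area_density g i x * area_density g i x = gdet i x.
Proof.
by move=> ix; rewrite area_densityE // -expr2 sqr_sqrtr // ltW // gdet_gt0.
Qed.

(** The components of [sqrt(det g) g^-1 grad u], the vector field whose divergence appears in the
    Laplacian. The inverse matrix is written by cofactors, so one [sqrt(det g)] remains in the
    denominator. *)
Definition flux0 i (u1 u2 : R * R -> R) y :=
  (gD i y * u1 y - gB i y * u2 y) / area_density g i y.
Definition flux1 i (u1 u2 : R * R -> R) y :=
  (gA i y * u2 y - gB i y * u1 y) / area_density g i y.

Lemma near_chart_img i x : chart_img (atlas i) x ->
  \forall y \near x, chart_img (atlas i) y.
Proof. by move=> ix; apply: open_nbhs_nbhs; split => //; exact: chart_img_open. Qed.

Lemma chart_laplacian_flux i (u u1 u2 : R * R -> R) x :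
  chart_img (atlas i) x ->
  (\forall y \near x, has_grad u y (u1 y) (u2 y)) ->
  chart_laplacian g i u x = (area_density g i x)^-1 *
    (partial ord0 (flux0 i u1 u2) x + partial ord_max (flux1 i u1 u2) x).
Proof.
move=> ix Hu; rewrite /chart_laplacian sum2; congr (_ * (_ + _));
  apply: near_eq_partial; near=> y; rewrite sum2;
  have Hy : has_grad u y (u1 y) (u2 y) by near: y.
- have iy : chart_img (atlas i) y by near: y; exact: near_chart_img.
  have d0 : \det (g i y) != 0 by rewrite metric_detE // gt_eqF // gdet_gt0.
  have s0 : area_density g i y != 0 by rewrite gt_eqF // area_density_gt0.
  have [-> -> _ _] := invmx22 d0.
  rewrite (has_grad_partial0 Hy) (has_grad_partial1 Hy) metric_detE //.
  rewrite -area_density_sqr // /flux0 -/(gD i y) -/(gB i y); field.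
  exact: s0.
- have iy : chart_img (atlas i) y by near: y; exact: near_chart_img.
  have d0 : \det (g i y) != 0 by rewrite metric_detE // gt_eqF // gdet_gt0.
  have s0 : area_density g i y != 0 by rewrite gt_eqF // area_density_gt0.
  have [_ _ -> ->] := invmx22 d0.
  rewrite (has_grad_partial0 Hy) (has_grad_partial1 Hy) metric_detE // metric_symE //.
  rewrite -area_density_sqr // /flux1 -/(gA i y) -/(gB i y); field.
  exact: s0.
Unshelve. all: by end_near. Qed.

Lemma has_grad_metric i x : chart_img (atlas i) x ->
  [/\ has_grad (gA i) x (partial ord0 (gA i) x) (partial ord_max (gA i) x),
      has_grad (gB i) x (partial ord0 (gB i) x) (partial ord_max (gB i) x) &
      has_grad (gD i) x (partial ord0 (gD i) x) (partial ord_max (gD i) x)].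
Proof.
move=> ix; have oU := chart_img_open (c := atlas i).
by split; apply: (smooth_has_grad oU (metric_smooth g i _ _) ix).
Qed.

Definition gdet_partial i (k : 'I_2) x :=
  partial k (gA i) x * gD i x + gA i x * partial k (gD i) x
  - 2 * (gB i x * partial k (gB i) x).

Lemma has_grad_area_density i x : chart_img (atlas i) x ->
  has_grad (area_density g i) x
    (gdet_partial i ord0 x / (2 * area_density g i x))
    (gdet_partial i ord_max x / (2 * area_density g i x)).
Proof.
move=> ix; have [HA HB HD] := has_grad_metric ix.
have d0 := gdet_gt0 ix.
have Hd := has_gradB (has_gradM HA HD) (has_gradM HB HB).
have Hs := has_grad_comp1 (is_derive1_sqrt d0) Hd.
apply: (near_has_grad (f := fun y => Num.sqrt (gdet i y))).
  have := near_chart_img ix; apply: filterS => y iy.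
  by rewrite area_densityE.
apply: has_grad_eq Hs _ _; rewrite area_densityE // /gdet_partial; field;
  by rewrite sqrtr_eq0 -ltNge.
Qed.

Lemma has_gradV (f : R * R -> R) x a b : f x != 0 -> has_grad f x a b ->
  has_grad (fun y => (f y)^-1) x (- a / (f x * f x)) (- b / (f x * f x)).
Proof.
move=> f0 Hf.
have H : is_derive (f x) (1 : R) (fun t => t^-1) (- (f x) ^- 2).
  have := realfun.is_deriveV f0 (is_derive_id (f x) (1 : R)).
  by rewrite /GRing.scale /= mulr1.
by apply: has_grad_eq (has_grad_comp1 H Hf) _ _; rewrite expr2; field.
Qed.

(** The first-order coefficients left when the derivatives in the divergence fall on
    [sqrt(det g) g^-1]. They are written with [gdet] and no square root, which makes their
    continuity immediate. *)
Definition drift0 i x :=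
  (partial ord0 (gD i) x - partial ord_max (gB i) x) / gdet i x -
  (gD i x * gdet_partial i ord0 x - gB i x * gdet_partial i ord_max x) /
    (2 * (gdet i x * gdet i x)).
Definition drift1 i x :=
  (partial ord_max (gA i) x - partial ord0 (gB i) x) / gdet i x -
  (gA i x * gdet_partial i ord_max x - gB i x * gdet_partial i ord0 x) /
    (2 * (gdet i x * gdet i x)).

Lemma has_grad_flux i (u1 u2 : R * R -> R) x h11 h12 h21 h22 :
  chart_img (atlas i) x ->
  has_grad u1 x h11 h12 -> has_grad u2 x h21 h22 ->
  exists a b c d,
   [/\ has_grad (flux0 i u1 u2) x a b, has_grad (flux1 i u1 u2) x c d &
   (area_density g i x)^-1 * (a + d) =
     gD i x / gdet i x * h11 - gB i x / gdet i x * (h12 + h21)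
     + gA i x / gdet i x * h22 + drift0 i x * u1 x + drift1 i x * u2 x].
Proof.
move=> ix H1 H2; have [HA HB HD] := has_grad_metric ix.
have s0 : area_density g i x != 0 by rewrite gt_eqF // area_density_gt0.
have Hs := has_gradV s0 (has_grad_area_density ix).
have F0 := has_gradM (has_gradB (has_gradM HD H1) (has_gradM HB H2)) Hs.
have F1 := has_gradM (has_gradB (has_gradM HA H2) (has_gradM HB H1)) Hs.
do 4!eexists; split; [exact: F0|exact: F1|].
by rewrite /drift0 /drift1 -!(area_density_sqr ix) //; field.
Qed.

(** The non-divergence form: at a minimum the first-order terms vanish and the Hessian has a sign,
    so this is the expression the maximum principle works with. *)
Lemma chart_laplacianE i (u u1 u2 : R * R -> R) x h11 h12 h21 h22 :
  chart_img (atlas i) x ->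
  (\forall y \near x, has_grad u y (u1 y) (u2 y)) ->
  has_grad u1 x h11 h12 -> has_grad u2 x h21 h22 ->
  chart_laplacian g i u x =
     gD i x / gdet i x * h11 - gB i x / gdet i x * (h12 + h21)
     + gA i x / gdet i x * h22 + drift0 i x * u1 x + drift1 i x * u2 x.
Proof.
move=> ix Hu H1 H2; rewrite (chart_laplacian_flux ix Hu).
have [a [b [c [d [F0 F1 <-]]]]] := has_grad_flux ix H1 H2.
by rewrite (has_grad_partial0 F0) (has_grad_partial1 F1).
Qed.

Section Transition.
Variables (i j : 'I_(atlas_size S)).
Let tau := transition (atlas i) (atlas j).
Definition tr_comp (k : 'I_2) : R * R -> R := coordinate k \o tau.
Definition tr_jac (k l : 'I_2) : R * R -> R := partial l (tr_comp k).
Definition tr_det x := tr_jac ord0 ord0 x * tr_jac ord_max ord_max x -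
  tr_jac ord0 ord_max x * tr_jac ord_max ord0 x.

Lemma tr_compE x : tau x = (tr_comp ord0 x, tr_comp ord_max x).
Proof. by rewrite [LHS]surjective_pairing. Qed.

Lemma has_grad_tr_comp k x : overlap (atlas i) (atlas j) x ->
  has_grad (tr_comp k) x (tr_jac k ord0 x) (tr_jac k ord_max x).
Proof.
exact: (smooth_has_grad (@overlap_open _ _ _ _) (atlas_smooth i j k)).
Qed.

Lemma has_grad_tr_jac k l x : overlap (atlas i) (atlas j) x ->
  has_grad (tr_jac k l) x (partial ord0 (tr_jac k l) x) (partial ord_max (tr_jac k l) x).
Proof.
by apply: smooth_has_grad; [exact: overlap_open|exact/smooth_partial/atlas_smooth].
Qed.

Lemma near_overlap x : overlap (atlas i) (atlas j) x ->
  \forall y \near x, overlap (atlas i) (atlas j) y.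
Proof. by move=> ox; apply: open_nbhs_nbhs; split => //; exact: overlap_open. Qed.

Lemma tr_jac_schwarz k x : overlap (atlas i) (atlas j) x ->
  partial ord_max (tr_jac k ord0) x = partial ord0 (tr_jac k ord_max) x.
Proof.
move=> ox; apply: schwarz (has_grad_tr_jac k ord0 ox) (has_grad_tr_jac k ord_max ox).
by have := near_overlap ox; apply: filterS => y oy; exact: has_grad_tr_comp.
Qed.

Lemma metric_transition x : overlap (atlas i) (atlas j) x ->
  let p := tr_jac ord0 ord0 x in let q := tr_jac ord0 ord_max x in
  let r := tr_jac ord_max ord0 x in let t := tr_jac ord_max ord_max x in
  let A := gA j (tau x) in let B := gB j (tau x) in let D := gD j (tau x) in
  [/\ gA i x = A * (p * p) + (B + B) * (p * r) + D * (r * r),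
      gB i x = A * (p * q) + B * (p * t + q * r) + D * (r * t),
      gD i x = A * (q * q) + (B + B) * (q * t) + D * (t * t) &
      gdet i x = tr_det x ^+ 2 * gdet j (tau x)].
Proof.
move=> ox p q r t A B D; have [ix jx] := overlap_img ox.
have := metric_tensorial g ox => /= /matrixP E.
have EA := E ord0 ord0; have EB := E ord0 ord_max; have ED := E ord_max ord_max.
have hsym := metric_symE jx.
rewrite !mxE sum2 !mxE !sum2 !mxE hsym in EA.
rewrite !mxE sum2 !mxE !sum2 !mxE hsym in EB.
rewrite !mxE sum2 !mxE !sum2 !mxE hsym in ED.
have E1 : gA i x = A * (p * p) + (B + B) * (p * r) + D * (r * r).
  by rewrite /gA EA /A /B /D /gA /gB /gD /p /r /tr_jac /tr_comp /tau; ring.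
have E2 : gB i x = A * (p * q) + B * (p * t + q * r) + D * (r * t).
  by rewrite /gB EB /A /B /D /gA /gB /gD /p /q /r /t /tr_jac /tr_comp /tau; ring.
have E3 : gD i x = A * (q * q) + (B + B) * (q * t) + D * (t * t).
  by rewrite /gD ED /A /B /D /gA /gB /gD /q /t /tr_jac /tr_comp /tau; ring.
split => //; rewrite /gdet E1 E2 E3 /tr_det -/A -/B -/D -/p -/q -/r -/t; ring.
Qed.

Lemma tr_det_neq0 x : overlap (atlas i) (atlas j) x -> tr_det x != 0.
Proof.
move=> ox; have [_ _ _ E] := metric_transition ox.
have [ix _] := overlap_img ox; have := gdet_gt0 ix.
by rewrite E; apply: contraTneq => ->; rewrite expr0n mul0r ltxx.
Qed.

Lemma area_density_transition x : overlap (atlas i) (atlas j) x ->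
  area_density g i x = `|tr_det x| * area_density g j (tau x).
Proof.
move=> ox; have [_ _ _ E] := metric_transition ox.
have [ix jx] := overlap_img ox.
by rewrite !area_densityE // E sqrtrM ?sqr_ge0 // sqrtr_sqr.
Qed.

(* The divergence form is invariant because the cofactor matrix of a Jacobian is
   divergence free, which in dimension 2 is the symmetry of second derivatives. *)
Lemma chart_laplacian_transition (v v1 v2 : R * R -> R) x h11 h12 h21 h22 :
  overlap (atlas i) (atlas j) x ->
  (\forall y \near tau x, has_grad v y (v1 y) (v2 y)) ->
  has_grad v1 (tau x) h11 h12 -> has_grad v2 (tau x) h21 h22 ->
  chart_laplacian g i (v \o tau) x = chart_laplacian g j v (tau x).
Proof.
move=> ox Hv H1 H2; have [ix jx] := overlap_img ox.
have tau_grad (w : R * R -> R) y a b : overlap (atlas i) (atlas j) y ->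
    has_grad w (tau y) a b -> has_grad (w \o tau) y
      (a * tr_jac ord0 ord0 y + b * tr_jac ord_max ord0 y)
      (a * tr_jac ord0 ord_max y + b * tr_jac ord_max ord_max y).
  move=> oy; rewrite tr_compE => Hw.
  have -> : w \o tau = (fun z => w (tr_comp ord0 z, tr_comp ord_max z)).
    by apply/funext => z /=; rewrite tr_compE.
  exact: has_grad_comp Hw (has_grad_tr_comp ord0 oy) (has_grad_tr_comp ord_max oy).
have tau_cont : tau @ x --> tau x.
  have := has_grad_tr_comp ord0 ox; have := has_grad_tr_comp ord_max ox.
  move=> /has_grad_continuous c1 /has_grad_continuous c0.
  have := cvg_pair c0 c1 => /(_ _ _ _).
  rewrite tr_compE (_ : (fun _ => _) = tau) //.
  by apply/funext => z; rewrite tr_compE.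
pose u1 y := v1 (tau y) * tr_jac ord0 ord0 y + v2 (tau y) * tr_jac ord_max ord0 y.
pose u2 y := v1 (tau y) * tr_jac ord0 ord_max y + v2 (tau y) * tr_jac ord_max ord_max y.
have Hu : \forall y \near x, has_grad (v \o tau) y (u1 y) (u2 y).
  apply: filterS2 (near_overlap ox) (tau_cont _ Hv) => y oy /= Hy.
  exact: tau_grad.
rewrite (chart_laplacian_flux ix Hu) (chart_laplacian_flux jx Hv).
have [a [b [c [d [F0 F1 _]]]]] := has_grad_flux jx H1 H2.
rewrite (has_grad_partial0 F0) (has_grad_partial1 F1).
have det0 := tr_det_neq0 ox.
(* The densities differ by the factor [|tr_det|], which can be differentiated because [tr_det] does
   not vanish and keeps its sign [sg] near [x]. *)
have [sg sgE] : exists sg : R, sg ^+ 2 = 1 /\ \forall y \near x, `|tr_det y| = sg * tr_det y.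
  have dc : {for x, continuous tr_det}.
    have J k l := has_grad_tr_jac k l ox.
    exact: has_grad_continuous (has_gradB (has_gradM (J ord0 ord0) (J ord_max ord_max))
      (has_gradM (J ord0 ord_max) (J ord_max ord0))).
  have [dneg|dpos|d0] := ltgtP (tr_det x) 0; last by rewrite d0 eqxx in det0.
    exists (-1); split; first by rewrite sqrrN expr1n.
    apply: filterS (cvgr_lt _ dc _ dneg) => y yneg.
    by rewrite ltr0_norm // mulN1r.
  exists 1; split; first by rewrite expr1n.
  apply: filterS (cvgr_gt _ dc _ dpos) => y ypos.
  by rewrite gtr0_norm // mul1r.
case: sgE => sg2 sgE.
have sg0 : sg != 0 by apply: contra_eq_neq sg2 => ->; rewrite expr0n eq_sym oner_eq0.
(* Up to [sg], the flux in chart [i] is the adjugate of the Jacobian applied to the flux in chart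
   [j]; [E0] and [E1] are its two components. *)
have E0 : \forall y \near x, sg * (tr_jac ord_max ord_max y * (flux0 j v1 v2 \o tau) y
    - tr_jac ord0 ord_max y * (flux1 j v1 v2 \o tau) y) = flux0 i u1 u2 y.
  apply: filterS2 (near_overlap ox) sgE => y oy sy.
  have [iy jy] := overlap_img oy.
  have [EA EB ED _] := metric_transition oy.
  have dy := tr_det_neq0 oy.
  have s0 : area_density g j (tau y) != 0 by rewrite gt_eqF // area_density_gt0.
  rewrite /flux0 /flux1 /= EB ED area_density_transition // sy /u1 /u2.
  have sgV : sg^-1 = sg by apply: (mulfI sg0); rewrite divff // -expr2.
  rewrite /= !invfM sgV.
  move: s0 dy; rewrite /tr_det.
  move: (area_density g j (tau y)) (tr_jac ord0 ord0 y) (tr_jac ord0 ord_max y)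
    (tr_jac ord_max ord0 y) (tr_jac ord_max ord_max y)
    => dens j00 j01 j10 j11 s0 dy; field.
  by rewrite s0.
have E1 : \forall y \near x, sg * (tr_jac ord0 ord0 y * (flux1 j v1 v2 \o tau) y
    - tr_jac ord_max ord0 y * (flux0 j v1 v2 \o tau) y) = flux1 i u1 u2 y.
  apply: filterS2 (near_overlap ox) sgE => y oy sy.
  have [iy jy] := overlap_img oy.
  have [EA EB ED _] := metric_transition oy.
  have dy := tr_det_neq0 oy.
  have s0 : area_density g j (tau y) != 0 by rewrite gt_eqF // area_density_gt0.
  rewrite /flux0 /flux1 /= EA EB area_density_transition // sy /u1 /u2.
  have sgV : sg^-1 = sg by apply: (mulfI sg0); rewrite divff // -expr2.
  rewrite /= !invfM sgV.
  move: s0 dy; rewrite /tr_det.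
  move: (area_density g j (tau y)) (tr_jac ord0 ord0 y) (tr_jac ord0 ord_max y)
    (tr_jac ord_max ord0 y) (tr_jac ord_max ord_max y)
    => dens j00 j01 j10 j11 s0 dy; field.
  by rewrite s0.
have G0 := tau_grad _ _ _ _ ox F0; have G1 := tau_grad _ _ _ _ ox F1.
have J k l := has_grad_tr_jac k l ox.
have K0 := near_has_grad E0 (has_gradM (has_grad_cst sg x)
  (has_gradB (has_gradM (J ord_max ord_max) G0) (has_gradM (J ord0 ord_max) G1))).
have K1 := near_has_grad E1 (has_gradM (has_grad_cst sg x)
  (has_gradB (has_gradM (J ord0 ord0) G1) (has_gradM (J ord_max ord0) G0))).
rewrite (has_grad_partial0 K0) (has_grad_partial1 K1).
rewrite area_density_transition // (nbhs_singleton sgE) /= !tr_jac_schwarz //.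
have s0 : area_density g j (tau x) != 0 by rewrite gt_eqF // area_density_gt0.
have sgV : sg^-1 = sg by apply: (mulfI sg0); rewrite divff // -expr2.
rewrite !invfM sgV.
transitivity (sg ^+ 2 * ((area_density g j (tau x))^-1 * (a + d))); last by rewrite sg2 mul1r.
move: s0 det0; rewrite /tr_det.
move: (partial ord0 (tr_jac ord_max ord_max) x) (partial ord0 (tr_jac ord0 ord_max) x) => k1 k0.
move: (flux0 j v1 v2 (tau x)) (flux1 j v1 v2 (tau x)) => f0 f1.
move: (area_density g j (tau x)) (tr_jac ord0 ord0 x) (tr_jac ord0 ord_max x)
  (tr_jac ord_max ord0 x) (tr_jac ord_max ord_max x)
  => dens j00 j01 j10 j11 s0 det0.
clear -s0 det0; field.
by rewrite s0.
Qed.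

End Transition.

Lemma smooth_function_grad (phi : S -> R) i x : smooth_function phi ->
  chart_img (atlas i) x ->
  let u := phi \o chart_inv (atlas i) in
  [/\ \forall y \near x, has_grad u y (partial ord0 u y) (partial ord_max u y),
    has_grad (partial ord0 u) x (partial ord0 (partial ord0 u) x) (partial ord_max (partial ord0 u) x) &
    has_grad (partial ord_max u) x (partial ord0 (partial ord_max u) x) (partial ord_max (partial ord_max u) x)].
Proof.
move=> sphi ix u; have oU := chart_img_open (c := atlas i).
split; [|apply: smooth_has_grad ix => //; exact: smooth_partial..].
have := near_chart_img ix; apply: filterS => y iy.
exact: (smooth_has_grad oU (sphi i)).
Qed.

(** The operator is defined with the chart [chart_at p]. On the overlap, the function read in that
    chart is the one read in chart [i] composed with the transition; elsewhere the inverse charts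
    are arbitrary, so germs are compared. *)
Lemma laplace_beltramiE (phi : S -> R) i p : smooth_function phi ->
  chart_dom (atlas i) p ->
  laplace_beltrami g phi p =
  chart_laplacian g i (phi \o chart_inv (atlas i)) (chart_map (atlas i) p).
Proof.
move=> sphi ip; rewrite /laplace_beltrami.
have jp : chart_dom (atlas (chart_at p)) p by exact: (projT2 (cid (atlas_cover p))).
set j := chart_at p in jp *.
have ox := overlapP jp ip.
have [jx ix] := overlap_img ox.
have [Hv H1 H2] := smooth_function_grad sphi ix.
have L := chart_laplacian_transition ox Hv H1 H2.
rewrite (transitionE (atlas i) jp) in L; rewrite -{}L.
have E : \forall y \near chart_map (atlas j) p, (phi \o chart_inv (atlas j)) y =
    ((phi \o chart_inv (atlas i)) \o transition (atlas j) (atlas i)) y.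
  have := near_overlap ox; apply: filterS => _ [q [jq iq] <-].
  by rewrite /transition /= !chart_mapK.
have [Hw K1 K2] := smooth_function_grad sphi jx.
have Hw' : \forall y \near chart_map (atlas j) p,
    has_grad (phi \o chart_inv (atlas i) \o transition (atlas j) (atlas i)) y
    (partial ord0 (phi \o chart_inv (atlas j)) y) (partial ord_max (phi \o chart_inv (atlas j)) y).
  apply: filterS2 Hw (nbhs_interior E) => y Hy Ey.
  exact: (near_has_grad Ey Hy).
by rewrite (chart_laplacianE jx Hw K1 K2) (chart_laplacianE jx Hw' K1 K2).
Qed.

End Laplacian.

(** * Consequences of the maximum principle *)

Section Boxes.
Context {R : realType}.
Implicit Types (x y : R * R) (s : R).

Lemma norm_pair_le x s : (`|x| <= s) <-> `|x.1| <= s /\ `|x.2| <= s.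
Proof. by rewrite norm_pair ge_max; split => [/andP|[-> ->]]. Qed.

Lemma box_compact x s : compact [set y : R * R | `|y - x| <= s].
Proof.
have -> : [set y : R * R | `|y - x| <= s] =
    `[x.1 - s, x.1 + s]%classic `*` `[x.2 - s, x.2 + s]%classic.
  apply/seteqP; split => y /=; rewrite norm_pair_le /= !in_itv /= !ler_distl //.
by apply: compact_setX; exact: segment_compact.
Qed.

Lemma dist_box_continuous x : continuous (fun y : R * R => `|y - x|).
Proof.
move=> y; apply: (@continuous_comp _ _ _ (fun y : R * R => y - x) Num.norm).
  by apply: cvgB; [exact: cvg_id|exact: cvg_cst].
exact: norm_continuous.
Qed.

Lemma box_boundary_compact x s : compact [set y : R * R | `|y - x| = s].
Proof.
apply: subclosed_compact (@box_compact x s) _; last by move=> y /= ->.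
rewrite (_ : [set y | _] = (fun y : R * R => `|y - x|) @^-1` [set s]) //.
by apply: closed_comp => [y _|]; [exact: dist_box_continuous|exact: closed_eq].
Qed.

Definition sqdist x y : R := (y.1 - x.1) * (y.1 - x.1) + (y.2 - x.2) * (y.2 - x.2).

Lemma has_grad_sqdist x y :
  has_grad (sqdist x) y (2 * (y.1 - x.1)) (2 * (y.2 - x.2)).
Proof.
have H1 := has_gradB (has_grad_fst y) (has_grad_cst x.1 y).
have H2 := has_gradB (has_grad_snd y) (has_grad_cst x.2 y).
by apply: has_grad_eq (has_gradD (has_gradM H1 H1) (has_gradM H2 H2)) _ _; ring.
Qed.

Lemma has_grad_sqdist1 x y : has_grad (fun y => 2 * (y.1 - x.1)) y 2 0.
Proof.
have H1 := has_gradB (has_grad_fst y) (has_grad_cst x.1 y).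
by apply: has_grad_eq (has_gradM (has_grad_cst 2 y) H1) _ _; ring.
Qed.

Lemma has_grad_sqdist2 x y : has_grad (fun y => 2 * (y.2 - x.2)) y 0 2.
Proof.
have H1 := has_gradB (has_grad_snd y) (has_grad_cst x.2 y).
by apply: has_grad_eq (has_gradM (has_grad_cst 2 y) H1) _ _; ring.
Qed.

Lemma sqdist_ge0 x y : 0 <= sqdist x y.
Proof. by rewrite /sqdist -!expr2 addr_ge0 ?sqr_ge0. Qed.

Lemma sqdist_le x y s : `|y - x| <= s -> sqdist x y <= 2 * (s * s).
Proof.
move=> /norm_pair_le[/= h1 h2]; rewrite /sqdist.
have a1 := normr_ge0 (y.1 - x.1); have a2 := normr_ge0 (y.2 - x.2).
have b1 : (y.1 - x.1) * (y.1 - x.1) <= s * s.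
  by rewrite -expr2 -real_normK ?num_real // expr2; exact: ler_pM.
have b2 : (y.2 - x.2) * (y.2 - x.2) <= s * s.
  by rewrite -expr2 -real_normK ?num_real // expr2; exact: ler_pM.
lra.
Qed.

Lemma norm_le_sqdist x y s : 0 <= s -> sqdist x y <= s * s -> `|y - x| <= s.
Proof.
move=> s0; rewrite /sqdist => H; apply/norm_pair_le => /=.
have q1 := sqr_ge0 (y.1 - x.1); have q2 := sqr_ge0 (y.2 - x.2).
rewrite expr2 in q1; rewrite expr2 in q2.
by split; rewrite -(ger0_norm s0) -ler_sqr ?qualifE /= // !real_normK ?num_real // !expr2; lra.
Qed.

(* The boundary of a square is connected, in the form of a sign statement. *)
Lemma box_boundary_sign (u : R * R -> R) x s : 0 < s ->
  (forall y, `|y - x| <= s -> {for y, continuous u}) ->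
  (forall y, `|y - x| = s -> u y != 0) ->
  (forall y, `|y - x| = s -> 0 < u y) \/ (forall y, `|y - x| = s -> u y < 0).
Proof.
move=> s0 uc u0.
(* Both points lie on one side of the square. The segment between them stays in the boundary, where
   [u] has no zero, so the intermediate value theorem gives them the same sign. *)
pose edge (a b : R * R) := (a.1 = b.1 /\ `|a.1 - x.1| = s) \/ (a.2 = b.2 /\ `|a.2 - x.2| = s).
have edgeP a b : `|a - x| <= s -> `|b - x| <= s -> edge a b -> 0 < u a * u b.
  move=> ax bx eab.
  pose c (t : R) : R * R := (a.1 + t * (b.1 - a.1), a.2 + t * (b.2 - a.2)).
  have /norm_pair_le[/= a1 a2] := ax; have /norm_pair_le[/= b1 b2] := bx.
  have convex (p q r t : R) : 0 <= t <= 1 -> `|p - r| <= s -> `|q - r| <= s ->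
      `|p + t * (q - p) - r| <= s.
    move=> /andP[t0 t1]; rewrite !ler_distl => /andP[p1 p2] /andP[q1 q2].
    by apply/andP; split; nra.
  have cx t : 0 <= t <= 1 -> `|c t - x| <= s.
    by move=> t01; apply/norm_pair_le; split; apply: convex.
  have cbd t : 0 <= t <= 1 -> `|c t - x| = s.
    move=> t01; apply/eqP; rewrite eq_le cx //=.
    case: eab => [[e1 e2]|[e1 e2]].
      by rewrite -[X in X <= _]e2; apply: le_trans (norm_fst_le _); rewrite /= e1 subrr mulr0 addr0.
    by rewrite -[X in X <= _]e2; apply: le_trans (norm_snd_le _); rewrite /= e1 subrr mulr0 addr0.
  have cc : continuous c.
    move=> t; have L (p q : R) : (fun t : R => p + t * q) @ t --> p + t * q.
      by apply: cvgD; [exact: cvg_cst|apply: cvgM; [exact: cvg_id|exact: cvg_cst]].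
    have P := cvg_pair (L a.1 (b.1 - a.1)) (L a.2 (b.2 - a.2)).
    exact: (P _ _ _).
  have c0 : c 0 = a by rewrite /c !mul0r !addr0 -surjective_pairing.
  have c1 : c 1 = b by rewrite /c !mul1r !(addrC _ (_ - _)) !subrK -surjective_pairing.
  have ucc : {within `[0, 1], continuous (u \o c)}.
    apply: continuous_in_subspaceT => t; rewrite inE /= in_itv /= => t01.
    by apply: continuous_comp; [exact: cc|apply: uc; exact: cx].
  rewrite ltNge; apply/negP => uab.
  have [|t] := @IVT R (u \o c) 0 1 0 ler01 ucc.
    rewrite /= c0 c1; have [h|/ltW h] := leP (u a) (u b).
      by apply/andP; split; nra.
    by apply/andP; split; nra.
  by rewrite in_itv /= => /cbd /u0 /eqP.
(* Every side is linked to the corner [cor s s], the two sides that do not contain it through one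
   more corner. *)
pose cor (p q : R) : R * R := (x.1 + p, x.2 + q).
have ns : `|- s| = s by rewrite normrN gtr0_norm.
have ps : `|s| = s by rewrite gtr0_norm.
have cp (p q : R) : `|p| = s -> `|q| = s -> `|cor p q - x| <= s.
  by move=> pE qE; apply/norm_pair_le; rewrite /= !(addrC x.1) !(addrC x.2) !addrK pE qE.
have dE (p q : R) : p + q - p = q by ring.
have e1 : 0 < u (cor s s) * u (cor s (- s)).
  by apply: edgeP; rewrite ?cp //; left; rewrite /= dE.
have e2 : 0 < u (cor s s) * u (cor (- s) s).
  by apply: edgeP; rewrite ?cp //; right; rewrite /= dE.
have main y : `|y - x| = s -> 0 < u y * u (cor s s).
  move=> yx; have yle : `|y - x| <= s by rewrite yx.
  have : `|y.1 - x.1| = s \/ `|y.2 - x.2| = s.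
    move: yx; rewrite norm_pair /=; case: leP => _; [by right|by left].
  have sc (v w z : R) : 0 < v * w -> 0 < z * w -> 0 < v * z by nra.
  case=> yE.
    have [pos|neg] := leP 0 (y.1 - x.1).
      apply: edgeP; rewrite ?cp //; left; split => //=.
      by rewrite -yE ger0_norm //; ring.
    apply: (sc _ (u (cor (- s) s))) => //; apply: edgeP; rewrite ?cp //; left; split => //=.
    by rewrite -yE ltr0_norm //; ring.
  have [pos|neg] := leP 0 (y.2 - x.2).
    apply: edgeP; rewrite ?cp //; right; split => //=.
    by rewrite -yE ger0_norm //; ring.
  apply: (sc _ (u (cor s (- s)))) => //; apply: edgeP; rewrite ?cp //; right; split => //=.
  by rewrite -yE ltr0_norm //; ring.
have [neg|pos] := leP (u (cor s s)) 0.
  by right => y /main; nra.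
by left => y /main; nra.
Qed.

End Boxes.

(** * Algebraic inequalities for the maximum principle *)

Section EllipticEstimates.
Context {R : realType}.
Implicit Types (K A B D d h b p q s m w l e Q ae : R).

Lemma elliptic_min_metric A B D d h11 h12 h22 b0 b1 : 0 < D -> 0 < d ->
  d = A * D - B * B ->
  (forall p q : R, 0 <= h11 * (p * p) + h12 * (p * q) + h22 * (q * q)) ->
  0 <= D / d * h11 - B / d * h12 + A / d * h22 + b0 * 0 + b1 * 0.
Proof.
move=> D0 d0 dE H; rewrite !mulr0 !addr0 -mulNr.
apply: elliptic_min => //; first by rewrite divr_gt0.
rewrite (_ : _ - _ = d^-1) ?invr_gt0 //.
by rewrite dE in d0 *; field; rewrite gt_eqF.
Qed.

(** The least eigenvalue of the inverse metric is at least the inverse of the trace of the metric.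
    The identity in the proof is the Cayley-Hamilton relation for the adjugate:
    [tr <v, adj v> = det |v|^2 + |adj v|^2]. *)
Lemma inverse_metric_coercive K A B D d p q : 0 < A -> 0 < D -> A <= K -> D <= K ->
  0 < d -> d = A * D - B * B ->
  (p * p + q * q) / (2 * K) <=
    D / d * (p * p) - B / d * (2 * (p * q)) + A / d * (q * q).
Proof.
move=> A0 D0 AK DK d0 dE.
have AD0 : 0 < A + D by lra.
have q0 : 0 <= p * p + q * q by rewrite -!expr2 addr_ge0 ?sqr_ge0.
apply: (@le_trans _ _ ((p * p + q * q) / (A + D))).
  have ADK : A + D <= 2 * K by lra.
  by rewrite ler_wpM2l // lef_pV2 ?posrE //; exact: lt_le_trans ADK.
have -> : D / d * (p * p) - B / d * (2 * (p * q)) + A / d * (q * q) =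
   (D * (p * p) - B * (2 * (p * q)) + A * (q * q)) / d.
  by field; rewrite gt_eqF.
rewrite ler_pdivrMr // mulrAC ler_pdivlMr //.
have -> : (D * (p * p) - B * (2 * (p * q)) + A * (q * q)) * (A + D) =
   (p * p + q * q) * d + ((D * p - B * q) ^+ 2 + (A * q - B * p) ^+ 2).
  by rewrite dE; ring.
by rewrite lerDl addr_ge0 ?sqr_ge0.
Qed.

(** The expression bounded is the Laplacian of [sqdist]: twice the trace of the inverse metric,
    which lies between [1 / K] and [2 K^2], plus drift terms of size at most [4 K s]. *)
Lemma inverse_metric_sqdist K A B D d b0 b1 p q s : 1 <= K ->
  0 < A -> 0 < D -> A <= K -> D <= K ->
  0 < d -> d = A * D - B * B -> d^-1 <= K -> `|b0| <= K -> `|b1| <= K ->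
  `|p| <= s -> `|q| <= s -> s <= 1 ->
  2 / K - 4 * K * s <= D / d * 2 - B / d * 0 + A / d * 2 + b0 * (2 * p) + b1 * (2 * q) /\
  D / d * 2 - B / d * 0 + A / d * 2 + b0 * (2 * p) + b1 * (2 * q) <= 8 * (K * K).
Proof.
move=> K1 A0 D0 AK DK d0 dE dK b0K b1K ps qs s1.
have K0 : 0 < K by lra.
have s0 : 0 <= s by apply: le_trans ps.
have trM v w : `|v| <= K -> `|w| <= s -> - (K * s) <= v * w <= K * s.
  by move=> vK ws; rewrite -ler_norml normrM; exact: ler_pM.
have /andP[m1 m2] := trM b0 p b0K ps; have /andP[m3 m4] := trM b1 q b1K qs.
have -> : D / d * 2 - B / d * 0 + A / d * 2 + b0 * (2 * p) + b1 * (2 * q) =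
   2 * ((A + D) / d) + 2 * (b0 * p) + 2 * (b1 * q) by ring.
have tr_le : (A + D) / d <= 2 * (K * K).
  have AD : A + D <= K + K by lra.
  have AD0 : 0 <= A + D by lra.
  have : (A + D) / d <= (K + K) * K by apply: ler_pM; rewrite // invr_ge0 ltW.
  lra.
have tr_ge : K^-1 <= (A + D) / d.
  have k1 := @inverse_metric_coercive K A B D d 1 0 A0 D0 AK DK d0 dE.
  have k2 := @inverse_metric_coercive K A B D d 0 1 A0 D0 AK DK d0 dE.
  have e1 : (1 * 1 + 0 * 0) / (2 * K) + (0 * 0 + 1 * 1) / (2 * K) = K^-1 by field; rewrite gt_eqF.
  rewrite -e1; apply: le_trans (lerD k1 k2) _.
  by rewrite le_eqVlt; apply/orP; left; apply/eqP; ring.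
have : K * s <= K * K by rewrite ler_pM2l //; lra.
by move=> Ks; split; lra.
Qed.

(** The left side is the Laplacian of [u - e - m w] at the minimum, after use of the equation. The
    hypotheses give [l >= 1 / K] and [mu2 w <= 1 / (2 K)], so the negative factor [m] decides the
    sign. *)
Lemma barrier_strict K (mu2 : R) m w l e s : 1 <= K -> 0 < s -> 4 * (K * K) * s <= 1 ->
  0 <= mu2 -> mu2 * (s * s) * (8 * K) <= 1 -> 2 / K - 4 * K * s <= l ->
  w <= 4 * (s * s) -> m < 0 -> 0 < e ->
  - (mu2 * (e + m * w)) + m * l < 0.
Proof.
move=> K1 s0 sK mu2_ge0 muK l1 w4 m0 e0.
have K0 : 0 < K by lra.
have KV0 : 0 < K^-1 by rewrite invr_gt0.
have t1 : mu2 * w <= K^-1 / 2.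
  apply: le_trans (ler_wpM2l mu2_ge0 w4) _.
  by rewrite ler_pdivlMr // -[X in _ <= X]mul1r ler_pdivlMr //; lra.
have t2 : 4 * K * s <= K^-1.
  by rewrite -[X in _ <= X]mul1r ler_pdivlMr //; lra.
have t3 : 0 < l - mu2 * w by lra.
have : m * (l - mu2 * w) < 0 by rewrite nmulr_rlt0.
have : 0 <= mu2 * e by rewrite mulr_ge0 // ltW.
lra.
Qed.

(** With [Q = th s^2] and [W = K^3 th >= th], the claim follows from [26 W^2 - 20 W + 4 > 0]; 26 is
    the first integer that makes this discriminant negative. *)
Lemma bump_strict K (mu2 : R) Q l ae s : 1 <= K -> 0 < s -> 26 * K ^+ 5 <= mu2 * (s * s) ->
  0 < Q -> Q <= s * s -> l <= 8 * (K * K) -> (s * s - Q) / (2 * K) <= ae ->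
  - (mu2 * (Q * Q)) + 2 * Q * l - 8 * ae < 0.
Proof.
move=> K1 s0 muK q0 qs l2 l3.
have K0 : 0 < K by lra.
have ss0 : 0 < s * s by rewrite mulr_gt0.
pose th := Q / (s * s).
have QE : Q = th * (s * s) by rewrite /th divfK // gt_eqF.
have th0 : 0 < th by rewrite /th divr_gt0.
have th1 : th <= 1 by rewrite /th ler_pdivrMr // mul1r.
move: th QE th0 th1 => th QE th0 th1.
have l4 : 2 * Q * l <= 2 * Q * (8 * (K * K)) by rewrite ler_pM2l // mulr_gt0.
have muQ : (26 * K ^+ 5) * (th * th * (s * s)) <= mu2 * (Q * Q).
  have -> : mu2 * (Q * Q) = (mu2 * (s * s)) * (th * th * (s * s)) by rewrite QE; ring.
  by apply: ler_wpM2r => //; apply: ltW; rewrite !mulr_gt0.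
have l5 : 4 * (1 - th) / K * (s * s) <= 8 * ae.
  have -> : 4 * (1 - th) / K * (s * s) = 8 * ((s * s - Q) / (2 * K)).
    by rewrite QE; field; rewrite gt_eqF.
  by rewrite ler_pM2l.
have key : 0 < 26 * K ^+ 5 * (th * th) + 4 * (1 - th) / K - 16 * (K * K) * th.
  have -> : 26 * K ^+ 5 * (th * th) + 4 * (1 - th) / K - 16 * (K * K) * th =
     (26 * (K ^+ 3 * th) ^+ 2 + 4 * (1 - th) - 16 * (K ^+ 3 * th)) / K.
    by field; rewrite gt_eqF.
  rewrite divr_gt0 //.
  have : th <= K ^+ 3 * th by rewrite ler_peMl ?exprn_ege1 // ltW.
  move: (K ^+ 3 * th) => W thW.
  have : 0 <= (26 * W - 10) ^+ 2 by rewrite sqr_ge0.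
  by rewrite expr2; nra.
have := mulr_gt0 key ss0.
have -> : (26 * K ^+ 5 * (th * th) + 4 * (1 - th) / K - 16 * (K * K) * th) * (s * s) =
  (26 * K ^+ 5) * (th * th * (s * s)) + 4 * (1 - th) / K * (s * s) - 2 * Q * (8 * (K * K)).
  by rewrite QE; ring.
move: muQ l4 l5.
move: ((26 * K ^+ 5) * (th * th * (s * s))) (4 * (1 - th) / K * (s * s)) (2 * Q * (8 * (K * K))) => a b c h1 h2 h3 h4; lra.
Qed.

End EllipticEstimates.

(** * Zeros of solutions of the Helmholtz equation *)

Section MaximumPrinciple.
Context {R : realType} {S : closed_surface R} (g : riemannian_metric S).
Implicit Types (i : 'I_(atlas_size S)) (x y : R * R) (K mu s : R).

(** All the information on the metric that the estimates use; the bound on [1 / gdet] keeps the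
    metric away from degenerate ones. Membership in the chart image is included because the
    coefficients are arbitrary elsewhere. *)
Definition geom_bound K i y :=
  [/\ chart_img (atlas i) y, gA g i y <= K /\ gD g i y <= K, (gdet g i y)^-1 <= K,
     `|drift0 g i y| <= K & `|drift1 g i y| <= K].

(** Here [h12] stands for the sum of the two mixed derivatives. *)
Definition lap_coef i y (h11 h12 h22 u1 u2 : R) :=
  gD g i y / gdet g i y * h11 - gB g i y / gdet g i y * h12
     + gA g i y / gdet g i y * h22 + drift0 g i y * u1 + drift1 g i y * u2.

(** The equation at a point with the derivatives of [u] as witnesses, so that it passes to [- u] by
    the gradient rules alone. *)
Definition helmholtz i mu (u : R * R -> R) y :=
  exists u1 u2 : R * R -> R, exists h11 h12 h21 h22 : R,
  [/\ \forall z \near y, has_grad u z (u1 z) (u2 z),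
      has_grad u1 y h11 h12, has_grad u2 y h21 h22 &
      lap_coef i y h11 (h12 + h21) h22 (u1 y) (u2 y) + mu ^+ 2 * u y = 0].

Lemma helmholtzN i mu u y : helmholtz i mu u y -> helmholtz i mu (fun z => - u z) y.
Proof.
move=> [u1 [u2 [h11 [h12 [h21 [h22 [H H1 H2 E]]]]]]].
exists (fun z => - u1 z), (fun z => - u2 z), (- h11), (- h12), (- h21), (- h22).
split; [|exact: has_gradN..|].
  by apply: filterS H => z; exact: has_gradN.
by rewrite -[RHS]oppr0 -E /lap_coef; ring.
Qed.

Lemma helmholtz_continuous i mu u y : helmholtz i mu u y -> {for y, continuous u}.
Proof.
by move=> [u1 [u2 [? [? [? [? [/nbhs_singleton /has_grad_continuous]]]]]]].
Qed.

Lemma eigenfunction_helmholtz mu (phi : S -> R) i y : eigenfunction g mu phi ->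
  chart_img (atlas i) y -> helmholtz i mu (phi \o chart_inv (atlas i)) y.
Proof.
move=> [sphi _ eq] iy; have [Hu H1 H2] := smooth_function_grad sphi iy.
do 6!eexists; split; [exact: Hu|exact: H1|exact: H2|].
have [ip pE] := chart_invK iy.
have := eq (chart_inv (atlas i) y); rewrite (laplace_beltramiE g sphi ip) pE.
by rewrite (chart_laplacianE g iy Hu H1 H2).
Qed.

Lemma lap_coef_min i y (z z1 z2 : R * R -> R) h11 h12 h21 h22 :
  chart_img (atlas i) y ->
  (\forall t \near y, has_grad z t (z1 t) (z2 t)) ->
  has_grad z1 y h11 h12 -> has_grad z2 y h21 h22 ->
  (\forall t \near y, z y <= z t) ->
  0 <= lap_coef i y h11 (h12 + h21) h22 (z1 y) (z2 y).
Proof.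
move=> iy Hz H1 H2 m; have [-> -> H] := min_hessian Hz H1 H2 m.
exact: elliptic_min_metric (gD_gt0 g iy) (gdet_gt0 g iy) erefl H.
Qed.

Lemma lap_coef_sqdist_bounds K i x y s : 1 <= K -> geom_bound K i y ->
  `|y - x| <= s -> s <= 1 ->
  [/\ 2 / K - 4 * K * s <= lap_coef i y 2 0 2 (2 * (y.1 - x.1)) (2 * (y.2 - x.2)),
      lap_coef i y 2 0 2 (2 * (y.1 - x.1)) (2 * (y.2 - x.2)) <= 8 * (K * K) &
     sqdist x y / (2 * K) <= gD g i y / gdet g i y * ((y.1 - x.1) * (y.1 - x.1))
       - gB g i y / gdet g i y * (2 * ((y.1 - x.1) * (y.2 - x.2)))
       + gA g i y / gdet g i y * ((y.2 - x.2) * (y.2 - x.2))].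
Proof.
move=> K1 [iy [AK DK] dK b0K b1K] /norm_pair_le[/= h1 h2] s1.
have A0 := gA_gt0 g iy; have D0 := gD_gt0 g iy; have d0 := gdet_gt0 g iy.
have [l1 l2] := inverse_metric_sqdist K1 A0 D0 AK DK d0 erefl dK b0K b1K h1 h2 s1.
split; [exact: l1|exact: l2|exact: inverse_metric_coercive].
Qed.

(* At a negative minimum [m] of [(u - e) / w], where [w y = 4 s^2 - sqdist x y], the
   function [u - e - m w] has minimum 0, which contradicts the equation since the
   Laplacian of [w] is very negative compared with [mu^2 w]. *)
Lemma helmholtz_lower_bound K i mu u x s e : 1 <= K -> 0 < s ->
  4 * (K * K) * s <= 1 -> mu ^+ 2 * (s * s) * (8 * K) <= 1 ->
  (forall y, `|y - x| <= s -> geom_bound K i y /\ helmholtz i mu u y) ->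
  0 < e -> (forall y, `|y - x| = s -> e <= u y) -> e <= u x.
Proof.
move=> K1 s0 sK muK H e0 He.
have K0 : 0 < K by lra.
have KK : 1 <= K * K by nra.
have s1 : s <= 1 by nra.
(* On the square [sqdist] is at most [2 s^2], its value at the corners; the constant [4 s^2] keeps
   [w] between [2 s^2] and [4 s^2]. *)
pose w y := 4 * (s * s) - sqdist x y.
have w0 y : `|y - x| <= s -> 2 * (s * s) <= w y /\ w y <= 4 * (s * s).
  by move=> /sqdist_le; have := sqdist_ge0 x y; rewrite /w; lra.
have ss0 : 0 < s * s by rewrite mulr_gt0.
have wgrad y : has_grad w y (0 - 2 * (y.1 - x.1)) (0 - 2 * (y.2 - x.2)).
  exact: has_gradB (has_grad_cst _ _) (has_grad_sqdist _ _).
pose f y := (u y - e) / w y.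
have fc : {within [set y : R * R | `|y - x| <= s], continuous f}.
  apply: continuous_in_subspaceT => y; rewrite inE /= => ys.
  have [_ /helmholtz_continuous uc] := H y ys.
  apply: cvgM; first by apply: cvgB => //; exact: cvg_cst.
  apply: cvgV; last exact: (has_grad_continuous (wgrad y)).
  by have [] := w0 y ys; lra.
have x_in : [set y : R * R | `|y - x| <= s] x by rewrite /= subrr normr0 ltW.
have [|y0] := compact_EVT_min _ (@box_compact _ x s) fc; first by exists x.
rewrite inE /= => y0s fmin.
have wpos y : `|y - x| <= s -> 0 < w y by move=> /w0; lra.
have [m0|m0] := leP 0 (f y0).
  have : 0 <= f x by apply: le_trans m0 (fmin x _); rewrite inE.
  have wx := wpos x x_in.
  by rewrite /f pmulr_lge0 ?invr_gt0 // subr_ge0.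
set m := f y0 in m0 fmin.
have y0in : `|y0 - x| < s.
  rewrite lt_neqAle y0s andbT; apply/eqP => /He ey.
  have wy := wpos _ y0s.
  by move: m0; rewrite /m /f pmulr_llt0 ?invr_gt0 // subr_lt0 ltNge ey.
have [gb [u1 [u2 [h11 [h12 [h21 [h22 [Hu H1 H2 E]]]]]]]] := H y0 y0s.
have [iy _ _ _ _] := gb.
pose z y := u y - e + m * sqdist x y - m * (4 * (s * s)).
have zE y : z y = u y - e - m * w y by rewrite /z /w; ring.
have nz : \forall t \near y0, has_grad z t (u1 t + m * (2 * (t.1 - x.1))) (u2 t + m * (2 * (t.2 - x.2))).
  apply: filterS Hu => t Ht.
  have := has_gradB (has_gradD (has_gradB Ht (has_grad_cst e t))
    (has_gradM (has_grad_cst m t) (has_grad_sqdist x t))) (has_grad_cst (m * (4 * (s * s))) t).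
  by move=> /has_grad_eq; apply; ring.
have L1 := has_gradD H1 (has_gradM (has_grad_cst m y0) (has_grad_sqdist1 x y0)).
have L2 := has_gradD H2 (has_gradM (has_grad_cst m y0) (has_grad_sqdist2 x y0)).
have zmin : \forall t \near y0, z y0 <= z t.
  have : nbhs y0 [set y | `|y - x| < s].
    apply: open_nbhs_nbhs; split => //.
    rewrite (_ : [set y | _] = (fun y : R * R => `|y - x|) @^-1` [set t | t < s]) //.
    by apply: open_comp => [t _|]; [exact: dist_box_continuous|exact: open_lt].
  apply: filterS => t /= /ltW ts.
  have := fmin t; rewrite inE /= => /(_ ts).
  have wt := wpos t ts; have wy := wpos y0 y0s.
  rewrite /f ler_pdivlMr // => ft; rewrite !zE.
  have : m * w y0 = u y0 - e by rewrite /m /f divfK // gt_eqF.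
  lra.
have := lap_coef_min iy nz L1 L2 zmin.
have [l1 _ _] := lap_coef_sqdist_bounds K1 gb y0s s1.
set l := lap_coef _ _ _ _ _ _ _ in l1.
have -> : lap_coef i y0 (h11 + (m * 2 + 2 * (y0.1 - x.1) * 0))
  (h12 + (m * 0 + 2 * (y0.1 - x.1) * 0) + (h21 + (m * 0 + 2 * (y0.2 - x.2) * 0)))
  (h22 + (m * 2 + 2 * (y0.2 - x.2) * 0)) (u1 y0 + m * (2 * (y0.1 - x.1)))
  (u2 y0 + m * (2 * (y0.2 - x.2))) =
  lap_coef i y0 h11 (h12 + h21) h22 (u1 y0) (u2 y0) + m * l.
  by rewrite /l /lap_coef; ring.
have uE : u y0 = e + m * w y0 by rewrite /m /f divfK ?gt_eqF ?wpos //; ring.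
have -> : lap_coef i y0 h11 (h12 + h21) h22 (u1 y0) (u2 y0) = - (mu ^+ 2 * u y0).
  by apply/eqP; rewrite -addr_eq0 E.
rewrite uE leNgt => /negP[].
have [_ w4] := w0 y0 y0s.
exact: barrier_strict K1 s0 sK (sqr_ge0 mu) muK l1 w4 m0 e0.
Qed.

(** Without a zero on the boundary, [u] has one sign there and by compactness stays away from 0 by
    some [e]; [helmholtz_lower_bound] for [u] or [- u] then forbids the value 0 at the centre. *)
Lemma helmholtz_boundary_zero K i mu u x s : 1 <= K -> 0 < s ->
  4 * (K * K) * s <= 1 -> mu ^+ 2 * (s * s) * (8 * K) <= 1 ->
  (forall y, `|y - x| <= s -> geom_bound K i y /\ helmholtz i mu u y) ->
  u x = 0 -> exists2 y, `|y - x| = s & u y = 0.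
Proof.
move=> K1 s0 sK muK H ux; apply: contrapT => noz.
have nz y : `|y - x| = s -> u y != 0.
  by move=> ys; apply/eqP => uy; apply: noz; exists y.
have uc y : `|y - x| <= s -> {for y, continuous u}.
  by move=> /H[_ /helmholtz_continuous].
have bd_ne : [set y : R * R | `|y - x| = s] !=set0.
  exists (x.1 + s, x.2); rewrite /= norm_pair /= subrr normr0 (addrC x.1) addrK.
  by rewrite gtr0_norm // (max_idPl _) // ltW.
have pos (v : R * R -> R) : (forall y, `|y - x| <= s -> helmholtz i mu v y) ->
    (forall y, `|y - x| = s -> 0 < v y) -> 0 < v x.
  move=> Hv vpos.
  have vc : {within [set y : R * R | `|y - x| = s], continuous v}.
    apply: continuous_in_subspaceT => y; rewrite inE /= => ys.
    by apply: helmholtz_continuous (Hv y _); rewrite ys.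
  have [y0] := compact_EVT_min bd_ne (@box_boundary_compact _ x s) vc.
  rewrite inE /= => y0s vmin.
  apply: lt_le_trans (vpos _ y0s) _.
  apply: (helmholtz_lower_bound K1 s0 sK muK (u := v)) (vpos _ y0s) _.
    by move=> y ys; split; [exact: (H y ys).1|exact: Hv].
  by move=> y ys; apply: vmin; rewrite inE.
have [up|un] := box_boundary_sign s0 uc nz.
  by have := pos u (fun y ys => (H y ys).2) up; rewrite ux ltxx.
have : 0 < - u x.
  apply: (pos (fun y => - u y)) => y ys; first exact: helmholtzN (H y ys).2.
  by rewrite oppr_gt0 un.
by rewrite ux oppr0 ltxx.
Qed.

(* If [u] had no zero, [f = (s^2 - sqdist x y)^2 / |u|] would have an interior maximum
   [m], and [m |u| - (s^2 - sqdist x y)^2] would have minimum 0 there. *)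
Lemma helmholtz_zero K i mu u x s : 1 <= K -> 0 < s -> s <= 1 ->
  26 * K ^+ 5 <= mu ^+ 2 * (s * s) ->
  (forall y, `|y - x| <= s -> geom_bound K i y /\ helmholtz i mu u y) ->
  exists2 y, `|y - x| <= s & u y = 0.
Proof.
move=> K1 s0 s1 muK H; apply: contrapT => noz.
have K0 : 0 < K by lra.
have nz y : `|y - x| <= s -> u y != 0.
  by move=> ys; apply/eqP => uy; apply: noz; exists y.
(* On the Euclidean disc inscribed in the square, [s^2 - sqdist] vanishes exactly on the boundary
   circle, so the maximum of [f] is interior. *)
pose E := [set y : R * R | sqdist x y <= s * s].
have sub y : E y -> `|y - x| <= s by apply: norm_le_sqdist; exact: ltW.
have Ec : compact E.
  apply: subclosed_compact (@box_compact _ x s) _ => //.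
  rewrite (_ : E = sqdist x @^-1` [set t | t <= s * s]) //.
  apply: closed_comp => [y _|]; last exact: closed_le.
  exact: has_grad_continuous (has_grad_sqdist x y).
pose q y := s * s - sqdist x y.
have qgrad y : has_grad q y (0 - 2 * (y.1 - x.1)) (0 - 2 * (y.2 - x.2)).
  exact: has_gradB (has_grad_cst _ _) (has_grad_sqdist _ _).
pose f y := q y * q y / `|u y|.
have fc : {within E, continuous f}.
  apply: continuous_in_subspaceT => y; rewrite inE /= => /sub ys.
  have [_ /helmholtz_continuous uc] := H y ys.
  have qc := has_grad_continuous (qgrad y).
  apply: cvgM; first exact: cvgM.
  by apply: cvgV; [rewrite normr_eq0; exact: nz|exact: (cvg_norm uc)].
have Ex : E x by rewrite /E /= /sqdist !subrr mulr0 addr0 mulr_ge0 // ltW.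
have [|y0] := compact_EVT_max _ Ec fc; first by exists x.
rewrite inE /= => y0E fmax.
have ss0 : 0 < s * s by rewrite mulr_gt0.
have unz y : E y -> 0 < `|u y| by move=> /sub /nz; rewrite normr_gt0.
have f0 : 0 < f y0.
  apply: lt_le_trans (fmax x _); last by rewrite inE.
  rewrite /f divr_gt0 ?unz // /q /sqdist !subrr mulr0 addr0 subr0 mulr_gt0 //.
have q0 : 0 < q y0.
  have : 0 <= q y0 by rewrite subr_ge0.
  rewrite le_eqVlt => /orP[/eqP qE|//].
  by move: f0; rewrite /f -qE mul0r mul0r ltxx.
have y0s := sub _ y0E.
have [gb Hh] := H y0 y0s; have [iy _ _ _ _] := gb.
pose sg : R := Num.sg (u y0).
have sgu : sg * u y0 = `|u y0| by rewrite /sg normrEsg.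
pose v y := sg * u y.
have Hv : helmholtz i mu v y0.
  have u0 := nz _ y0s; rewrite /v /sg.
  have [un|up|u00] := ltgtP (u y0) 0; last by rewrite u00 eqxx in u0.
    rewrite ltr0_sg // (_ : (fun y => -1 * u y) = (fun y => - u y)); last by apply/funext => y; rewrite mulN1r.
    exact: helmholtzN.
  by rewrite gtr0_sg // (_ : (fun y => 1 * u y) = u) //; apply/funext => y; rewrite mul1r.
have v0 : 0 < v y0 by rewrite /v sgu unz.
have vc := helmholtz_continuous Hv.
move: Hv => [v1 [v2 [h11 [h12 [h21 [h22 [Hv H1 H2 EQ]]]]]]].
set m := f y0 in f0.
have mE : m * v y0 = q y0 * q y0 by rewrite /m /f /v sgu divfK // gt_eqF // unz.
pose z y := m * v y - q y * q y.
have nz' : \forall t \near y0, has_grad z t (m * v1 t + 2 * (t.1 - x.1) * (2 * q t))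
     (m * v2 t + 2 * (t.2 - x.2) * (2 * q t)).
  apply: filterS Hv => t Ht.
  have := has_gradB (has_gradM (has_grad_cst m t) Ht) (has_gradM (qgrad t) (qgrad t)).
  by move=> /has_grad_eq; apply; ring.
have Q2 := has_gradM (has_grad_cst 2 y0) (qgrad y0).
have L1 := has_gradD (has_gradM (has_grad_cst m y0) H1) (has_gradM (has_grad_sqdist1 x y0) Q2).
have L2 := has_gradD (has_gradM (has_grad_cst m y0) H2) (has_gradM (has_grad_sqdist2 x y0) Q2).
have zmin : \forall t \near y0, z y0 <= z t.
  have qc := has_grad_continuous (qgrad y0).
  apply: filterS2 (cvgr_gt _ qc _ q0) (cvgr_gt _ vc _ v0) => t qt vt.
  have tE : E t by rewrite /E /= -subr_ge0 ltW.
  have := fmax t; rewrite inE => /(_ tE); rewrite /f -/m.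
  rewrite ler_pdivrMr ?unz // => h.
  have ut : v t = `|u t|.
    rewrite -[RHS]mul1r -[LHS](gtr0_norm vt) /v normrM; congr (_ * _).
    by rewrite /sg normr_sg nz.
  have {}h : q t * q t <= m * `|u t| by exact: h.
  by rewrite /z mE ut; lra.
have := lap_coef_min iy nz' L1 L2 zmin.
have [_ l2 l3] := lap_coef_sqdist_bounds K1 gb y0s s1.
set l := lap_coef _ _ _ _ _ _ _ in l2.
set ae := (X in _ <= X) in l3.
set X := lap_coef _ _ _ _ _ _ _.
(* The term [- 8 ae] comes from the gradient of the bump: [- q^2] contributes
   [- 2 g^-1(grad q, grad q)], and [grad q = - 2 (y - x)]. *)
have -> : X = m * lap_coef i y0 h11 (h12 + h21) h22 (v1 y0) (v2 y0) + 2 * q y0 * l - 8 * ae.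
  by rewrite /X /l /ae /lap_coef; ring.
have -> : lap_coef i y0 h11 (h12 + h21) h22 (v1 y0) (v2 y0) = - (mu ^+ 2 * v y0).
  by apply/eqP; rewrite -addr_eq0 EQ.
have -> : m * - (mu ^+ 2 * v y0) = - (mu ^+ 2 * (q y0 * q y0)) by rewrite -mE; ring.
rewrite leNgt => /negP[].
have sqE : sqdist x y0 = s * s - q y0 by rewrite /q; ring.
rewrite sqE in l3.
have qs : q y0 <= s * s by rewrite /q lerBlDr lerDl sqdist_ge0.
exact: bump_strict K1 s0 muK q0 qs l2 l3.
Qed.

Lemma smooth_function_continuous (phi : S -> R) : smooth_function phi -> continuous phi.
Proof.
move=> sphi p; have [i ip] := atlas_cover p.
have ix : chart_img (atlas i) (chart_map (atlas i) p) by exists p.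
have c1 := smooth_continuous (sphi i) ix.
have c2 := chart_map_continuous ip.
have c3 : {for p, continuous ((phi \o chart_inv (atlas i)) \o chart_map (atlas i))}.
  exact: continuous_comp.
have E : \forall q \near p, (phi \o chart_inv (atlas i) \o chart_map (atlas i)) q = phi q.
  have : nbhs p (chart_dom (atlas i)) by apply: open_nbhs_nbhs; split => //; exact: chart_dom_open.
  by apply: filterS => q iq; rewrite /= chart_mapK.
rewrite /prop_for /continuous_at -(nbhs_singleton E).
exact: cvg_trans (near_eq_cvg E) c3.
Qed.

(** At a nonzero minimum of [|phi|] over the compact surface, the positive one of [phi] and [- phi]
    would have a nonnegative Laplacian, which the equation makes negative. *)
Lemma eigenfunction_has_zero mu (phi : S -> R) : 0 < mu -> eigenfunction g mu phi ->
  exists p, phi p = 0.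
Proof.
move=> mu0 ef; have [sphi [p1 _] _] := ef; apply: contrapT => noz.
have nz p : phi p != 0 by apply/eqP => pz; apply: noz; exists p.
have phic := smooth_function_continuous sphi.
have ac : {within [set: S], continuous (fun p => `|phi p|)}.
  by apply: continuous_subspaceT => p; apply: cvg_norm; exact: phic.
have [|p0 _ pmin] := compact_EVT_min _ (surface_compact (c := S)) ac; first by exists p1.
have [i ip] := atlas_cover p0.
have iy : chart_img (atlas i) (chart_map (atlas i) p0) by exists p0.
set y0 := chart_map (atlas i) p0 in iy.
set u := phi \o chart_inv (atlas i).
have u0 : u y0 = phi p0 by rewrite /u /= chart_mapK.
have umin y : `|u y0| <= `|u y| by rewrite u0; apply: pmin; rewrite inE.
have Hh := eigenfunction_helmholtz ef iy.
have main (v : R * R -> R) : helmholtz i mu v y0 -> 0 < v y0 ->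
    (forall y, `|v y0| <= `|v y|) -> False.
  move=> Hv v0 vmin; have vc := helmholtz_continuous Hv.
  move: Hv => [v1 [v2 [h11 [h12 [h21 [h22 [Hv H1 H2 E]]]]]]].
  have nm : \forall t \near y0, v y0 <= v t.
    apply: filterS (cvgr_gt _ vc _ v0) => t vt.
    by have := vmin t; rewrite !gtr0_norm.
  have := lap_coef_min iy Hv H1 H2 nm.
  have : 0 < mu ^+ 2 * v y0 by rewrite mulr_gt0 // exprn_gt0.
  by lra.
have [un|up|uz] := ltgtP (u y0) 0.
- apply: (main (fun y => - u y)); first exact: helmholtzN.
    by rewrite oppr_gt0.
  by move=> y; rewrite !normrN.
- exact: (main u).
- by have := nz p0; rewrite -u0 uz eqxx.
Qed.

End MaximumPrinciple.

(** * Comparison of the Riemannian and coordinate distances *)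

Section IntegralBounds.
Import HBNNSimple.
Local Open Scope ereal_scope.
Context d (T : measurableType d) {R : realType} (mu : {measure set T -> \bar R}).

(* No measurability is assumed: the integral of a nonnegative function is a
   supremum over simple functions. *)
Lemma le_integral_pointwise (D : set T) (f1 f2 : T -> \bar R) :
  (forall x, D x -> 0 <= f1 x) -> (forall x, D x -> f1 x <= f2 x) ->
  \int[mu]_(x in D) f1 x <= \int[mu]_(x in D) f2 x.
Proof.
move=> f10 f12.
have f20 x : D x -> 0 <= f2 x by move=> Dx; exact: le_trans (f10 x Dx) (f12 x Dx).
rewrite (ge0_integralE _ f10) (ge0_integralE _ f20).
apply: ge_ereal_sup => _ [h /= hf <-]; apply: ereal_sup_ubound; exists h => //= x.
by apply: le_trans (hf x) _; apply: lee_restrict.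
Qed.

(** Here [f] will be the speed of a piecewise C^1 curve, so measurability is asked of its minorant
    [m] on [B] only. A simple function below [f] on [A] and [m] on [B] add up to a minorant of [f]
    on [D]. *)
Lemma ge0_integral_superadd (A B D : set T) (f m : T -> \bar R) :
  measurable B -> A `&` B = set0 -> A `|` B `<=` D ->
  (forall x, D x -> 0 <= f x) -> measurable_fun B m ->
  (forall x, B x -> 0 <= m x <= f x) -> \int[mu]_(x in B) m x < +oo ->
  \int[mu]_(x in A) f x + \int[mu]_(x in B) m x <= \int[mu]_(x in D) f x.
Proof.
move=> mB AB ABD f0 mm mf mfin.
have m0 x : B x -> 0 <= m x by move=> /mf/andP[].
have f0A x : A x -> 0 <= f x by move=> Ax; apply/f0/ABD; left.
have im0 : 0 <= \int[mu]_(x in B) m x by exact: integral_ge0.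
have imfin : \int[mu]_(x in B) m x \is a fin_num by rewrite ge0_fin_numE.
rewrite -leeBrDr // (ge0_integralE _ f0A).
apply: ge_ereal_sup => _ [h /= hf <-]; rewrite leeBrDr //.
rewrite -integralT_nnsfun [X in _ + X]integral_mkcond.
rewrite -ge0_integralD //=; last 4 first.
- by move=> x _; rewrite lee_fin; exact: fun_ge0.
- by apply/measurable_EFinP; exact: measurable_funTS.
- by move=> x _; exact: erestrict_ge0.
- by apply/(measurable_restrictT _ _).1.
rewrite [leRHS]integral_mkcond; apply: le_integral_pointwise => x _.
  by rewrite adde_ge0 ?lee_fin //; exact: erestrict_ge0.
have := hf x; rewrite /patch.
case: ifPn => [/set_mem Ax|/negP Ax] hx.
  have nB : x \notin B.
    by apply/negP => /set_mem Bx; have : (A `&` B) x by []; rewrite AB.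
  by rewrite (negbTE nB) adde0 ifT //; apply/mem_set/ABD; left.
case: ifPn => [/set_mem Bx|nB].
  rewrite ifT; last by apply/mem_set/ABD; right.
  by have /andP[_ mfx] := mf x Bx; rewrite -[leRHS]add0e leeD.
rewrite adde0; apply: le_trans hx _.
by case: ifPn => // /set_mem Dx; exact: f0.
Qed.

End IntegralBounds.

(** * Speed in an arbitrary chart and the upper bound for the distance *)

Section Speed.
Context {R : realType} {S : closed_surface R} (g : riemannian_metric S).
Implicit Types (i j : 'I_(atlas_size S)) (c : R -> S) (t : R).

Lemma gquad_transition i j x (p q : R) : overlap (atlas i) (atlas j) x ->
  gquad g i x p q = gquad g j (transition (atlas i) (atlas j) x)
     (tr_jac i j ord0 ord0 x * p + tr_jac i j ord0 ord_max x * q)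
     (tr_jac i j ord_max ord0 x * p + tr_jac i j ord_max ord_max x * q).
Proof.
move=> ox; have [EA EB ED _] := metric_transition g ox; rewrite /gquad EA EB ED.
move: (gA g j _) (gB g j _) (gD g j _) (tr_jac i j ord0 ord0 x) (tr_jac i j ord0 ord_max x).
move: (tr_jac i j ord_max ord0 x) (tr_jac i j ord_max ord_max x) => *; ring.
Qed.

Lemma local_curve_transition i j c t : {for t, continuous c} ->
  chart_dom (atlas i) (c t) -> chart_dom (atlas j) (c t) ->
  forall k, \forall s \near t, local_curve j c k s =
    tr_comp i j k (local_curve i c ord0 s, local_curve i c ord_max s).
Proof.
move=> cc ict jct k.
have n1 : nbhs (c t) (chart_dom (atlas i)).
  by apply: open_nbhs_nbhs; split => //; exact: chart_dom_open.
have n2 : nbhs (c t) (chart_dom (atlas j)).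
  by apply: open_nbhs_nbhs; split => //; exact: chart_dom_open.
have m1 : \forall s \near t, chart_dom (atlas i) (c s) := cc _ n1.
have m2 : \forall s \near t, chart_dom (atlas j) (c s) := cc _ n2.
apply: filterS2 m1 m2 => s /= i_s j_s.
rewrite /tr_comp /local_curve /= (_ : (_, _) = chart_map (atlas i) (c s)).
  by rewrite transitionE.
by rewrite [RHS]surjective_pairing.
Qed.

Lemma local_curve_is_derive i j c t (v0 v1 : R) : {for t, continuous c} ->
  chart_dom (atlas i) (c t) -> chart_dom (atlas j) (c t) ->
  is_derive t (1 : R) (local_curve i c ord0) v0 ->
  is_derive t (1 : R) (local_curve i c ord_max) v1 ->
  let x := chart_map (atlas i) (c t) in
  forall k, is_derive t (1 : R) (local_curve j c k)
    (tr_jac i j k ord0 x * v0 + tr_jac i j k ord_max x * v1).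
Proof.
move=> cc ict jct d0 d1 x k.
have E := local_curve_transition cc ict jct k.
apply: (near_eq_is_derive (f := fun s => tr_comp i j k (local_curve i c ord0 s, local_curve i c ord_max s))).
  by apply: filterS E => s ->.
apply: has_grad_curve d0 d1.
rewrite (_ : (_, _) = x); last by rewrite [RHS]surjective_pairing.
by apply: has_grad_tr_comp; exact: overlapP.
Qed.

(** [speed] uses the chart [chart_at (c t)]; the chain rule and the tensor law of the metric give
    the same value in every chart around the point. *)
Lemma speedE i c t (v0 v1 : R) : {for t, continuous c} ->
  chart_dom (atlas i) (c t) ->
  is_derive t (1 : R) (local_curve i c ord0) v0 ->
  is_derive t (1 : R) (local_curve i c ord_max) v1 ->
  speed g c t = Num.sqrt (gquad g i (chart_map (atlas i) (c t)) v0 v1).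
Proof.
move=> cc ict d0 d1; rewrite /speed.
have jct : chart_dom (atlas (chart_at (c t))) (c t) by exact: (projT2 (cid (atlas_cover (c t)))).
set j := chart_at (c t) in jct *.
have D := local_curve_is_derive cc ict jct d0 d1.
have [_ E0] := D ord0; have [_ E1] := D ord_max.
rewrite metric_quadE; last by exists (c t).
by rewrite !mxE !derive1E E0 E1 (gquad_transition _ _ (overlapP ict jct)) transitionE.
Qed.

Lemma speed_ge0 c t : 0 <= speed g c t.
Proof. exact: sqrtr_ge0. Qed.

(** The form and its adjugate add up to [(gA + gD) (p^2 + q^2)], and the adjugate is nonnegative. *)
Lemma gquad_le K i y (p q : R) : chart_img (atlas i) y -> gA g i y <= K -> gD g i y <= K ->
  gquad g i y p q <= 2 * K * (p * p + q * q).
Proof.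
move=> iy; rewrite /gquad.
have := gA_gt0 g iy; have := gD_gt0 g iy; have := gdet_gt0 g iy.
rewrite /gdet; move: (gA g i y) (gB g i y) (gD g i y) => A B D d0 D0 A0 AK DK.
have : 0 <= A * (A * (q * q) - 2 * B * (p * q) + D * (p * p)).
  have -> : A * (A * (q * q) - 2 * B * (p * q) + D * (p * p)) =
    (A * q - B * p) ^+ 2 + (A * D - B * B) * p ^+ 2 by ring.
  by rewrite addr_ge0 ?sqr_ge0 // mulr_ge0 ?sqr_ge0 // ltW.
rewrite pmulr_rge0 // => h.
have pp : 0 <= p * p by rewrite -expr2 sqr_ge0.
have qq : 0 <= q * q by rewrite -expr2 sqr_ge0.
have : (A + D) * (p * p + q * q) <= 2 * K * (p * p + q * q).
  by rewrite ler_wpM2r ?addr_ge0 //; lra.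
lra.
Qed.

(** Divided by its determinant, the metric has the shape of an inverse metric with diagonal entries
    exchanged and the sign of [gB] reversed, so [inverse_metric_coercive] applies to it. *)
Lemma gquad_ge K i y (p q : R) : 1 <= K -> geom_bound g K i y ->
  p * p + q * q <= 2 * (K * K) * gquad g i y p q.
Proof.
move=> K1 [iy [AK DK] dK _ _]; rewrite /gquad.
have := gA_gt0 g iy; have := gD_gt0 g iy; have := gdet_gt0 g iy.
move: AK DK dK; rewrite /gdet; move: (gA g i y) (gB g i y) (gD g i y).
move=> A B D AK DK dK d0 D0 A0.
set d := A * D - B * B in dK d0.
have dE : d = A * D - B * B by [].
move: d dE dK d0 => d dE dK d0.
have key : (p * p + q * q) / (2 * K) <=
    A / d * (p * p) - (- B) / d * (2 * (p * q)) + D / d * (q * q).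
  by apply: inverse_metric_coercive => //; rewrite dE; ring.
have K0 : 0 < K by lra.
have Q0 : 0 <= A * (p * p) + (B + B) * (p * q) + D * (q * q).
  have : 0 <= A * (A * (p * p) + (B + B) * (p * q) + D * (q * q)).
    have -> : A * (A * (p * p) + (B + B) * (p * q) + D * (q * q)) =
      (A * p + B * q) ^+ 2 + d * q ^+ 2 by rewrite dE; ring.
    by rewrite addr_ge0 ?sqr_ge0 // mulr_ge0 ?sqr_ge0 // ltW.
  by rewrite pmulr_rge0.
move: key.
have -> : A / d * (p * p) - - B / d * (2 * (p * q)) + D / d * (q * q) =
  (A * (p * p) + (B + B) * (p * q) + D * (q * q)) * d^-1 by ring.
rewrite ler_pdivrMr ?mulr_gt0 // => key.
have := ler_wpM2l Q0 dK; set Q := A * _ + _ + _ in Q0 key *.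
move=> h.
have : Q * d^-1 * (2 * K) <= Q * K * (2 * K) by rewrite ler_pM2r // mulr_gt0.
lra.
Qed.

Lemma abs_velocity_le K i y (p q : R) : 1 <= K -> geom_bound g K i y ->
  `|p| <= 2 * K * Num.sqrt (gquad g i y p q) /\ `|q| <= 2 * K * Num.sqrt (gquad g i y p q).
Proof.
move=> K1 gb; have H := gquad_ge p q K1 gb.
have aux (u v Q : R) : u * u + v * v <= 2 * (K * K) * Q -> `|u| <= 2 * K * Num.sqrt Q.
  move=> {}H.
  have uu : 0 <= u * u by rewrite -expr2 sqr_ge0.
  have vv : 0 <= v * v by rewrite -expr2 sqr_ge0.
  have Q0 : 0 <= Q.
    have : 0 <= 2 * (K * K) * Q by lra.
    by rewrite pmulr_rge0 //; nra.
  have r0 := sqrtr_ge0 Q; have rE := sqr_sqrtr Q0; rewrite expr2 in rE.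
  have R0 : 0 <= 2 * K * Num.sqrt Q by rewrite !mulr_ge0 //; lra.
  have KKQ : 0 <= K * K * Q by rewrite !mulr_ge0 //; lra.
  have RR : (2 * K * Num.sqrt Q) * (2 * K * Num.sqrt Q) = 4 * (K * K) * Q.
    by rewrite -[in RHS]rE; ring.
  rewrite -(ger0_norm R0) -ler_sqr ?qualifE /= // !real_normK ?num_real // !expr2 RR.
  lra.
by split; [exact: aux H|apply: (aux q p); rewrite addrC].
Qed.

Lemma near_chart_dom i (p : S) : chart_dom (atlas i) p -> nbhs p (chart_dom (atlas i)).
Proof. by move=> ip; apply: open_nbhs_nbhs; split => //; exact: chart_dom_open. Qed.

(* [ramp] is a smooth function with values in [[0, 1]] on the whole line, so that a
   segment of coordinates parametrized by it is a C^1 curve that stays in the chart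
   for all times. *)
Definition ramp (t : R) : R := (1 - cos (pi * t)) / 2.
Definition ramp' (t : R) : R := pi / 2 * sin (pi * t).

Lemma ramp_is_derive t : is_derive t (1 : R) ramp (ramp' t).
Proof.
have D1 : is_derive t (1 : R) (fun s => pi * s) pi.
  have -> : (fun s : R => pi * s) = cst pi * id by apply/funext.
  by apply: is_derive_eq; rewrite /GRing.scale /= mulr0 addr0 mulr1.
have D2 := is_derive1_comp (is_derive_cos (pi * t)) D1.
have -> : ramp = (cst 1 - (cos \o (fun s => pi * s))) * cst (2^-1) by apply/funext.
by apply: is_derive_eq; rewrite /GRing.scale /= /ramp'; ring.
Qed.

Lemma ramp_bounds t : 0 <= ramp t <= 1.
Proof.
rewrite /ramp; have := cos_le1 (pi * t); have := cos_geN1 (pi * t).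
by move=> h1 h2; apply/andP; split; lra.
Qed.

Lemma ramp'_bound t : `|ramp' t| <= 2.
Proof.
rewrite /ramp' normrM (ger0_norm (ltW _)) ?divr_gt0 ?pi_gt0 //.
rewrite -[leRHS]mulr1; apply: ler_pM => //; first by rewrite divr_ge0 // pi_ge0.
  exact/ltW/pihalf_lt2.
by rewrite ler_norml sin_le1 sin_geN1.
Qed.

Lemma ramp'_continuous : continuous ramp'.
Proof.
move=> t; apply: cvgM; first exact: cvg_cst.
apply: (@continuous_comp _ _ _ (fun s : R => pi * s) sin); last exact: continuous_sin.
by apply: cvgM; [exact: cvg_cst|exact: cvg_id].
Qed.

Definition ramp_path (x y : R * R) (t : R) : R * R :=
  (x.1 + ramp t * (y.1 - x.1), x.2 + ramp t * (y.2 - x.2)).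

Lemma ramp_path0 x y : ramp_path x y 0 = x.
Proof.
by rewrite /ramp_path /ramp mulr0 cos0 subrr mul0r !mul0r !addr0 -surjective_pairing.
Qed.

Lemma ramp_path1 x y : ramp_path x y 1 = y.
Proof.
rewrite /ramp_path /ramp mulr1 cospi opprK (_ : (1 + 1) / 2 = 1); last by field.
by rewrite !mul1r !(addrC _ (_ - _)) !subrK -surjective_pairing.
Qed.

Lemma coordinate_ramp_path_is_derive x y t (k : 'I_2) :
  is_derive t (1 : R) (fun s => coordinate k (ramp_path x y s))
    (ramp' t * (coordinate k y - coordinate k x)).
Proof.
have main (a b : R) : is_derive t (1 : R) (fun s => a + ramp s * b) (ramp' t * b).
  have D := ramp_is_derive t.
  have -> : (fun s => a + ramp s * b) = cst a + ramp * cst b by apply/funext.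
  apply: (@is_derive_eq _ _ _ _ _ _ _ _
    (is_deriveD (is_derive_cst a t 1) (is_deriveM D (is_derive_cst b t 1)))).
  by rewrite /GRing.scale /=; ring.
by rewrite /coordinate; case: ifP => _; exact: main.
Qed.

Lemma ramp_path_continuous x y : continuous (ramp_path x y).
Proof.
move=> t.
have c0 : {for t, continuous (fun s => (ramp_path x y s).1)}.
  have [D _] := coordinate_ramp_path_is_derive x y t ord0.
  exact/differentiable_continuous/derivable1_diffP.
have c1 : {for t, continuous (fun s => (ramp_path x y s).2)}.
  have [D _] := coordinate_ramp_path_is_derive x y t ord_max.
  exact/differentiable_continuous/derivable1_diffP.
have P := cvg_pair c0 c1.
exact: (P _ _ _).
Qed.

Section RampCurve.
Variables (i : 'I_(atlas_size S)) (x y : R * R).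
Hypothesis xy_img : forall t, chart_img (atlas i) (ramp_path x y t).
Let c (t : R) : S := chart_inv (atlas i) (ramp_path x y t).

Lemma ramp_curve_dom t : chart_dom (atlas i) (c t) /\ chart_map (atlas i) (c t) = ramp_path x y t.
Proof. exact: chart_invK. Qed.

Lemma ramp_curve_continuous : continuous c.
Proof.
move=> t; apply: continuous_comp; first exact: ramp_path_continuous.
exact: (chart_inv_continuous (xy_img t)).
Qed.

Lemma local_ramp_curve k : local_curve i c k = (fun s => coordinate k (ramp_path x y s)).
Proof. by apply/funext => s; rewrite /local_curve (ramp_curve_dom s).2. Qed.

Lemma ramp_curve_C1 : C1_curve c.
Proof.
split; first exact: ramp_curve_continuous.
move=> j t jct k.
pose z s := ramp_path x y s.
pose dj s := tr_jac i j k ord0 (z s) * (ramp' s * (y.1 - x.1)) +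
   tr_jac i j k ord_max (z s) * (ramp' s * (y.2 - x.2)).
have Dj s : chart_dom (atlas j) (c s) -> is_derive s (1 : R) (local_curve j c k) (dj s).
  move=> jcs; have [ics zs] := ramp_curve_dom s.
  have D0 := coordinate_ramp_path_is_derive x y s ord0.
  have D1 := coordinate_ramp_path_is_derive x y s ord_max.
  rewrite -local_ramp_curve in D0; rewrite -local_ramp_curve in D1.
  have := local_curve_is_derive (@ramp_curve_continuous s) ics jcs D0 D1 k.
  by rewrite zs.
split; first by have [] := Dj t jct.
have oz : overlap (atlas i) (atlas j) (z t).
  by have [ict zt] := ramp_curve_dom t; rewrite /z -zt; exact: overlapP.
have zc := @ramp_path_continuous x y t.
have Jc l : {for t, continuous (tr_jac i j k l \o z)}.
  by apply: continuous_comp zc _; exact: has_grad_continuous (has_grad_tr_jac k l oz).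
have djc : {for t, continuous dj}.
  by apply: cvgD; apply: cvgM; [exact: Jc|apply: cvgM; [exact: ramp'_continuous|exact: cvg_cst]
    |exact: Jc|apply: cvgM; [exact: ramp'_continuous|exact: cvg_cst]].
have E : \forall s \near t, dj s = (local_curve j c k)^`()%classic s.
  have m : \forall s \near t, chart_dom (atlas j) (c s) :=
    @ramp_curve_continuous t _ (near_chart_dom jct).
  by apply: filterS m => s js; have [_ <-] := Dj s js; rewrite derive1E.
rewrite /prop_for /continuous_at -(nbhs_singleton E).
exact: cvg_trans (near_eq_cvg E) djc.
Qed.

Lemma speed_ramp_curve t : speed g c t =
  Num.sqrt (gquad g i (ramp_path x y t) (ramp' t * (y.1 - x.1)) (ramp' t * (y.2 - x.2))).
Proof.
have [ict zt] := ramp_curve_dom t.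
have D0 := coordinate_ramp_path_is_derive x y t ord0.
have D1 := coordinate_ramp_path_is_derive x y t ord_max.
rewrite -local_ramp_curve in D0; rewrite -local_ramp_curve in D1.
by rewrite (speedE (@ramp_curve_continuous t) ict D0 D1) zt.
Qed.

End RampCurve.

Lemma ramp_path_dist (x y z : R * R) (s t : R) : `|x - z| <= s -> `|y - z| <= s ->
  `|ramp_path x y t - z| <= s.
Proof.
move=> /norm_pair_le[/= x1 x2] /norm_pair_le[/= y1 y2]; apply/norm_pair_le => /=.
have /andP[t0 t1] := ramp_bounds t.
move: x1 x2 y1 y2; rewrite !ler_distl.
move=> /andP[a1 a2] /andP[b1 b2] /andP[c1 c2] /andP[d1 d2].
by split; apply/andP; split; nra.
Qed.

(** The ramp curve has velocity at most [2 |y - x|] in each coordinate and the metric is at most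
    [2 K]. The squared speed is therefore at most [16 K |y - x|^2], which [K >= 1] absorbs in
    [(4 K |y - x|)^2]. *)
Lemma riemannian_dist_le K i (x y z : R * R) s : 1 <= K ->
  (forall w, `|w - z| <= s -> geom_bound g K i w) -> `|x - z| <= s -> `|y - z| <= s ->
  (riemannian_dist g (chart_inv (atlas i) x) (chart_inv (atlas i) y) <=
    (4 * K * `|y - x|)%:E)%E.
Proof.
move=> K1 gb xs ys.
have gbt t : geom_bound g K i (ramp_path x y t) by apply: gb; exact: ramp_path_dist.
have img t : chart_img (atlas i) (ramp_path x y t) by have [] := gbt t.
set c := fun t : R => chart_inv (atlas i) (ramp_path x y t).
have C1c : C1_curve c by exact: ramp_curve_C1.
apply: (@le_trans _ _ (curve_length g c)).
  apply: ereal_inf_lbound; exists c => //=; split.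
  - by exists [:: 1]; split => //=; [rewrite ltr01|move=> k k1; exists c].
  - by rewrite /c ramp_path0.
  - by rewrite /c ramp_path1.
rewrite /curve_length.
have n0 : 0 <= 4 * K * `|y - x| by rewrite !mulr_ge0 //; lra.
apply: (@le_trans _ _ (\int[lebesgue_measure]_(t in `[0%R, 1%R]) (cst (4 * K * `|y - x|)%:E) t)%E); last first.
  rewrite integral_cst //= lebesgue_measure_itv /= lte_fin ltr01 oppr0 adde0.
  by rewrite mule1.
apply: le_integral_pointwise => t _; rewrite lee_fin ?speed_ge0 //.
rewrite /c (speed_ramp_curve img) -(ger0_norm n0) -sqrtr_sqr ler_wsqrtr //.
have [iy [AK DK] _ _ _] := gbt t.
apply: le_trans (gquad_le _ _ iy AK DK) _.
have /norm_pair_le[/= h1 h2] := lexx `|y - x|.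
have rb := ramp'_bound t.
have aux (u : R) : `|u| <= `|y - x| -> (ramp' t * u) * (ramp' t * u) <= 4 * (`|y - x| * `|y - x|).
  move=> un; rewrite -expr2 -real_normK ?num_real // expr2.
  have : `|ramp' t * u| <= 2 * `|y - x| by rewrite normrM; exact: ler_pM.
  move=> h; have := ler_pM (normr_ge0 _) (normr_ge0 _) h h; lra.
have a1 := aux _ h1; have a2 := aux _ h2.
have nn : 0 <= `|y - x| * `|y - x| by rewrite mulr_ge0.
apply: (@le_trans _ _ (2 * K * (8 * (`|y - x| * `|y - x|)))).
  by rewrite ler_wpM2l //; lra.
rewrite (_ : (4 * K * `|y - x|) ^+ 2 = 16 * K * (K * (`|y - x| * `|y - x|))); last ring.
have -> : 2 * K * (8 * (`|y - x| * `|y - x|)) = 16 * K * (`|y - x| * `|y - x|) by ring.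
by rewrite ler_wpM2l ?ler_peMl //; lra.
Qed.

End Speed.

(** * The lower bound for the distance *)

Section CurveLowerBound.
Context {R : realType}.

Lemma subset_integral_pointwise d (T : measurableType d) (mu : {measure set T -> \bar R})
  (A B : set T) (f : T -> \bar R) : A `<=` B -> (forall x, B x -> (0 <= f x)%E) ->
  (\int[mu]_(x in A) f x <= \int[mu]_(x in B) f x)%E.
Proof.
move=> AB f0; rewrite integral_mkcond [leRHS]integral_mkcond.
apply: le_integral_pointwise => x _.
  by apply: erestrict_ge0 => y Ay; exact/f0/AB.
rewrite /patch; case: ifPn => [/set_mem Ax|_]; first by rewrite ifT //; exact/mem_set/AB.
by case: ifPn => // /set_mem; exact: f0.
Qed.

(** This is meant for the interval between two break points of a curve. At the break points the
    speed is not controlled, hence the open interval in the conclusion. *)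
Lemma abs_increment_le_integral (f df : R -> R) (a b : R) : a < b ->
  (forall t, a <= t <= b -> is_derive t (1 : R) f (df t) /\ {for t, continuous df}) ->
  [/\ measurable_fun `]a, b[%classic (fun t => `|df t|%:E),
      (\int[lebesgue_measure]_(t in `]a, b[) `|df t|%:E < +oo)%E &
      (`|f b - f a|%:E <= \int[lebesgue_measure]_(t in `]a, b[) `|df t|%:E)%E].
Proof.
move=> ab H.
have dfc : {within `[a, b], continuous df}.
  by apply: continuous_in_subspaceT => t; rewrite inE /= in_itv /= => /H[].
have mdf : measurable_fun `]a, b[%classic df.
  apply: open_continuous_measurable_fun; first exact: interval_open.
  move=> t; rewrite inE /= in_itv /= => /andP[h1 h2].
  by have [] := H t; rewrite ?ltW.
have mabs : measurable_fun `]a, b[%classic (fun t => `|df t|%:E).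
  by apply/measurable_EFinP; exact: measurableT_comp.
have fc t : a <= t <= b -> {for t, continuous f}.
  by move=> /H[[D _] _]; exact/differentiable_continuous/derivable1_diffP.
have FTC : (\int[lebesgue_measure]_(x in `[a, b]) (df x)%:E = (f b)%:E - (f a)%:E)%E.
  apply: continuous_FTC2 => //; last first.
    move=> t; rewrite in_itv /= => /andP[h1 h2]; rewrite derive1E.
    by have [|[_ ->]] := H t; rewrite ?ltW.
  split.
  - by move=> t; rewrite in_itv /= => /andP[h1 h2]; have [|[]] := H t; rewrite ?ltW.
  - by apply: cvg_at_right_filter; apply: fc; rewrite lexx ltW.
  - by apply: cvg_at_left_filter; apply: fc; rewrite lexx ltW.
split => //.
  have int : lebesgue_measure.-integrable `[a, b] (EFin \o df).
    by apply: continuous_compact_integrable => //; exact: segment_compact.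
  have /integrableP[_] := int; apply: le_lt_trans.
  apply: subset_integral_pointwise => //=.
  by apply: subset_itv; rewrite bnd_simp.
have mEdf : measurable_fun `]a, b[%classic (fun t => (df t)%:E) by exact/measurable_EFinP.
have E : (\int[lebesgue_measure]_(x in `[a, b]) (df x)%:E =
    \int[lebesgue_measure]_(x in `]a, b[) (df x)%:E)%E.
  exact: (@integral_itv_bndoo R a b (fun t => (df t)%:E) true false mEdf).
rewrite -abse_EFin EFinB -FTC E.
exact: le_abse_integral.
Qed.

End CurveLowerBound.

Section DistLowerBound.
Context {R : realType} {S : closed_surface R} (g : riemannian_metric S).
Implicit Types (i j : 'I_(atlas_size S)) (t : R).

Definition chart_box i (x : R * R) (s : R) : set S :=
  [set p | chart_dom (atlas i) p /\ `|chart_map (atlas i) p - x| < s].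

Lemma chart_box_open i x s : open (chart_box i x s).
Proof.
rewrite (_ : chart_box i x s = chart_dom (atlas i) `&`
    chart_map (atlas i) @^-1` [set y | `|y - x| < s]) //.
apply: chart_preimage_open.
rewrite (_ : [set y | _] = (fun y : R * R => `|y - x|) @^-1` [set t | t < s]) //.
by apply: open_comp => [t _|]; [exact: dist_box_continuous|exact: open_lt].
Qed.

(** Closed in the whole surface and not only in the chart domain: the set is the image of a compact
    square under the inverse chart, and the surface is Hausdorff. *)
Lemma chart_closed_box i x s : (forall w, `|w - x| <= s -> chart_img (atlas i) w) ->
  closed [set p | chart_dom (atlas i) p /\ `|chart_map (atlas i) p - x| <= s].
Proof.
move=> img.
have -> : [set p | chart_dom (atlas i) p /\ `|chart_map (atlas i) p - x| <= s] =
    chart_inv (atlas i) @` [set w | `|w - x| <= s].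
  apply/seteqP; split => [p /= [ip ps]|_ [w /= ws <-]].
    by exists (chart_map (atlas i) p) => //; rewrite chart_mapK.
  by have [iw ->] := chart_invK (img w ws).
apply: compact_closed; first exact: surface_hausdorff.
apply: continuous_compact; last exact: box_compact.
apply: continuous_in_subspaceT => w; rewrite inE /= => ws.
exact: (chart_inv_continuous (img w ws)).
Qed.

(** The times spent outside the open box form a compact set, whose minimum is [t1]. Closedness of
    the closed box keeps [c t1] in the chart, at coordinate distance exactly [s]. *)
Lemma exit_time i x s (c : R -> S) (a b : R) :
  (forall w, `|w - x| <= s -> chart_img (atlas i) w) -> continuous c ->
  a <= b -> chart_box i x s (c a) ->
  exists t1, [/\ a <= t1 <= b,
    forall t, a <= t <= t1 -> chart_dom (atlas i) (c t) /\ `|chart_map (atlas i) (c t) - x| <= s &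
    (t1 = b /\ chart_box i x s (c b)) \/ `|chart_map (atlas i) (c t1) - x| = s].
Proof.
move=> img cc ab Wa.
have [all|] := pselect (forall t, a <= t <= b -> chart_box i x s (c t)).
  exists b; split; first by rewrite ab lexx.
    by move=> t /all[h1 /ltW h2].
  by left; split => //; apply: all; rewrite ab lexx.
move=> /existsNP[t0 /not_implyP[t0ab nW0]].
pose E := [set t | a <= t <= b /\ ~ chart_box i x s (c t)].
have cE : compact E.
  rewrite (_ : E = `[a, b]%classic `&` c @^-1` (~` chart_box i x s)); last first.
    by apply/seteqP; split => t /=; rewrite in_itv.
  apply: (@subclosed_compact _ _ `[a, b]%classic); [|exact: segment_compact|by move=> t []].
  apply: closedI; first exact: interval_closed.
  apply: closed_comp => [t _|]; first exact: cc.
  by rewrite closedC; exact: chart_box_open.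
have [||t1] := @compact_EVT_min _ R (fun t : R => t) E _ cE.
- by exists t0.
- by apply: continuous_subspaceT => t; exact: cvg_id.
rewrite inE => -[t1ab nW1] t1min.
have lt1 t : a <= t < t1 -> chart_box i x s (c t).
  move=> /andP[at1 tt1]; apply: contrapT => nW.
  have /t1min : t \in E.
    rewrite inE; split => //; rewrite at1 /= ltW //.
    by apply: lt_le_trans tt1 _; have /andP[] := t1ab.
  by rewrite leNgt tt1.
have at1 : a < t1.
  have /andP[h _] := t1ab; rewrite lt_neqAle h andbT.
  by apply/eqP => E1; apply: nW1; rewrite -E1.
have Bx1 : chart_dom (atlas i) (c t1) /\ `|chart_map (atlas i) (c t1) - x| <= s.
  have cl : closed (c @^-1` [set p | chart_dom (atlas i) p /\ `|chart_map (atlas i) p - x| <= s]).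
    by apply: closed_comp => [t _|]; [exact: cc|exact: chart_closed_box].
  apply: cl => B /nbhs_ballP[e /= e0 eB].
  pose t := Num.max a (t1 - e / 2).
  have tt1 : t < t1 by rewrite gt_max at1 /= ltrBlDr ltrDl divr_gt0.
  have ta : a <= t by rewrite le_max lexx.
  exists t; split.
    have [h1 /ltW h2] : chart_box i x s (c t) by apply: lt1; rewrite ta.
    by [].
  apply: eB; rewrite -ball_normE /= ltr_distl.
  have : t1 - e / 2 <= t by rewrite le_max lexx orbT.
  by move=> h; apply/andP; split; lra.
exists t1; split => //.
  move=> t /andP[h1]; rewrite le_eqVlt => /orP[/eqP ->//|h2].
  by have [? /ltW ?] : chart_box i x s (c t) by apply: lt1; rewrite h1.
right; apply/eqP; rewrite eq_le Bx1.2 /= leNgt; apply/negP => h.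
by apply: nW1; split => //; exact: Bx1.1.
Qed.

(** Stated for each coordinate separately: the coordinate norm is a maximum, so a single coordinate
    carries the whole exit distance. *)
Definition reach_bound K i (x : R * R) (c : R -> S) (t : R) := forall k : 'I_2,
  ((`|local_curve i c k t - coordinate k x| / (2 * K))%:E <=
    \int[lebesgue_measure]_(r in `[0%R, t]) (speed g c r)%:E)%E.

(** One C^1 piece of the induction along a curve: either the curve leaves the box within the piece,
    and its length already suffices, or the bound is carried to the end of the piece. *)
Lemma reach_bound_step K i x s (c c' : R -> S) (a b : R) : 1 <= K -> 0 < s ->
  (forall w, `|w - x| <= s -> geom_bound g K i w) ->
  0 <= a -> a < b -> b <= 1 -> C1_curve c' ->
  (forall t, a <= t <= b -> c t = c' t) ->
  chart_box i x s (c a) -> reach_bound K i x c a ->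
  ((s / (2 * K))%:E <= \int[lebesgue_measure]_(r in `[0%R, 1%R]) (speed g c r)%:E)%E \/
  (chart_box i x s (c b) /\ reach_bound K i x c b).
Proof.
move=> K1 s0 gb a0 ab b1 [cc' C1] cE Wa Ra.
have img w : `|w - x| <= s -> chart_img (atlas i) w by move=> /gb[].
have K0 : 0 < 2 * K by lra.
have cEa : c a = c' a by apply: cE; rewrite lexx ltW.
have Wa' : chart_box i x s (c' a) by rewrite -cEa.
have [t1 [/andP[at1 t1b] dom1 cases]] := exit_time img cc' (ltW ab) Wa'.
have {}at1 : a < t1.
  rewrite lt_neqAle at1 andbT; apply/eqP => E1.
  case: cases => [[E2 _]|E2]; first by rewrite E1 E2 ltxx in ab.
  by move: Wa' => [_]; rewrite E1 E2 ltxx.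
have cE1 t : a <= t <= t1 -> c t = c' t.
  by move=> /andP[h1 h2]; apply: cE; rewrite h1 (le_trans h2).
have Rt1 : reach_bound K i x c t1.
  move=> k; pose f t := local_curve i c' k t / (2 * K).
  pose df t := derive1 (local_curve i c' k) t / (2 * K).
  have Hf t : a <= t <= t1 -> is_derive t (1 : R) f (df t) /\ {for t, continuous df}.
    move=> /dom1[ict _]; have [D Dc] := C1 i t ict k.
    split; last by apply: cvgM; [exact: Dc|exact: cvg_cst].
    have -> : f = local_curve i c' k * cst ((2 * K)^-1) by apply/funext.
    have D' := derivableP D.
    apply: is_derive_eq; rewrite /GRing.scale /= /df derive1E; ring.
  have [mdf fdf dfle] := abs_increment_le_integral at1 Hf.
  (* Inside the piece [c] agrees with [c'] near [t], so its speed can be computed in chart [i] and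
     dominates [|df t|] by [abs_velocity_le]. *)
  have minor t : `]a, t1[%classic t -> (0 <= `|df t|%:E <= (speed g c t)%:E)%E.
    rewrite /= in_itv /= => /andP[h1 h2]; rewrite !lee_fin normr_ge0 /=.
    have [ict' ws] : chart_dom (atlas i) (c' t) /\ `|chart_map (atlas i) (c' t) - x| <= s.
      by apply: dom1; rewrite !ltW.
    have ct : c t = c' t by apply: cE1; rewrite !ltW.
    have nE : \forall r \near t, c' r = c r.
      have : t \in `]a, t1[ by rewrite in_itv /= h1.
      move=> /near_in_itvoo; apply: filterS => r; rewrite in_itv /= => /andP[r1 r2].
      by rewrite cE1 // !ltW.
    have cct : {for t, continuous c}.
      rewrite /prop_for /continuous_at ct; exact: cvg_trans (near_eq_cvg nE) (cc' t).
    have D l : is_derive t (1 : R) (local_curve i c l) (derive1 (local_curve i c' l) t).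
      apply: (near_eq_is_derive (f := local_curve i c' l)).
        by apply: filterS nE => r Er; rewrite /local_curve Er.
      by have [D _] := C1 i t ict' l; rewrite derive1E; exact: derivableP.
    have ict : chart_dom (atlas i) (c t) by rewrite ct.
    rewrite (speedE g cct ict (D ord0) (D ord_max)) ct.
    have [A0 A1] := abs_velocity_le (derive1 (local_curve i c' ord0) t)
      (derive1 (local_curve i c' ord_max) t) K1 (gb _ ws).
    rewrite /df normrM normfV (gtr0_norm K0) ler_pdivrMr // mulrC.
    have [->|->] : k = ord0 \/ k = ord_max.
      by case: k {f df Hf mdf fdf dfle} => -[|[|//]] ?; [left|right]; exact: val_inj.
      exact: A0.
    exact: A1.
  have sup := @ge0_integral_superadd _ _ R lebesgue_measure `[0, a]%classic `]a, t1[%classic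
    `[0, t1]%classic (fun r => (speed g c r)%:E) (fun t => `|df t|%:E).
  apply: le_trans (sup _ _ _ _ mdf minor fdf) => //=.
  - apply: (@le_trans _ _ ((`|local_curve i c k a - coordinate k x| / (2 * K))%:E + `|f t1 - f a|%:E)%E).
      rewrite -EFinD lee_fin.
      have -> : `|f t1 - f a| = `|local_curve i c' k t1 - local_curve i c' k a| / (2 * K).
        by rewrite /f -mulrBl normrM normfV (gtr0_norm K0).
      rewrite -mulrDl ler_pM2r ?invr_gt0 //.
      have Ea : local_curve i c' k a = local_curve i c k a by rewrite /local_curve cEa.
      have Eb : local_curve i c' k t1 = local_curve i c k t1.
        by rewrite /local_curve cE1 // lexx ltW.
      rewrite Ea Eb (_ : local_curve i c k t1 - coordinate k x =
        (local_curve i c k a - coordinate k x) + (local_curve i c k t1 - local_curve i c k a)).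
        exact: ler_normD.
      by ring.
    by apply: leeD.
  - apply/seteqP; split => // t /= []; rewrite !in_itv /= => /andP[_ h1] /andP[h2 _].
    by move: h1; rewrite leNgt h2.
  - move=> t /=; rewrite !in_itv /= => -[/andP[h1 h2]|/andP[h1 h2]].
      by rewrite h1 /=; apply: le_trans h2 (ltW at1).
    by rewrite (le_trans a0 (ltW h1)) ltW.
  - by move=> t _; rewrite lee_fin speed_ge0.
case: cases => [[E1 W1]|E1].
  right; split; last by rewrite -E1.
  by rewrite cE // lexx ltW.
left.
have : exists k, `|local_curve i c k t1 - coordinate k x| = s.
  move: E1; rewrite norm_pair /= => E1.
  have ct1 : c t1 = c' t1 by apply: cE1; rewrite lexx ltW.
  case: leP E1 => _ E1; [exists ord_max|exists ord0];
    by rewrite /local_curve /coordinate /= ct1.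
move=> [k kE]; have := Rt1 k; rewrite kE => /le_trans; apply.
apply: subset_integral_pointwise => [t /=|t _]; last by rewrite lee_fin speed_ge0.
rewrite !in_itv /= => /andP[-> h] /=; apply: le_trans h _; exact: le_trans t1b b1.
Qed.

(** A curve from [p] to [q] has to reach the boundary of the box, also when [q] lies outside the
    chart; [reach_bound_step] is iterated over the pieces of the curve. *)
Lemma riemannian_dist_ge K i (p q : S) s : 1 <= K -> 0 < s ->
  chart_dom (atlas i) p ->
  (forall w, `|w - chart_map (atlas i) p| <= s -> geom_bound g K i w) ->
  ~ chart_box i (chart_map (atlas i) p) s q ->
  ((s / (2 * K))%:E <= riemannian_dist g p q)%E.
Proof.
move=> K1 s0 ip gb nq; set x := chart_map (atlas i) p in gb nq *.
apply: le_ereal_inf_tmp => _ [c /= [[sq [sq_path sq_last sq_C1]] c0 c1] <-].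
pose sg k := nth 0 (0 :: sq) k.
have sgS k : (k < size sq)%N -> sg k < sg k.+1 by move: k; exact/(pathP 0).
have sg_last : sg (size sq) = 1.
  by rewrite -sq_last /sg (last_nth 0).
have sg_le1 k : (k <= size sq)%N -> sg k <= 1.
  move=> ksz; rewrite -sg_last -(subKn ksz).
  elim: (size sq - k)%N (leq_subr k (size sq)) => [_|m IH msz]; first by rewrite subn0.
  apply: le_trans (IH (ltnW msz)); apply: ltW.
  have -> : (size sq - m = (size sq - m.+1).+1)%N by rewrite subnSK.
  by apply: sgS; rewrite ltn_subrL /= (leq_ltn_trans _ msz).
have sg_ge0 k : (k <= size sq)%N -> 0 <= sg k.
  elim: k => [_|k IH ksz]; first by rewrite /sg.
  exact: le_trans (IH (ltnW ksz)) (ltW (sgS _ ksz)).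
have main k : (k <= size sq)%N ->
    ((s / (2 * K))%:E <= curve_length g c)%E \/
    (chart_box i x s (c (sg k)) /\ reach_bound K i x c (sg k)).
  elim: k => [_|k IH ksz].
    right; rewrite /sg /= c0; split; first by split => //; rewrite subrr normr0.
    move=> k; have -> : local_curve i c k 0 - coordinate k x = 0.
      by rewrite /local_curve c0 subrr.
    rewrite normr0 mul0r; apply: integral_ge0 => t _; by rewrite lee_fin speed_ge0.
  have [|[Wk Rk]] := IH (ltnW ksz); first by left.
  have [c' C1c' cE] := sq_C1 k ksz.
  apply: (reach_bound_step K1 s0 gb (sg_ge0 _ (ltnW ksz)) (sgS k ksz) (sg_le1 _ ksz) C1c') => //.
have [//|[Wq _]] := main (size sq) (leqnn _).
by case: nq; rewrite -c1 -sg_last.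
Qed.

End DistLowerBound.

(** * Comparison of measures on plane squares *)

Section PlaneSquares.
Context {R : realType}.
Notation plane := (measurableTypeR R * measurableTypeR R)%type.
Implicit Types (u x : R * R) (l : R).

(** Half-open, so that the four quarters of a square partition it; the closed version serves for the
    limit point of nested squares. *)
Definition square u l : set (R * R) :=
  [set x | u.1 <= x.1 < u.1 + l /\ u.2 <= x.2 < u.2 + l].
Definition csquare u l : set (R * R) :=
  [set x | u.1 <= x.1 <= u.1 + l /\ u.2 <= x.2 <= u.2 + l].

Lemma square_csquare u l : square u l `<=` csquare u l.
Proof.
by move=> x [/andP[a b] /andP[c d]]; split; rewrite ?a ?c /= ltW.
Qed.

Lemma squareE u l : square u l = `[u.1, u.1 + l[%classic `*` `[u.2, u.2 + l[%classic.
Proof. by apply/seteqP; split => x /=; rewrite !in_itv. Qed.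

Lemma square_measurable u l : measurable (square u l : set plane).
Proof. by rewrite squareE; apply: measurableX; exact: measurable_itv. Qed.

Lemma square_area u l : 0 < l -> area_measure (square u l) = (l * l)%:E.
Proof.
move=> l0; rewrite squareE.
have E (a : R) : (@lebesgue_measure R) (`[a, a + l[%classic : set R) = l%:E.
  by rewrite lebesgue_measure_itv /= lte_fin ltrDl l0 -EFinB addrAC subrr add0r.
apply: etrans (product_measure1E (@lebesgue_measure R) _ _ _) _; [exact: measurable_itv..|].
by rewrite EFinM; congr (_ * _)%E; exact: E.
Qed.

Lemma square_split u l : 0 < l -> square u l =
  (square u (l / 2) `|` square (u.1 + l / 2, u.2) (l / 2)) `|`
  (square (u.1, u.2 + l / 2) (l / 2) `|` square (u.1 + l / 2, u.2 + l / 2) (l / 2)).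
Proof.
move=> l0; apply/seteqP; split => x; rewrite /square /=.
  move=> [/andP[a b] /andP[c d]].
  have [h1|h1] := ltP x.1 (u.1 + l / 2); have [h2|h2] := ltP x.2 (u.2 + l / 2).
  - by left; left; rewrite a c.
  - by right; left; rewrite a /=; split => //; lra.
  - by left; right; rewrite c /=; split => //; lra.
  - by right; right; split; lra.
by move=> [[[/andP[a b] /andP[c d]]|[/andP[a b] /andP[c d]]]|
  [[/andP[a b] /andP[c d]]|[/andP[a b] /andP[c d]]]]; split; lra.
Qed.

Lemma measure_square_split (m : {measure set plane -> \bar R}) u l : 0 < l ->
  m (square u l) =
  ((m (square u (l / 2)) + m (square (u.1 + l / 2, u.2)%R (l / 2))) +
  (m (square (u.1, u.2 + l / 2)%R (l / 2)) + m (square (u.1 + l / 2, u.2 + l / 2)%R (l / 2))))%E.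
Proof.
move=> l0; have M := square_measurable.
have dis x a b : square a (l / 2) x -> square b (l / 2) x -> a.1 + l / 2 <= b.1 \/ a.2 + l / 2 <= b.2 -> False.
  by move=> [/andP[a1 a2] /andP[a3 a4]] [/andP[b1 b2] /andP[b3 b4]] [h|h]; lra.
rewrite {1}square_split // measureU; [|exact: measurableU|exact: measurableU|].
  by congr (_ + _)%E; rewrite measureU //; apply/seteqP; split => // x [/dis H1 /H1]; apply => /=; lra.
by apply/seteqP; split => // x [[/dis H1|/dis H1] [/H1|/H1]]; apply => /=; lra.
Qed.

Lemma geometric_small (l e : R) : 0 < l -> 0 < e -> exists n : nat, l / 2 ^+ n < e.
Proof.
move=> l0 e0; have h0 : 0 <= l / e by rewrite divr_ge0 // ltW.
exists (Num.bound (l / e)); have := archi_boundP h0.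
set n := Num.bound _; rewrite ltr_pdivrMr // => h.
have : n%:R * e <= 2 ^+ n * e.
  rewrite ler_wpM2r ?(ltW e0) // -natrX ler_nat ltnW //; exact: ltn_expl.
by rewrite ltr_pdivrMr ?exprn_gt0 // mulrC => h2; apply: lt_le_trans h _; rewrite mulrC [leRHS]mulrC.
Qed.

(* Otherwise successive bisections give nested squares that violate the bound and
   shrink to a point. *)
Lemma square_bisection (m1 m2 : {measure set plane -> \bar R}) (C : R) u0 l0 :
  0 <= C -> 0 < l0 ->
  (forall x, csquare u0 l0 x -> exists2 e : R, 0 < e &
     forall u l, 0 < l -> l < e -> csquare u l x ->
       (m1 (square u l) <= C%:E * m2 (square u l))%E) ->
  (m1 (square u0 l0) <= C%:E * m2 (square u0 l0))%E.
Proof.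
move=> C0 l00 loc; apply: contrapT => bad0.
pose bad (q : (R * R) * R) := 0 < q.2 /\ ~ (m1 (square q.1 q.2) <= C%:E * m2 (square q.1 q.2))%E.
have step (q : {q | bad q}) : {q' : {q | bad q} |
    [/\ (sval q').2 = (sval q).2 / 2,
       (sval q).1.1 <= (sval q').1.1 <= (sval q).1.1 + (sval q).2 / 2 &
       (sval q).1.2 <= (sval q').1.2 <= (sval q).1.2 + (sval q).2 / 2]}.
  apply: cid; case: q => -[u l] /= [/= lpos bd].
  have l2 : 0 < l / 2 by rewrite divr_gt0.
  apply: contrapT => noq; apply: bd.
  have ok v : u.1 <= v.1 <= u.1 + l / 2 -> u.2 <= v.2 <= u.2 + l / 2 ->
      (m1 (square v (l / 2)) <= C%:E * m2 (square v (l / 2)))%E.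
    move=> v1 v2; apply: contrapT => bv; apply: noq.
    by exists (exist _ (v, l / 2) (conj l2 bv)).
  rewrite !(measure_square_split _ _ lpos) !ge0_muleDr ?adde_ge0 //.
  by apply: leeD; apply: leeD; apply: ok => /=; lra.
pose q0 : {q | bad q} := exist _ (u0, l0) (conj l00 bad0).
pose q n := sval (iter n (fun q => sval (step q)) q0).
have qS n : [/\ (q n.+1).2 = (q n).2 / 2, (q n).1.1 <= (q n.+1).1.1 <= (q n).1.1 + (q n).2 / 2 &
    (q n).1.2 <= (q n.+1).1.2 <= (q n).1.2 + (q n).2 / 2].
  by rewrite /q iterS; exact: (svalP (step _)).
have qbad n : bad (q n) by exact: svalP.
have ql n : (q n).2 = l0 / 2 ^+ n.
  elim: n => [|n IH]; first by rewrite expr0 divr1.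
  by have [-> _ _] := qS n; rewrite IH exprSr invfM mulrA.
have ql0 n : 0 < (q n).2 by have [] := qbad n.
have nest (f : R * R -> R) : (forall n, f (q n).1 <= f (q n.+1).1 <= f (q n).1 + (q n).2 / 2) ->
    exists z : R, forall n, f (q n).1 <= z <= f (q n).1 + (q n).2.
  move=> fS.
  have up n k : f (q n).1 <= f (q (n + k)%N).1 /\ f (q (n + k)%N).1 + (q (n + k)%N).2 <= f (q n).1 + (q n).2.
    elim: k => [|k [IH1 IH2]]; first by rewrite addn0.
    rewrite addnS; have [E _ _] := qS (n + k)%N; have /andP[h1 h2] := fS (n + k)%N.
    by rewrite E; split; lra.
  have cross n m : f (q m).1 <= f (q n).1 + (q n).2.
    have hn := ql0 n; have hm := ql0 m.
    have [mn|/ltnW nm] := leqP m n.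
      by have [h _] := up m (n - m)%N; rewrite subnKC // in h; lra.
    have [_ h] := up n (m - n)%N; rewrite subnKC // in h.
    by lra.
  exists (sup [set f (q n).1 | n in setT]) => n; apply/andP; split.
    apply: ub_le_sup; last by exists n.
    by exists (f (q 0%N).1 + (q 0%N).2) => _ [m _ <-].
  apply: ge_sup; first by exists (f (q 0%N).1), 0%N.
  by move=> _ [m _ <-].
have [z1 Hz1] := nest fst (fun n => let: And3 _ h _ := qS n in h).
have [z2 Hz2] := nest snd (fun n => let: And3 _ _ h := qS n in h).
have zin n : csquare (q n).1 (q n).2 (z1, z2) by split; [exact: Hz1|exact: Hz2].
have [e e0 He] := loc _ (zin 0%N).
have [n nE] := geometric_small l00 e0.
have [_ bn] := qbad n; apply: bn; apply: He => //.
by rewrite ql.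
Qed.

End PlaneSquares.

(** * Dyadic exhaustion of open sets, and approximation of closed sets by open ones *)

Section PlaneOpenSets.
Context {R : realType}.
Notation plane := (measurableTypeR R * measurableTypeR R)%type.
Implicit Types (u x : R * R) (l : R) (O : set (R * R)).

Definition mesh (n : nat) : R := (2 ^+ n)^-1.
Definition node (n : nat) (z : int * int) : R * R := (z.1%:~R * mesh n, z.2%:~R * mesh n).

Lemma mesh_gt0 n : 0 < mesh n.
Proof. by rewrite /mesh invr_gt0 exprn_gt0. Qed.

Lemma mesh_half n : mesh n = 2 * mesh n.+1.
Proof. by rewrite /mesh exprS invfM mulrA divff ?mul1r. Qed.

Lemma square_nodeP n z x : square (node n z) (mesh n) x <->
  z = (Num.floor (x.1 / mesh n), Num.floor (x.2 / mesh n)).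
Proof.
have m0 := mesh_gt0 n.
have main (k : int) (t : R) : (k%:~R * mesh n <= t < k%:~R * mesh n + mesh n) =
    (Num.floor (t / mesh n) == k).
  rewrite floor_eq ler_pdivlMr // ltr_pdivrMr // intrD.
  by rewrite mulrDl mul1r.
rewrite /square /= !main; case: z => a b /=; split => [[/eqP -> /eqP ->]//|[-> ->]].
by rewrite !eqxx.
Qed.

(* The dyadic squares of side [mesh n] whose closure lies in [O], numbered by [pickle]. *)
Definition grid_cell O n k : set (R * R) :=
  if (pickle_inv k : option (int * int)%type) is Some z then
    (if `[< csquare (node n z) (mesh n) `<=` O >] then square (node n z) (mesh n) else set0)
  else set0.

Lemma grid_cellP O n k x : grid_cell O n k x ->
  exists z, [/\ pickle z = k, csquare (node n z) (mesh n) `<=` O & square (node n z) (mesh n) x].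
Proof.
rewrite /grid_cell; case E : (pickle_inv k) => [z|] //.
case: asboolP => // sub xz; exists z; split => //.
by have := @pickle_invK (int * int)%type k; rewrite E.
Qed.

Lemma grid_cell_mem O n z x : csquare (node n z) (mesh n) `<=` O ->
  square (node n z) (mesh n) x -> grid_cell O n (pickle z) x.
Proof. by move=> sub xz; rewrite /grid_cell pickleK_inv asboolT. Qed.

Lemma grid_cell_measurable O n k : measurable (grid_cell O n k : set plane).
Proof.
rewrite /grid_cell; case: pickle_inv => [z|]; last exact: measurable0.
by case: ifP => _; [exact: square_measurable|exact: measurable0].
Qed.

Lemma grid_cell_trivIset O n : trivIset setT (grid_cell O n).
Proof.
move=> k k' _ _ [x [/grid_cellP[z [<- _ /square_nodeP E]] /grid_cellP[z' [<- _ /square_nodeP E']]]].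
by rewrite E E'.
Qed.

Definition grid_union O n := \bigcup_k grid_cell O n k.

(** A square of level [n + 1] lies in one of level [n]: comparing nodes gives strict inequalities
    between integers, which sharpen to those of the inclusion of the closed squares. *)
Lemma grid_union_nondecreasing O : {homo grid_union O : n m / (n <= m)%N >-> n `<=` m}.
Proof.
apply: (@homo_leq _ _ (fun A B : set _ => A `<=` B)) => [A|A B C|n x] //; first exact: subset_trans.
move=> [k _ /grid_cellP[z [_ sub xz]]].
pose z' := (Num.floor (x.1 / mesh n.+1), Num.floor (x.2 / mesh n.+1)).
have xz' : square (node n.+1 z') (mesh n.+1) x by apply/square_nodeP.
refine (ex_intro2 _ _ (pickle z') I _); apply: (grid_cell_mem _ xz').
apply: subset_trans sub => y.
have m0 := mesh_gt0 n.+1; have mE := mesh_half n.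
have aux (a b : int) (t s : R) : a%:~R * mesh n <= t < a%:~R * mesh n + mesh n ->
    b%:~R * mesh n.+1 <= t < b%:~R * mesh n.+1 + mesh n.+1 ->
    b%:~R * mesh n.+1 <= s <= b%:~R * mesh n.+1 + mesh n.+1 ->
    a%:~R * mesh n <= s <= a%:~R * mesh n + mesh n.
  rewrite mE => /andP[a1 a2] /andP[b1 b2] /andP[s1 s2].
  have h1 : (2 * a)%:~R < (b + 1)%:~R :> R.
    rewrite !intrD intrM -(ltr_pM2r m0); lra.
  have h2 : b%:~R < (2 * a + 2)%:~R :> R.
    rewrite !intrD intrM -(ltr_pM2r m0); lra.
  rewrite !ltr_int in h1 h2.
  have h3 : (2 * a <= b)%R by rewrite -ltzD1.
  have h4 : (b + 1 <= 2 * a + 2)%R by rewrite lezD1.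
  rewrite -(ler_int R) intrM in h3; rewrite -(ler_int R) !intrD intrM in h4.
  have := ler_wpM2r (ltW m0) h3; have := ler_wpM2r (ltW m0) h4.
  by move=> k4 k3; apply/andP; split; lra.
move: xz xz' => [p1 p2] [q1 q2] [r1 r2]; split; [exact: aux p1 q1 r1|exact: aux p2 q2 r2].
Qed.

Lemma grid_unionE O : open O -> \bigcup_n grid_union O n = O.
Proof.
move=> oO; apply/seteqP; split => [x [n _ [k _ /grid_cellP[z [_ sub xz]]]]|x Ox].
  exact/sub/square_csquare.
have /nbhs_ballP[e /= e0 eO] : nbhs x O by exact: open_nbhs_nbhs.
have [n] := geometric_small (@ltr01 R) e0; rewrite div1r -/(mesh n) => ne.
pose z := (Num.floor (x.1 / mesh n), Num.floor (x.2 / mesh n)).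
have xz : square (node n z) (mesh n) x by apply/square_nodeP.
exists n; first by []; refine (ex_intro2 _ _ (pickle z) I _).
apply: (@grid_cell_mem O n z x _ xz) => y yz.
apply: eO; apply/ball_pair; move: xz yz => [/andP[a1 a2] /andP[b1 b2]] [/andP[c1 c2] /andP[d1 d2]].
by split; rewrite ltr_norml; apply/andP; split; lra.
Qed.

Lemma grid_union_measurable O n : measurable (grid_union O n : set plane).
Proof. by apply: bigcup_measurable => k _; exact: grid_cell_measurable. Qed.

Lemma plane_open_measurable O : open O -> measurable (O : set plane).
Proof.
move=> /grid_unionE <-; apply: bigcup_measurable => n _.
exact: grid_union_measurable.
Qed.

Lemma plane_closed_measurable O : closed O -> measurable (O : set plane).
Proof. by move/closed_openC/plane_open_measurable/measurableC; rewrite setCK. Qed.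

(** The dyadic squares of one level inside the open set are disjoint, so the bound adds up over
    them; continuity from below passes to the limit in the level. *)
Lemma measure_le_open (m1 m2 : {measure set plane -> \bar R}) (C : R) O : 0 <= C -> open O ->
  (forall u l, 0 < l -> csquare u l `<=` O -> (m1 (square u l) <= C%:E * m2 (square u l))%E) ->
  (m1 O <= C%:E * m2 O)%E.
Proof.
move=> C0 oO H.
have mG n : measurable (grid_union O n : set plane) := grid_union_measurable O n.
have mO : measurable (O : set plane) := plane_open_measurable oO.
have cv : (m1 \o grid_union O) n @[n --> \oo] --> m1 O.
  rewrite -[in X in _ --> X](grid_unionE oO); apply: nondecreasing_cvg_mu => //.
    by rewrite grid_unionE.
  by move=> n m nm; apply/subsetPset; exact: grid_union_nondecreasing.
have le n : (m1 (grid_union O n) <= C%:E * m2 O)%E.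
  apply: (@le_trans _ _ (C%:E * m2 (grid_union O n))%E); last first.
    rewrite lee_wpmul2l ?lee_fin // le_measure ?inE // -[X in _ `<=` X](grid_unionE oO).
    exact: bigcup_sup.
  have mc k : measurable (grid_cell O n k : set plane) := grid_cell_measurable O n k.
  rewrite /grid_union !measure_semi_bigcup //; [|exact: grid_cell_trivIset|exact: mG|exact: grid_cell_trivIset|exact: mG].
  rewrite -nneseriesZl //; apply: lee_nneseries => // k _.
  rewrite /grid_cell; case: pickle_inv => [z|]; last by rewrite !measure0 mule0.
  case: asboolP => [sub|_]; last by rewrite !measure0 mule0.
  by apply: H => //; exact: mesh_gt0.
rewrite -(cvg_lim _ cv) //; apply: lime_le; first by apply/cvg_ex; exists (m1 O).
by apply: nearW.
Qed.

Definition fattening (F : set (R * R)) (n : nat) : set (R * R) :=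
  \bigcup_(z in F) ball z (n.+1%:R^-1).

Lemma fattening_open F n : open (fattening F n).
Proof.
apply: bigcup_open => z _; apply: ball_open; by rewrite invr_gt0.
Qed.

Lemma fattening_cap F : closed F -> \bigcap_n fattening F n = F.
Proof.
move=> cF; apply/seteqP; split => [x Hx|x Fx n _]; last first.
  by exists x => //; apply: ballxx; rewrite invr_gt0.
apply: cF => B /nbhs_ballP[e /= e0 eB].
have h0 : 0 <= e^-1 by rewrite invr_ge0 ltW.
have [z Fz zx] := Hx (Num.bound e^-1) I.
exists z; split => //; apply: eB; apply: ball_sym; apply: le_ball zx.
rewrite -[leRHS]invrK lef_pV2 ?posrE ?invr_gt0 //.
by apply: ltW; apply: lt_le_trans (archi_boundP h0) _; rewrite ler_nat.
Qed.

(** A closed set is a decreasing intersection of open fattenings, and finiteness of [m2 V] allows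
    continuity from above. Such sets arise because [chart_piece] is an open set minus an open
    set. *)
Lemma measure_le_open_closed (m1 m2 : {measure set plane -> \bar R}) (C : R) (V F : set (R * R)) :
  0 <= C -> open V -> closed F -> (m2 V < +oo)%E ->
  (forall O, open O -> O `<=` V -> (m1 O <= C%:E * m2 O)%E) ->
  (m1 (V `&` F) <= C%:E * m2 (V `&` F))%E.
Proof.
move=> C0 oV cF fin H.
pose G n := V `&` fattening F n.
have oG n : open (G n) by apply: openI => //; exact: fattening_open.
have mG n : measurable (G n : set plane) by exact: plane_open_measurable.
have capG : \bigcap_n G n = V `&` F.
  by rewrite /G bigcapIr ?fattening_cap //; exists 0%N.
have mVF : measurable (V `&` F : set plane).
  by apply: measurableI; [exact: plane_open_measurable|exact: plane_closed_measurable].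
have finG n : (m2 (G n) < +oo)%E.
  apply: le_lt_trans fin; apply: le_measure; rewrite ?inE //; first exact: plane_open_measurable.
  by move=> x [].
have dec : {homo G : n m / (n <= m)%N >-> (m <= n)%O}.
  move=> n m nm; apply/subsetPset => x [Vx [z Fz zx]]; split => //; exists z => //.
  by apply: le_ball zx; rewrite lef_pV2 ?posrE // ler_nat ltnS.
have cv : (m2 \o G) n @[n --> \oo] --> m2 (V `&` F).
  by rewrite -capG; apply: nonincreasing_cvg_mu => //; rewrite capG.
have cvC : (C%:E * m2 (G n))%E @[n --> \oo] --> (C%:E * m2 (V `&` F))%E.
  by apply: cvgeZl.
rewrite -(cvg_lim _ cvC) //; apply: lime_ge; first by apply/cvg_ex; eexists; exact: cvC.
apply: nearW => n; apply: le_trans (H _ (oG n) _); last by move=> x [].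
apply: le_measure; rewrite ?inE // -capG; exact: bigcap_inf.
Qed.

End PlaneOpenSets.

(** * Comparison of areas between charts *)

Section PlaneArea.
Context {R : realType}.
Notation plane := (measurableTypeR R * measurableTypeR R)%type.
Implicit Types (x y w u : R * R) (k r l : R).

Definition strip y k (al be : R) : set (R * R) :=
  [set z | `|z.1 - y.1| <= al /\ `|z.2 - y.2 - k * (z.1 - y.1)| <= be].

Lemma strip_closed y k al be : closed (strip y k al be).
Proof.
have H1 z := has_gradB (has_grad_fst z) (has_grad_cst y.1 z).
have H2 z := has_gradB (has_gradB (has_grad_snd z) (has_grad_cst y.2 z))
  (has_gradM (has_grad_cst k z) (H1 z)).
rewrite (_ : strip y k al be =
  (fun z : R * R => `|z.1 - y.1|) @^-1` [set t | t <= al] `&`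
  (fun z : R * R => `|z.2 - y.2 - k * (z.1 - y.1)|) @^-1` [set t | t <= be]) //.
apply: closedI; (apply: closed_comp => [z _|]; last exact: closed_le).
  exact: cvg_norm (has_grad_continuous (H1 z)).
exact: cvg_norm (has_grad_continuous (H2 z)).
Qed.

Lemma strip_area y k al be : 0 < al -> 0 < be ->
  (area_measure (strip y k al be) <= (4 * (al * be))%:E)%E.
Proof.
move=> al0 be0.
(* The product measure unfolds to the integral of the lengths of the vertical slices. *)
change (\int[lebesgue_measure]_x ((@lebesgue_measure R) \o xsection (strip y k al be)) x <=
  (4 * (al * be))%:E)%E.
pose D := `[y.1 - al, y.1 + al]%classic.
apply: (@le_trans _ _ (\int[@lebesgue_measure R]_(x in D) (cst (2 * be)%:E) x)%E); last first.
  have E : (@lebesgue_measure R) (D : set R) = (2 * al)%:E.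
    rewrite /D lebesgue_measure_itv /= lte_fin ifT; last by lra.
    by rewrite -EFinB; congr EFin; ring.
  rewrite integral_cst; last exact: measurable_itv.
  apply: (@le_trans _ _ ((2 * be)%:E * (2 * al)%:E)%E); first by rewrite -E.
  by rewrite -EFinM lee_fin; lra.
rewrite [leRHS]integral_mkcond; apply: le_integral_pointwise => x _ //=.
rewrite /patch; case: ifPn => [/set_mem xD|xD].
  rewrite (_ : xsection _ _ = `[y.2 + k * (x - y.1) - be, y.2 + k * (x - y.1) + be]%classic).
    rewrite lebesgue_measure_itv /= lte_fin ifT; last by lra.
    by rewrite -EFinB lee_fin; lra.
  apply/seteqP; split => t; rewrite /xsection /= ?in_itv /=.
    by rewrite inE => -[_] /=; rewrite ler_norml => /andP[h1 h2]; apply/andP; split; lra.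
  move=> /andP[h1 h2]; rewrite inE; split => /=.
    by move: xD; rewrite /D /= in_itv /= => /andP[h3 h4]; rewrite ler_norml; apply/andP; split; lra.
  by rewrite ler_norml; apply/andP; split; lra.
rewrite (_ : xsection _ _ = set0) ?measure0 //.
apply/seteqP; split => t //; rewrite /xsection /= inE => -[/= h _].
case/negP: xD; rewrite inE /D /= in_itv /=.
by move: h; rewrite ler_norml => /andP[h1 h2]; apply/andP; split; lra.
Qed.

(* The parallelogram is enclosed in a sheared rectangle, whose vertical slices are
   intervals; the larger of [a], [b] determines the shear. *)
Lemma linear_image_area y (a b c d r : R) : a * d - b * c != 0 -> 0 < r ->
  exists P : set (R * R), [/\ measurable (P : set plane),
    (area_measure P <= (8 * `|a * d - b * c| * (r * r))%:E)%E &
    forall w, `|w| <= r -> P (y.1 + (a * w.1 + b * w.2), y.2 + (c * w.1 + d * w.2))].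
Proof.
move=> det0 r0.
have main (k p q : R) : 0 < p -> 0 < q -> p * q = `|a * d - b * c| ->
    (forall w, `|a * w.1 + b * w.2| <= 2 * p * `|w| /\
       `|c * w.1 + d * w.2 - k * (a * w.1 + b * w.2)| <= q * `|w|) ->
    exists P : set (R * R), [/\ measurable (P : set plane),
    (area_measure P <= (8 * `|a * d - b * c| * (r * r))%:E)%E &
    forall w, `|w| <= r -> P (y.1 + (a * w.1 + b * w.2), y.2 + (c * w.1 + d * w.2))].
  move=> p0 q0 pq H; exists (strip y k (2 * p * r) (q * r)); split.
  - by apply: plane_closed_measurable; exact: strip_closed.
  - apply: le_trans (strip_area _ _ _ _) _; rewrite ?mulr_gt0 //.
    by rewrite lee_fin -pq; lra.
  - move=> w wr; have [H1 H2] := H w; have ads (v z : R) : v + z - v = z by ring.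
    split => /=; rewrite !ads.
      by apply: le_trans H1 _; rewrite ler_wpM2l // mulr_ge0 // ltW.
    by apply: le_trans H2 _; rewrite ler_wpM2l // ltW.
have D0 : 0 < `|a * d - b * c| by rewrite normr_gt0.
have [ba|ab] := leP `|b| `|a|.
  have a0 : a != 0.
    apply: contra_neq det0 => a0; move: ba; rewrite a0 normr0 normr_le0 => /eqP ->.
    by rewrite !mul0r subrr.
  have na : 0 < `|a| by rewrite normr_gt0.
  apply: (main (c / a) `|a| (`|a * d - b * c| / `|a|)); rewrite ?divr_gt0 //.
    by rewrite mulrC divfK // gt_eqF.
  move=> w; have w1 := norm_fst_le w; have w2 := norm_snd_le w; split.
    apply: le_trans (ler_normD _ _) _; rewrite !normrM.
    have : `|a| * `|w.1| <= `|a| * `|w| by rewrite ler_wpM2l.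
    have : `|b| * `|w.2| <= `|a| * `|w| by apply: ler_pM.
    lra.
  rewrite (_ : _ - _ = (a * d - b * c) / a * w.2); last by field.
  by rewrite !normrM normfV ler_wpM2l // divr_ge0.
have nb : 0 < `|b| by apply: le_lt_trans ab.
have b0 : b != 0 by rewrite -normr_gt0.
apply: (main (d / b) `|b| (`|a * d - b * c| / `|b|)); rewrite ?divr_gt0 //.
  by rewrite mulrC divfK // gt_eqF.
move=> w; have w1 := norm_fst_le w; have w2 := norm_snd_le w; split.
  apply: le_trans (ler_normD _ _) _; rewrite !normrM.
  have : `|a| * `|w.1| <= `|b| * `|w| by apply: ler_pM => //; exact: ltW.
  have : `|b| * `|w.2| <= `|b| * `|w| by rewrite ler_wpM2l.
  lra.
rewrite (_ : _ - _ = - ((a * d - b * c) / b * w.1)); last by field.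
by rewrite normrN !normrM normfV ler_wpM2l // divr_ge0.
Qed.

Lemma csquare_dist u l x x' : csquare u l x -> csquare u l x' -> `|x' - x| <= l.
Proof.
move=> [/andP[a1 a2] /andP[b1 b2]] [/andP[c1 c2] /andP[d1 d2]]; apply/norm_pair_le => /=.
by split; rewrite ler_norml; apply/andP; split; lra.
Qed.

(** The remainder is absorbed in the argument: [t z = t x + J w], where [w] is [z - x] plus the
    inverse Jacobian applied to the remainder. For small [l] this correction is at most [l], so
    [|w| <= 2 l], and [8 (2 l)^2 = 32 l^2]. *)
Lemma differentiable_image_area (t : R * R -> R * R) x (a b c d : R) :
  has_grad (fst \o t) x a b -> has_grad (snd \o t) x c d -> a * d - b * c != 0 ->
  exists2 e : R, 0 < e & forall u l, 0 < l -> l < e -> csquare u l x ->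
    exists P : set (R * R), [/\ measurable (P : set plane),
      (area_measure P <= (32 * `|a * d - b * c| * (l * l))%:E)%E &
      forall z, square u l z -> P (t z)].
Proof.
move=> /has_gradP H1 /has_gradP H2; set dt := a * d - b * c => det0.
have D0 : 0 < `|dt| by rewrite normr_gt0.
(* [N] dominates the rows of the adjugate, so a remainder of slope [|dt| / N] has slope at most 1
   once the Jacobian is inverted. *)
pose N := 1 + `|a| + `|b| + `|c| + `|d|.
have N0 : 0 < N by rewrite /N !ltr_wpDr.
pose ep := `|dt| / N.
have ep0 : 0 < ep by rewrite divr_gt0.
have /nbhs_ballP[e1 /= e10 E1] := H1 _ ep0.
have /nbhs_ballP[e2 /= e20 E2] := H2 _ ep0.
exists (Num.min e1 e2); first by rewrite lt_min e10.
move=> u l l0; rewrite lt_min => /andP[le1 le2] ux.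
have l20 : 0 < 2 * l by rewrite mulr_gt0.
have [P [mP aP PP]] := linear_image_area (t x) det0 l20.
exists P; split => //.
  by apply: le_trans aP _; rewrite lee_fin; lra.
move=> z /square_csquare uz.
have zx := csquare_dist ux uz.
have B1 := E1 (z - x); rewrite -ball_normE /= sub0r normrN subrK in B1.
have {}B1 := B1 (le_lt_trans zx le1).
have B2 := E2 (z - x); rewrite -ball_normE /= sub0r normrN subrK in B2.
have {}B2 := B2 (le_lt_trans zx le2).
set h1 := z.1 - x.1 in B1 B2; set h2 := z.2 - x.2 in B1 B2.
set r1 := (t z).1 - _ - _ in B1; set r2 := (t z).2 - _ - _ in B2.
pose w := (h1 + (d * r1 - b * r2) / dt, h2 + (a * r2 - c * r1) / dt).
have small (p q : R) : `|p| + `|q| <= N -> `|(p * r1 - q * r2) / dt| <= l.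
  move=> pq; rewrite normrM normfV ler_pdivrMr //.
  apply: le_trans (ler_normB _ _) _; rewrite !normrM.
  have k1 : `|p| * `|r1| <= `|p| * (ep * l).
    by rewrite ler_wpM2l //; apply: le_trans B1 _; rewrite ler_wpM2l // ltW.
  have k2 : `|q| * `|r2| <= `|q| * (ep * l).
    by rewrite ler_wpM2l //; apply: le_trans B2 _; rewrite ler_wpM2l // ltW.
  have k3 : (`|p| + `|q|) * (ep * l) <= N * (ep * l).
    by rewrite ler_wpM2r // ltW // mulr_gt0.
  have k4 : N * (ep * l) = l * `|dt| by rewrite /ep; field; rewrite gt_eqF.
  lra.
have na := normr_ge0 a; have nb := normr_ge0 b; have nc := normr_ge0 c; have nd := normr_ge0 d.
have /norm_pair_le[/= hh1 hh2] := zx.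
have wl : `|w| <= 2 * l.
  apply/norm_pair_le; rewrite /w /=; split.
    apply: le_trans (ler_normD _ _) _.
    have : `|(d * r1 - b * r2) / dt| <= l by apply: small; rewrite /N; lra.
    by move: hh1; rewrite -/h1; lra.
  apply: le_trans (ler_normD _ _) _.
  have : `|(a * r2 - c * r1) / dt| <= l.
    by rewrite -normrN -mulNr opprB; apply: small; rewrite /N; lra.
  by move: hh2; rewrite -/h2; lra.
have := PP w wl; rewrite (_ : (_, _) = t z) // [RHS]surjective_pairing /w /=.
have dtE : dt = a * d - b * c by [].
congr pair.
  have -> : (t z).1 = (t x).1 + (a * h1 + b * h2) + r1 by rewrite /r1 /=; ring.
  by rewrite dtE in det0 *; field.
have -> : (t z).2 = (t x).2 + (c * h1 + d * h2) + r2 by rewrite /r2 /=; ring.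
by rewrite dtE in det0 *; field.
Qed.

(** The area seen through a transition map has to be a genuine measure before [square_bisection] and
    [measure_le_open] can be applied to it. *)
Lemma weighted_pushforward (f : plane -> \bar R) (h : plane -> plane) :
  measurable_fun setT f -> (forall y, 0 <= f y)%E -> measurable_fun setT h ->
  exists m : {measure set plane -> \bar R},
    forall E, m E = (\int[area_measure]_(y in h @^-1` E) f y)%E.
Proof.
move=> mf f0 mh.
pose m0 (E : set plane) := (\int[area_measure]_(y in h @^-1` E) f y)%E.
have m00 : m0 set0 = 0%E by rewrite /m0 preimage_set0 integral_set0.
have mge0 E : (0 <= m0 E)%E by apply: integral_ge0 => y _; exact: f0.
have msa : semi_sigma_additive m0.
  move=> F mF tF mUF; rewrite /m0 preimage_bigcup ge0_integral_bigcup //; last 3 first.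
  - by move=> k; rewrite -[X in measurable X]setTI; exact: mh.
  - exact: measurable_funTS.
  - by move=> i j _ _ [y [Fi Fj]]; apply: tF => //; exists (h y).
  by apply: is_cvg_ereal_nneg_natsum_cond => k _ _; exact: mge0.
pose mM := isMeasure.Build _ _ _ m0 m00 mge0 msa.
pose m : {measure set plane -> \bar R} := HB.pack m0 mM.
by exists m.
Qed.

Lemma integral_le_cst d (T : measurableType d) (mu : {measure set T -> \bar R})
  (A P : set T) (f : T -> \bar R) (c : R) : 0 <= c -> A `<=` P -> measurable P ->
  (forall t, A t -> 0 <= f t <= c%:E)%E -> (\int[mu]_(t in A) f t <= c%:E * mu P)%E.
Proof.
move=> c0 AP mP H; rewrite -integral_cst // integral_mkcond [leRHS]integral_mkcond.
apply: le_integral_pointwise => y _.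
  by apply: erestrict_ge0 => z /H/andP[].
rewrite /patch; case: ifPn => [/set_mem Ay|_].
  by rewrite ifT; [have /andP[] := H y Ay|exact/mem_set/AP].
by case: ifPn; rewrite ?lee_fin.
Qed.

Lemma integral_ge_cst d (T : measurableType d) (mu : {measure set T -> \bar R})
  (A P : set T) (f : T -> \bar R) (c : R) : 0 <= c -> P `<=` A -> measurable P ->
  (forall t, A t -> 0 <= f t)%E -> (forall t, P t -> c%:E <= f t)%E ->
  (c%:E * mu P <= \int[mu]_(t in A) f t)%E.
Proof.
move=> c0 AP mP f0 H; rewrite -integral_cst // integral_mkcond [leRHS]integral_mkcond.
apply: le_integral_pointwise => y _.
  by apply: erestrict_ge0 => z _; rewrite lee_fin.
rewrite /patch; case: ifPn => [/set_mem Py|_].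
  by rewrite ifT; [exact: H|exact/mem_set/AP].
by case: ifPn => // /set_mem /f0.
Qed.

Lemma plane_continuous_measurable (O : set (R * R)) (f : R * R -> R) : open O ->
  (forall x, O x -> {for x, continuous f}) -> measurable_fun (O : set plane) f.
Proof.
move=> oO fc; apply: (measurability _ (RGenOpens.measurableE R)).
move=> _ [_ [a [b ->] <-]]; apply: plane_open_measurable.
rewrite openE => x [Ox fx].
have n1 : nbhs x O by exact: open_nbhs_nbhs.
have n2 : nbhs x (f @^-1` `]a, b[%classic).
  by apply: (fc _ Ox); apply: open_nbhs_nbhs; split => //; exact: interval_open.
exact: filterI n1 n2.
Qed.

End PlaneArea.

(** * The area of one set read in two charts *)

Section ChartArea.
Context {R : realType} {S : closed_surface R} (g : riemannian_metric S).
Notation plane := (measurableTypeR R * measurableTypeR R)%type.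
Implicit Types (i j : 'I_(atlas_size S)) (x y : R * R) (A B : set S).

Definition chart_area i A : \bar R :=
  (\int[area_measure]_(x in chart_map (atlas i) @` A) (area_density g i x)%:E)%E.

Lemma area_density_ge0 i x : 0 <= area_density g i x.
Proof. exact: sqrtr_ge0. Qed.

Lemma area_density_continuous i x : chart_img (atlas i) x ->
  {for x, continuous (area_density g i)}.
Proof. by move=> /(has_grad_area_density g) /has_grad_continuous. Qed.

Lemma restricted_density_measurable i (V : set (R * R)) : open V ->
  V `<=` chart_img (atlas i) ->
  measurable_fun [set: plane] ((fun x => (area_density g i x)%:E) \_ V).
Proof.
move=> oV Vi; apply/(measurable_restrictT _ _).1; first exact: plane_open_measurable.
apply/measurable_EFinP; apply: (plane_continuous_measurable oV) => x /Vi.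
exact: area_density_continuous.
Qed.

Lemma transition_image i j A : A `<=` chart_dom (atlas i) `&` chart_dom (atlas j) ->
  chart_map (atlas j) @` A =
  overlap (atlas j) (atlas i) `&` transition (atlas j) (atlas i) @^-1` (chart_map (atlas i) @` A).
Proof.
move=> Aij; apply/seteqP; split => [_ [p Ap <-]|y [[p [jp ip] <-] /=]].
  by have [ip jp] := Aij p Ap; split; [exists p|exists p => //; rewrite transitionE].
rewrite transitionE // => -[q Aq qp]; exists q => //.
have [iq jq] := Aij q Aq.
by rewrite -(chart_mapK iq) qp chart_mapK.
Qed.

(* [m1] and [m2] are the areas computed in the charts [j] and [i], both carried by the
   coordinates of chart [i].  The constant is 32, from [differentiable_image_area],
   times 2 for the oscillation of each density on a small square. *)
Lemma transition_measures i j : exists m1 m2 : {measure set plane -> \bar R},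
  (forall A, A `<=` chart_dom (atlas i) `&` chart_dom (atlas j) ->
     m1 (chart_map (atlas i) @` A) = chart_area j A /\
     m2 (chart_map (atlas i) @` A) = chart_area i A) /\
  (forall O, open O -> O `<=` overlap (atlas i) (atlas j) -> (m1 O <= 128%:E * m2 O)%E).
Proof.
set U := overlap (atlas i) (atlas j); set V := overlap (atlas j) (atlas i).
have oU : open U by exact: overlap_open.
have oV : open V by exact: overlap_open.
have Ui : U `<=` chart_img (atlas i) by move=> x /overlap_img[].
have Vj : V `<=` chart_img (atlas j) by move=> x /overlap_img[].
pose tj := transition (atlas j) (atlas i).
(* Restriction to [V] makes the transition measurable on the whole plane; the default value taken
   outside is harmless, since the density restricted to [V] vanishes there. *)
pose h (y : plane) : plane := (((fst \o tj) \_ V) y, ((snd \o tj) \_ V) y).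
have mh : measurable_fun setT h.
  apply/measurable_fun_pairP; split.
    apply/(measurable_restrictT _ _).1; first exact: plane_open_measurable.
    apply: (plane_continuous_measurable oV) => y Vy.
    exact: has_grad_continuous (has_grad_tr_comp ord0 Vy).
  apply/(measurable_restrictT _ _).1; first exact: plane_open_measurable.
  apply: (plane_continuous_measurable oV) => y Vy.
  exact: has_grad_continuous (has_grad_tr_comp ord_max Vy).
have hE y : V y -> h y = tj y.
  by move=> Vy; rewrite /h /patch !ifT ?mem_set // -surjective_pairing.
have d0 k (W : set (R * R)) y : (0 <= ((fun x => (area_density g k x)%:E) \_ W) y)%E.
  by apply: erestrict_ge0 => z _; rewrite lee_fin area_density_ge0.
have [m1 m1E] := weighted_pushforward (restricted_density_measurable oV Vj) (d0 j V) mh.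
have [m2 m2E] := weighted_pushforward (restricted_density_measurable oU Ui) (d0 i U) (measurable_id (D := setT)).
have m1E' E : m1 E = (\int[area_measure]_(y in h @^-1` E `&` V) (area_density g j y)%:E)%E.
  by rewrite m1E -integral_mkcondr.
have m2E' E : m2 E = (\int[area_measure]_(y in E `&` U) (area_density g i y)%:E)%E.
  by rewrite m2E -integral_mkcondr preimage_id.
exists m1, m2; split.
  move=> A Aij; rewrite m1E' m2E' /chart_area; split.
    congr (integral _ _ _); rewrite (transition_image Aij) -/V setIC.
    by apply/seteqP; split => y [Vy]; rewrite /= hE //; split => //=; rewrite hE.
  congr (integral _ _ _); apply/setIidPl => _ [p /Aij[ip jp] <-].
  exact: overlapP.
move=> O oO OU; apply: measure_le_open => // u l l0 uO.
apply: square_bisection => // x /uO /OU Ux.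
have a0 : has_grad (fst \o transition (atlas i) (atlas j)) x
    (tr_jac i j ord0 ord0 x) (tr_jac i j ord0 ord_max x) := has_grad_tr_comp ord0 Ux.
have a1 : has_grad (snd \o transition (atlas i) (atlas j)) x
    (tr_jac i j ord_max ord0 x) (tr_jac i j ord_max ord_max x) := has_grad_tr_comp ord_max Ux.
have det0 := tr_det_neq0 g Ux.
have [e e0 He] := differentiable_image_area a0 a1 det0.
rewrite -/(tr_det i j x) in He.
set t := transition (atlas i) (atlas j) in a0 a1 He.
have [ix jtx] := overlap_img Ux.
have di0 := area_density_gt0 g ix; have dj0 := area_density_gt0 g jtx.
have dE := area_density_transition g Ux.
have tc : t @ x --> t x.
  have P := cvg_pair (has_grad_continuous a0) (has_grad_continuous a1).
  have E : (fun z => ((fst \o t) z, (snd \o t) z)) = t.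
    by apply/funext => z; rewrite [RHS]surjective_pairing.
  by rewrite -[X in X @ _]E (_ : t x = ((fst \o t) x, (snd \o t) x)) -?surjective_pairing //; exact: (P _ _ _).
have n1 : nbhs x U by exact: open_nbhs_nbhs.
have n2 : \forall y \near x, area_density g i x / 2 < area_density g i y.
  apply: (cvgr_gt _ (area_density_continuous ix)).
  by rewrite ltr_pdivrMr // ltr_pMr // ltr1n.
have n3 : \forall y \near x, area_density g j (t y) < 2 * area_density g j (t x).
  have cc : {for x, continuous (area_density g j \o t)}.
    by apply: continuous_comp tc _; exact: area_density_continuous.
  by apply: (cvgr_lt _ cc); rewrite /= ltr_pMl // ltr1n.
have n4 : nbhs x (U `&` ((fun y => area_density g i x / 2 < area_density g i y) `&`
     (fun y => area_density g j (t y) < 2 * area_density g j (t x)))).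
  by apply: filterI => //; exact: filterI.
have /nbhs_ballP[e1 /= e10 E1] := n4.
exists (Num.min e e1); first by rewrite lt_min e0.
move=> v k k0; rewrite lt_min => /andP[ke ke1] vx.
have [P [mP aP PP]] := He v k k0 ke vx.
have near_sq z : square v k z -> [/\ U z, area_density g i x / 2 < area_density g i z &
    area_density g j (t z) < 2 * area_density g j (t x)].
  move=> /square_csquare vz; have zx := csquare_dist vx vz.
  have [h1 [h2 h3]] : (U `&` ((fun y => area_density g i x / 2 < area_density g i y) `&`
     (fun y => area_density g j (t y) < 2 * area_density g j (t x)))) z.
    by apply: E1; rewrite -ball_normE /= distrC; exact: le_lt_trans zx ke1.
  by split.
have up : (m1 (square v k) <= (2 * area_density g j (t x))%:E * area_measure P)%E.
  rewrite m1E'; apply: integral_le_cst => //.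
  - by rewrite mulr_ge0 // ltW.
  - move=> y [hy Vy]; rewrite /= hE // in hy.
    have := PP _ hy; rewrite /t /tj; move: Vy => [p [jp ip] <-].
    by rewrite !transitionE.
  - move=> y [hy Vy]; rewrite /= hE // in hy; rewrite !lee_fin area_density_ge0 /=.
    have [_ _ /ltW] := near_sq _ hy; rewrite /t /tj; move: Vy => [p [jp ip] <-].
    by rewrite !transitionE.
have down : ((area_density g i x / 2)%:E * area_measure (square v k) <= m2 (square v k))%E.
  rewrite m2E'; apply: integral_ge_cst.
  - by rewrite divr_ge0 // ltW.
  - by move=> y vy; split => //; have [] := near_sq y vy.
  - exact: square_measurable.
  - by move=> y _; rewrite lee_fin area_density_ge0.
  - by move=> y vy; rewrite lee_fin ltW //; have [] := near_sq y vy.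
apply: le_trans up _; apply: (@le_trans _ _ ((2 * area_density g j (t x))%:E * (32 * `|tr_det i j x| * (k * k))%:E)%E).
  by rewrite lee_wpmul2l // lee_fin mulr_ge0 // ltW.
apply: (@le_trans _ _ (128%:E * ((area_density g i x / 2)%:E * area_measure (square v k)))%E); last first.
  by rewrite lee_wpmul2l // lee_fin.
rewrite square_area // -!EFinM lee_fin dE -/t.
by rewrite le_eqVlt; apply/orP; left; apply/eqP; field.
Qed.

Lemma chart_area_le i j A : open A -> A `<=` chart_dom (atlas i) `&` chart_dom (atlas j) ->
  (chart_area j A <= 128%:E * chart_area i A)%E.
Proof.
move=> oA Aij; have [m1 [m2 [mE mle]]] := transition_measures i j.
have [<- <-] := mE A Aij; apply: mle.
  rewrite (_ : chart_map (atlas i) @` A = chart_map (atlas i) @` (chart_dom (atlas i) `&` A)).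
    exact: chart_image_open.
  by congr (_ @` _); apply/esym/setIidPr => p /Aij[].
by move=> _ [p /Aij[ip jp] <-]; exact: overlapP.
Qed.

Lemma chart_image_subset_open i A : open A -> A `<=` chart_dom (atlas i) ->
  open (chart_map (atlas i) @` A).
Proof.
move=> oA Ai; rewrite (_ : chart_map (atlas i) @` A = chart_map (atlas i) @` (chart_dom (atlas i) `&` A)).
  exact: chart_image_open.
by congr (_ @` _); apply/esym/setIidPr.
Qed.

Lemma chart_image_setD i A B : A `<=` chart_dom (atlas i) ->
  chart_map (atlas i) @` (A `\` B) =
  chart_map (atlas i) @` A `&` ~` (chart_map (atlas i) @` (A `&` B)).
Proof.
move=> Ai; apply/seteqP; split => [_ [p [Ap nBp] <-]|_ [[p Ap <-] nB]].
  split; first by exists p.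
  move=> [q [Aq Bq] qp]; apply: nBp.
  by rewrite -(chart_mapK (Ai p Ap)) -qp chart_mapK //; exact: Ai.
by exists p => //; split => // Bp; apply: nB; exists p.
Qed.

(** In coordinates the difference is an open set intersected with a closed one, the case treated by
    [measure_le_open_closed]. *)
Lemma chart_area_setD_le i j A B : open A -> open B ->
  A `<=` chart_dom (atlas i) `&` chart_dom (atlas j) -> (chart_area i A < +oo)%E ->
  (chart_area j (A `\` B) <= 128%:E * chart_area i (A `\` B))%E.
Proof.
move=> oA oB Aij fin; have [m1 [m2 [mE mle]]] := transition_measures i j.
have ABij : A `\` B `<=` chart_dom (atlas i) `&` chart_dom (atlas j) by move=> p [/Aij].
have Ai : A `<=` chart_dom (atlas i) by move=> p /Aij[].
have [<- <-] := mE _ ABij.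
rewrite chart_image_setD //; apply: measure_le_open_closed => //.
- exact: chart_image_subset_open.
- by apply: open_closedC; apply: chart_image_subset_open; [exact: openI|move=> p [/Ai]].
- by have [_ ->] := mE A Aij.
- move=> O oO OA; apply: mle => // x /OA[p /Aij[ip jp] <-]; exact: overlapP.
Qed.

End ChartArea.

(** * Area of boxes, coverings and packings on the surface *)

Section AreaBounds.
Context {R : realType} {S : closed_surface R} (g : riemannian_metric S).
Notation plane := (measurableTypeR R * measurableTypeR R)%type.
Notation N := (atlas_size S).
Implicit Types (i j : 'I_(atlas_size S)) (x y w : R * R) (A B : set S) (K r : R).

Lemma area_density_bounds K i y : 1 <= K -> geom_bound g K i y ->
  K^-1 <= area_density g i y <= K.
Proof.
move=> K1 [iy [AK DK] dK _ _].
have A0 := gA_gt0 g iy; have D0 := gD_gt0 g iy; have d0 := gdet_gt0 g iy.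
have K0 : 0 < K by lra.
have e0 := area_density_gt0 g iy.
have sq : area_density g i y ^+ 2 = gdet g i y by rewrite area_densityE // sqr_sqrtr // ltW.
have up : gdet g i y <= K ^+ 2.
  rewrite /gdet; have B2 : 0 <= gB g i y * gB g i y by rewrite -expr2 sqr_ge0.
  have : gA g i y * gD g i y <= K * K by apply: ler_pM => //; exact: ltW.
  by rewrite expr2; move: (gB g i y * gB g i y) (gA g i y * gD g i y) B2 => a b; lra.
have down : K^-1 ^+ 2 <= gdet g i y.
  have h : K^-1 <= gdet g i y by rewrite -[leRHS]invrK lef_pV2 // posrE invr_gt0.
  apply: le_trans h; rewrite expr2 ler_piMl ?invr_ge0 ?(ltW K0) //.
  by rewrite invf_le1.
apply/andP; split.
  by rewrite -(@ler_pXn2r _ 2) ?nnegrE ?invr_ge0 ?(ltW K0) ?(ltW e0) // sq.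
by rewrite -(@ler_pXn2r _ 2) ?nnegrE ?(ltW K0) ?(ltW e0) // sq.
Qed.

Lemma chart_area_ge0 i A : (0 <= chart_area g i A)%E.
Proof. by apply: integral_ge0 => x _; rewrite lee_fin area_density_ge0. Qed.

Lemma chart_area_mono i A B : A `<=` B -> (chart_area g i A <= chart_area g i B)%E.
Proof.
move=> AB; apply: subset_integral_pointwise; first exact: image_subset.
by move=> x _; rewrite lee_fin area_density_ge0.
Qed.

Lemma riemannian_areaE A :
  riemannian_area g A = (\sum_(i < N) chart_area g i (A `&` chart_piece i))%E.
Proof. by []. Qed.

Lemma riemannian_area_ge0 A : (0 <= riemannian_area g A)%E.
Proof. by rewrite riemannian_areaE; apply: sume_ge0 => i _; exact: chart_area_ge0. Qed.

Lemma riemannian_area_mono A B : A `<=` B -> (riemannian_area g A <= riemannian_area g B)%E.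
Proof.
move=> AB; rewrite !riemannian_areaE; apply: lee_sum => i _.
by apply: chart_area_mono; exact: setSI.
Qed.

(** [chart_area] is an integral over an image; once it is given by a measure on the plane, it
    inherits additivity. *)
Lemma chart_measure i : exists m : {measure set plane -> \bar R},
  forall A, A `<=` chart_dom (atlas i) -> m (chart_map (atlas i) @` A) = chart_area g i A.
Proof.
have d0 y : (0 <= ((fun x => (area_density g i x)%:E) \_ (chart_img (atlas i))) y)%E.
  by apply: erestrict_ge0 => z _; rewrite lee_fin area_density_ge0.
have oi : open (chart_img (atlas i)) by exact: chart_img_open.
have [m mE] := weighted_pushforward
  (restricted_density_measurable g oi (@subset_refl _ _)) d0 (measurable_id (D := setT)).
exists m => A Ai; rewrite mE -integral_mkcondr preimage_id /chart_area.
by congr (integral _ _ _); apply/setIidPl; exact: image_subset.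
Qed.

Lemma chart_image_inj i A B : A `<=` chart_dom (atlas i) -> B `<=` chart_dom (atlas i) ->
  chart_map (atlas i) @` A `&` chart_map (atlas i) @` B = chart_map (atlas i) @` (A `&` B).
Proof.
move=> Ai Bi; apply/seteqP; split => [_ [[p Ap <-] [q Bq qp]]|_ [p [Ap Bp] <-]].
  exists p => //; split=> //.
  by rewrite -(chart_mapK (Ai p Ap)) -qp chart_mapK //; exact: Bi.
by split; exists p.
Qed.

Lemma earlier_charts_open j :
  open (\bigcup_(k in [set k : 'I_N | (k < j)%N]) chart_dom (atlas k)).
Proof. by apply: bigcup_open => k _; exact: chart_dom_open. Qed.

Lemma chart_pieceE j A : A `&` chart_piece j = (A `&` chart_dom (atlas j)) `\`
  \bigcup_(k in [set k : 'I_N | (k < j)%N]) chart_dom (atlas k).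
Proof. by rewrite /chart_piece setIDA. Qed.

Lemma chart_piece_cover p : exists j, chart_piece j p.
Proof.
have [i0 h0] := atlas_cover p.
pose P (j : 'I_N) := `[< chart_dom (atlas j) p >].
have P0 : P i0 by apply/asboolP.
case: (arg_minnP (fun j : 'I_N => nat_of_ord j) P0) => j /asboolP jp jmin.
exists j; split => // -[k /= kj kp].
by move: kj; rewrite ltnNge jmin //; exact/asboolP.
Qed.

Lemma piece_image_measurable i j A : open A -> A `<=` chart_dom (atlas i) ->
  measurable (chart_map (atlas i) @` (A `&` chart_piece j) : set plane).
Proof.
move=> oA Ai; have Aj : A `&` chart_dom (atlas j) `<=` chart_dom (atlas i) by move=> p [/Ai].
have oAj : open (A `&` chart_dom (atlas j)) by apply: openI => //; exact: chart_dom_open.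
rewrite chart_pieceE chart_image_setD //; apply: measurableI.
  by apply: plane_open_measurable; exact: chart_image_subset_open.
apply: measurableC; apply: plane_open_measurable; apply: chart_image_subset_open.
  by apply: openI => //; exact: earlier_charts_open.
by move=> p [/Aj].
Qed.

Lemma chart_piece_image_measurable j A : open A ->
  measurable (chart_map (atlas j) @` (A `&` chart_piece j) : set plane).
Proof.
move=> oA; rewrite (_ : A `&` _ = (A `&` chart_dom (atlas j)) `&` chart_piece j).
  apply: piece_image_measurable; last by move=> p [].
  by apply: openI => //; exact: chart_dom_open.
by rewrite -setIA; congr (_ `&` _); apply/esym/setIidPr => p [].
Qed.

Lemma piece_sub j A : A `&` chart_piece j `<=` chart_dom (atlas j).
Proof. by move=> p [_ []]. Qed.

(** Open sets meet each [chart_piece] in a set with measurable image, so subadditivity holds for the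
    measure of each chart and can be summed over the pieces. *)
Lemma riemannian_area_setU A B : open A -> open B ->
  (riemannian_area g (A `|` B) <= riemannian_area g A + riemannian_area g B)%E.
Proof.
move=> oA oB; rewrite !riemannian_areaE -big_split /=; apply: lee_sum => j _.
have [m mE] := chart_measure j.
rewrite -!mE ?setIUl ?image_setU; try exact: piece_sub; last first.
  by move=> p [|] /piece_sub.
by apply: measureU2; exact: chart_piece_image_measurable.
Qed.

Lemma riemannian_area_disjoint A B : open A -> open B -> A `&` B = set0 ->
  (riemannian_area g (A `|` B) = riemannian_area g A + riemannian_area g B)%E.
Proof.
move=> oA oB AB; rewrite !riemannian_areaE -big_split /=; apply: eq_bigr => j _.
have [m mE] := chart_measure j.
rewrite -!mE ?setIUl ?image_setU; try exact: piece_sub; last first.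
  by move=> p [|] /piece_sub.
apply: measureU; try exact: chart_piece_image_measurable.
rewrite chart_image_inj; try exact: piece_sub.
by rewrite setIACA AB set0I image_set0.
Qed.

Section Families.
Variables (I : choiceType) (F : I -> set S).

(** Openness is asked of the covering sets; [A] may be any set, such as the tube. *)
Lemma area_cover_le (s : seq I) A (c : R) : (forall k, k \in s -> open (F k)) ->
  (forall k, k \in s -> (riemannian_area g (F k) <= c%:E)%E) ->
  (forall p, A p -> exists2 k, k \in s & F k p) ->
  (riemannian_area g A <= ((size s)%:R * c)%:E)%E.
Proof.
move=> oF aF AF; apply: (@le_trans _ _ (riemannian_area g (\bigcup_(k in [set` s]) F k))).
  by apply: riemannian_area_mono => p /AF[k ks Fk]; exists k.
rewrite bigcup_seq; elim: s oF aF {AF} => [|k s IH] oF aF.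
  rewrite big_nil mul0r riemannian_areaE big1 // => j _.
  by rewrite set0I /chart_area image_set0 integral_set0.
rewrite big_cons; apply: le_trans (riemannian_area_setU _ _) _.
- by apply: oF; rewrite mem_head.
- by rewrite -bigcup_seq; apply: bigcup_open => l /= ls; apply: oF; rewrite inE ls orbT.
rewrite /= -add1n natrD mulrDl mul1r EFinD; apply: leeD.
  by apply: aF; rewrite mem_head.
by apply: IH => l ls; [apply: oF|apply: aF]; rewrite inE ls orbT.
Qed.

Lemma area_packing_ge (s : seq I) A (c : R) : uniq s ->
  (forall k, k \in s -> open (F k)) ->
  (forall k, k \in s -> (c%:E <= riemannian_area g (F k))%E) ->
  (forall k l p, k \in s -> l \in s -> F k p -> F l p -> k = l) ->
  (forall k, k \in s -> F k `<=` A) ->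
  (((size s)%:R * c)%:E <= riemannian_area g A)%E.
Proof.
move=> us oF aF dF AF; apply: (@le_trans _ _ (riemannian_area g (\bigcup_(k in [set` s]) F k))); last first.
  by apply: riemannian_area_mono => p [k /= /AF]; apply.
rewrite bigcup_seq; elim: s us oF aF dF {AF} => [|k s IH] /=.
  by move=> *; rewrite mul0r riemannian_area_ge0.
move=> /andP[ks us] oF aF dF; rewrite big_cons riemannian_area_disjoint.
- rewrite -add1n natrD mulrDl mul1r EFinD; apply: leeD.
    by apply: aF; rewrite mem_head.
  apply: IH => //.
  + by move=> l ls; apply: oF; rewrite inE ls orbT.
  + by move=> l ls; apply: aF; rewrite inE ls orbT.
  + by move=> a b p sa sb; apply: dF; rewrite inE ?sa ?sb orbT.
- by apply: oF; rewrite mem_head.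
- by rewrite -bigcup_seq; apply: bigcup_open => l /= ls; apply: oF; rewrite inE ls orbT.
- rewrite -bigcup_seq -subset0 => p [Fk [l /= ls Fl]].
  have E : k = l by apply: (dF _ _ p) => //; rewrite inE ?eqxx ?ls ?orbT.
  by move: ks; rewrite E ls.
Qed.

End Families.

Lemma measure_bigsetU_le (m : {measure set plane -> \bar R}) (I : choiceType) (F : I -> set plane)
  (s : seq I) : (forall k, measurable (F k)) ->
  (m (\bigcup_(k in [set` s]) F k) <= \sum_(k <- s) m (F k))%E.
Proof.
move=> mF; rewrite bigcup_seq; elim: s => [|k s IH]; first by rewrite !big_nil measure0.
rewrite !big_cons; apply: le_trans (measureU2 _ _ _) _ => //; last exact: leeD2l.
by apply: bigsetU_measurable => l _.
Qed.

(** Half-open squares of sides [r] and [2 r] about [x], one inside the open box and one around it,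
    bracket the area. *)
Lemma box_chart_area i x K r : 1 <= K -> 0 < r ->
  (forall w, `|w - x| <= r -> geom_bound g K i w) ->
  ((r ^+ 2 / K)%:E <= chart_area g i (chart_box i x r))%E /\
  (chart_area g i (chart_box i x r) <= (4 * K * r ^+ 2)%:E)%E.
Proof.
move=> K1 r0 gb; have K0 : 0 < K by lra.
have im w : `|w - x| <= r -> chart_img (atlas i) w by move=> /gb[].
split.
  pose u := (x.1 - r / 2, x.2 - r / 2).
  have sq w : square u r w -> (chart_map (atlas i) @` chart_box i x r) w /\ geom_bound g K i w.
    move=> [/= /andP[a1 a2] /andP[b1 b2]].
    have wr : `|w - x| <= r / 2.
      by apply/norm_pair_le; split => /=; rewrite ler_norml; apply/andP; split; lra.
    have wr' : `|w - x| < r by lra.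
    split; last exact/gb/ltW.
    have [h1 h2] := chart_invK (im _ (ltW wr')).
    by exists (chart_inv (atlas i) w) => //; split => //; rewrite h2.
  apply: (@le_trans _ _ ((K^-1)%:E * area_measure (square u r))%E).
    by rewrite square_area // -EFinM lee_fin expr2 mulrC.
  apply: integral_ge_cst.
  - by rewrite invr_ge0 ltW.
  - by move=> w /sq[].
  - exact: square_measurable.
  - by move=> w _; rewrite lee_fin area_density_ge0.
  - by move=> w /sq[_ /(area_density_bounds K1)/andP[h _]]; rewrite lee_fin.
pose u := (x.1 - r, x.2 - r).
have sub w : (chart_map (atlas i) @` chart_box i x r) w -> square u (2 * r) w /\ geom_bound g K i w.
  move=> [p [ip pr] <-]; split; last exact/gb/ltW.
  have : `|(chart_map (atlas i) p - x).1| < r /\ `|(chart_map (atlas i) p - x).2| < r.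
    by split; apply: le_lt_trans pr; [exact: norm_fst_le|exact: norm_snd_le].
  rewrite /= !ltr_norml => -[/andP[a1 a2] /andP[b1 b2]].
  by split; apply/andP; split; rewrite /u /=; lra.
apply: (@le_trans _ _ (K%:E * area_measure (square u (2 * r)))%E).
  apply: integral_le_cst.
  - exact: ltW.
  - by move=> w /sub[].
  - exact: square_measurable.
  - by move=> w /sub[_ /(area_density_bounds K1)/andP[_ h]]; rewrite !lee_fin area_density_ge0 h.
rewrite square_area ?mulr_gt0 // -EFinM lee_fin expr2.
by rewrite le_eqVlt; apply/orP; left; apply/eqP; ring.
Qed.

(** The factor 512 is 128, from the comparison of charts, times 4, from the enclosing square of side
    [2 r]; the number of charts counts the pieces. *)
Lemma box_area_le i x K r : 1 <= K -> 0 < r ->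
  (forall w, `|w - x| <= r -> geom_bound g K i w) ->
  (riemannian_area g (chart_box i x r) <= (N%:R * (512 * K) * r ^+ 2)%:E)%E.
Proof.
move=> K1 r0 gb; have [_ up] := box_chart_area K1 r0 gb.
have oA := chart_box_open i x r.
set A := chart_box i x r in up oA *.
apply: (@le_trans _ _ (\sum_(j < N) (512 * K * r ^+ 2)%:E)%E); last first.
  by rewrite sumEFin lee_fin sumr_const card_ord -[X in X <= _]mulr_natl !mulrA.
rewrite riemannian_areaE; apply: lee_sum => j _.
apply: (@le_trans _ _ (chart_area g j (A `&` chart_dom (atlas j)))).
  by apply: chart_area_mono => p [Ap []].
have le1 := @chart_area_le _ _ g i j (A `&` chart_dom (atlas j)).
apply: le_trans (le1 _ _) _.
- by apply: openI => //; exact: chart_dom_open.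
- by move=> p [[ip _] jp].
apply: (@le_trans _ _ (128%:E * (4 * K * r ^+ 2)%:E)%E); last first.
  by rewrite -EFinM lee_fin le_eqVlt; apply/orP; left; apply/eqP; ring.
rewrite lee_wpmul2l ?lee_fin //; apply: le_trans up.
by apply: chart_area_mono => p [].
Qed.

(** The area in chart [i] splits over the pieces, and each is compared with the area in its own
    chart. A piece is an open set minus an open set, hence [chart_area_setD_le], whose finiteness
    hypothesis comes from the comparison of open sets. *)
Lemma box_area_ge i x K r : 1 <= K -> 0 < r ->
  (forall w, `|w - x| <= r -> geom_bound g K i w) ->
  ((r ^+ 2 / (128 * K))%:E <= riemannian_area g (chart_box i x r))%E.
Proof.
move=> K1 r0 gb; have [down up] := box_chart_area K1 r0 gb.
have K0 : 0 < K by lra.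
have oA := chart_box_open i x r.
have Ai : chart_box i x r `<=` chart_dom (atlas i) by move=> p [].
set A := chart_box i x r in down up oA Ai *.
have main : (chart_area g i A <= 128%:E * riemannian_area g A)%E.
  have [m mE] := chart_measure i.
  apply: (@le_trans _ _ (\sum_(j < N) chart_area g i (A `&` chart_piece j))%E).
    rewrite -mE // (_ : _ @` A = \bigcup_(j in [set` index_enum 'I_N])
        chart_map (atlas i) @` (A `&` chart_piece j)).
      apply: le_trans (measure_bigsetU_le _ _ _) _.
        by move=> j; exact: piece_image_measurable.
      by apply: lee_sum => j _; rewrite mE // => p [/Ai].
    apply/seteqP; split => [_ [p Ap <-]|w [j _ [p [Ap _] <-]]]; last by exists p.
    by have [j jp] := chart_piece_cover p; exists j => /=; [exact: mem_index_enum|exists p].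
  rewrite riemannian_areaE ge0_sume_distrr; last by move=> j _; exact: chart_area_ge0.
  apply: lee_sum => j _.
  have oAj : open (A `&` chart_dom (atlas j)) by apply: openI => //; exact: chart_dom_open.
  have Aij : A `&` chart_dom (atlas j) `<=` chart_dom (atlas i) `&` chart_dom (atlas j).
    by move=> p [/Ai].
  rewrite chart_pieceE; apply: chart_area_setD_le => //.
  - exact: earlier_charts_open.
  - by move=> p /Aij[].
  - apply: le_lt_trans (chart_area_le g oAj Aij) _.
    apply: (@le_lt_trans _ _ (128%:E * (4 * K * r ^+ 2)%:E)%E); last by rewrite -EFinM ltry.
    rewrite lee_wpmul2l ?lee_fin //; apply: le_trans up.
    by apply: chart_area_mono => p [].
have : ((r ^+ 2 / K)%:E <= 128%:E * riemannian_area g A)%E by exact: le_trans main.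
have := riemannian_area_ge0 A.
case: (riemannian_area g A) => [a||] //= _; last by rewrite leey.
rewrite -EFinM !lee_fin => h; rewrite (_ : r ^+ 2 / _ = r ^+ 2 / K / 128).
  by rewrite ler_pdivrMr // [leRHS]mulrC.
by rewrite invfM mulrA mulrAC.
Qed.

End AreaBounds.

(** * Uniform charts *)

Section UniformGeometry.
Context {R : realType} {S : closed_surface R} (g : riemannian_metric S).
Implicit Types (i j : 'I_(atlas_size S)) (x y w : R * R) (p q : S) (K r : R).

Lemma geom_bound_mono K K' i y : K <= K' -> geom_bound g K i y -> geom_bound g K' i y.
Proof.
move=> KK [iy [a b] c d e].
by split; [exact: iy|split; [exact: le_trans a KK|exact: le_trans b KK]|exact: le_trans c KK
  |exact: le_trans d KK|exact: le_trans e KK].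
Qed.

Lemma geom_bound_continuous i x : chart_img (atlas i) x ->
  [/\ {for x, continuous (gA g i)}, {for x, continuous (gD g i)},
      {for x, continuous (fun y => (gdet g i y)^-1)},
      {for x, continuous (drift0 g i)} & {for x, continuous (drift1 g i)}].
Proof.
move=> ix.
have cA : gA g i @ x --> gA g i x := smooth_continuous (metric_smooth g i _ _) ix.
have cB : gB g i @ x --> gB g i x := smooth_continuous (metric_smooth g i _ _) ix.
have cD : gD g i @ x --> gD g i x := smooth_continuous (metric_smooth g i _ _) ix.
have cpA k : partial k (gA g i) @ x --> partial k (gA g i) x :=
  smooth_continuous (smooth_partial k (metric_smooth g i _ _)) ix.
have cpB k : partial k (gB g i) @ x --> partial k (gB g i) x :=
  smooth_continuous (smooth_partial k (metric_smooth g i _ _)) ix.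
have cpD k : partial k (gD g i) @ x --> partial k (gD g i) x :=
  smooth_continuous (smooth_partial k (metric_smooth g i _ _)) ix.
have cdet : gdet g i @ x --> gdet g i x.
  by apply: cvgB; apply: cvgM.
have cgp k : gdet_partial g i k @ x --> gdet_partial g i k x.
  apply: cvgB; first by apply: cvgD; apply: cvgM.
  by apply: cvgM; [exact: cvg_cst|apply: cvgM].
have det0 : gdet g i x != 0 by rewrite gt_eqF // gdet_gt0.
have cdV : (fun y => (gdet g i y)^-1) @ x --> (gdet g i x)^-1 by exact: cvgV.
have c2V : (fun y => (2 * (gdet g i y * gdet g i y))^-1) @ x -->
    (2 * (gdet g i x * gdet g i x))^-1.
  apply: cvgV; first by rewrite !mulf_neq0.
  by apply: cvgM; [exact: cvg_cst|apply: cvgM].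
split => //.
- apply: cvgB; apply: cvgM => //; first by apply: cvgB.
  by apply: cvgB; apply: cvgM.
- apply: cvgB; apply: cvgM => //; first by apply: cvgB.
  by apply: cvgB; apply: cvgM.
Qed.

Lemma geom_bound_near i x : chart_img (atlas i) x ->
  exists2 K, 1 <= K & \forall y \near x, geom_bound g K i y.
Proof.
move=> ix; have [cA cD cd c0 c1] := geom_bound_continuous ix.
have near_le (f : R * R -> R) : {for x, continuous f} ->
    \forall y \near x, f y <= `|f x| + 1.
  move=> fc; have lt1 : f x < `|f x| + 1 by rewrite ltr_pwDr // ler_norm.
  by apply: filterS (cvgr_lt _ fc _ lt1) => y; exact: ltW.
have near_abs (f : R * R -> R) : {for x, continuous f} ->
    \forall y \near x, `|f y| <= `|f x| + 1.
  move=> fc; have fc' : {for x, continuous (fun y => `|f y|)} by apply: cvg_norm; exact: fc.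
  by have := near_le _ fc'; rewrite normr_id.
have nI : \forall y \near x, chart_img (atlas i) y.
  by apply: open_nbhs_nbhs; split => //; exact: chart_img_open.
have lt1 (t : R) : 1 <= `|t| + 1 by rewrite lerDr.
suff main (a b c d e : R) : 1 <= a -> 1 <= b -> 1 <= c -> 1 <= d -> 1 <= e ->
    (\forall y \near x, gA g i y <= a) -> (\forall y \near x, gD g i y <= b) ->
    (\forall y \near x, (gdet g i y)^-1 <= c) -> (\forall y \near x, `|drift0 g i y| <= d) ->
    (\forall y \near x, `|drift1 g i y| <= e) ->
    exists2 K, 1 <= K & \forall y \near x, geom_bound g K i y.
  exact: (main _ _ _ _ _ (lt1 _) (lt1 _) (lt1 _) (lt1 _) (lt1 _)
    (near_le _ cA) (near_le _ cD) (near_le _ cd) (near_abs _ c0) (near_abs _ c1)).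
move=> a1 b1 c1' d1 e1 nA nD nd n0 n1.
exists (a + b + c + d + e); first by lra.
have [ha hb hc hd he] : [/\ a <= a + b + c + d + e, b <= a + b + c + d + e,
    c <= a + b + c + d + e, d <= a + b + c + d + e & e <= a + b + c + d + e].
  by split; lra.
apply: filterS (filterI nI (filterI (filterI nA nD) (filterI nd (filterI n0 n1)))).
move=> y [iy [[yA yD] [yd [y0 y1]]]]; split; [exact: iy|split|..].
- exact: le_trans yA ha.
- exact: le_trans yD hb.
- exact: le_trans yd hc.
- exact: le_trans y0 hd.
- exact: le_trans y1 he.
Qed.

(** Bounds and size of the chart share one parameter: the condition is monotone in [K], so a maximum
    over a finite subcover makes it uniform. *)
Definition good_chart K p i :=
  chart_dom (atlas i) p /\
  forall w, `|w - chart_map (atlas i) p| <= K^-1 -> geom_bound g K i w.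

Lemma good_chart_near p : exists K, exists i, exists U : set S,
  [/\ open U, U p & forall q, U q -> forall K', K <= K' -> good_chart K' q i].
Proof.
have [i ip] := atlas_cover p.
set x := chart_map (atlas i) p.
have ix : chart_img (atlas i) x by exists p.
have [K0 K01 /nbhs_ballP[e /= e0 He]] := geom_bound_near ix.
(* The summand [2 / e] forces [1 / K' <= e / 2], so a box of radius [1 / K'] centred within [e / 2]
   of [x] stays where the bounds hold. *)
exists (K0 + 2 / e), i, (chart_box i x (e / 2)); split.
- exact: chart_box_open.
- by split => //; rewrite subrr normr0 divr_gt0.
move=> q [iq qx] K' KK'; split => // w wq.
have K0K' : K0 <= K' by apply: le_trans KK'; rewrite lerDl divr_ge0 // ltW.
have eK' : 2 / e <= K' by apply: le_trans KK'; rewrite lerDr; lra.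
apply: (geom_bound_mono K0K'); apply: He; rewrite -ball_normE /= distrC.
have : `|w - x| <= `|w - chart_map (atlas i) q| + `|chart_map (atlas i) q - x|.
  by rewrite -[X in `|X|](subrKA (chart_map (atlas i) q)) ler_normD.
have : K'^-1 <= e / 2.
  by rewrite -[leRHS]invrK lef_pV2 ?posrE ?invf_div ?divr_gt0 //; apply: lt_le_trans eK'; rewrite divr_gt0.
move: qx wq; rewrite -/x; lra.
Qed.

Lemma compact_finite_subcover (A : set S) (F : S -> set S) : compact A ->
  (forall p, A p -> open (F p) /\ F p p) ->
  exists2 s : seq S, (forall p, p \in s -> A p) & forall q, A q -> exists2 p, p \in s & F p q.
Proof.
move=> cA HF; have [[p0 _]|nA] := pselect (A !=set0); last first.
  by exists [::] => // q Aq; case: nA; exists q.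
(* Cover compactness is applied to a pointed space; its base point is taken from [A], the empty case
   being settled. *)
pose PS : ptopologicalType := HB.pack S (isPointed.Build S p0).
have cc : cover_compact A by have := cA; rewrite -[compact]/(@compact PS) compact_cover.
have [||D' D'A AD'] := cc S A F.
- by move=> p /HF[].
- by move=> p Ap; exists p => //; have [] := HF p Ap.
exists (finmap.enum_fset D'); first by move=> p /D'A /set_mem.
by move=> q /AD'[p /= pD' Fp]; exists p.
Qed.

Lemma seq_bounded (I : eqType) (f : I -> R) (s : seq I) :
  exists2 M, 1 <= M & forall k, k \in s -> f k <= M.
Proof.
elim: s => [|k s [M M1 HM]]; first by exists 1.
exists (M + `|f k|); first by rewrite (le_trans M1) // lerDl.
move=> l; rewrite inE => /predU1P[->|/HM h].
  by apply: le_trans (ler_norm _) _; rewrite lerDr; lra.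
by apply: le_trans h _; rewrite lerDl.
Qed.

Lemma uniform_good_chart : exists2 K, 1 <= K & forall p, exists i, good_chart K p i.
Proof.
have /choice[k Hk] : forall p, exists K, exists i, exists U : set S,
  [/\ open U, U p & forall q, U q -> forall K', K <= K' -> good_chart K' q i].
  exact: good_chart_near.
have /choice[i Hi] := Hk.
have /choice[U HU] := Hi.
have [||s _ sc] := compact_finite_subcover (A := [set: S]) (F := U).
- exact: surface_compact.
- by move=> p _; have [] := HU p.
have [M M1 HM] := seq_bounded k s.
exists M => // q; have [p ps Uq] := sc q I; exists (i p).
by have [_ _] := HU p; apply => //; exact: HM.
Qed.

End UniformGeometry.

(** Greedy choice: a new index is kept exactly when its set misses all those kept so far. *)
Lemma disjoint_subfamily (T : eqType) (F : T -> set T) (s : seq T) :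
  (forall p, p \in s -> F p p) ->
  exists t : seq T, [/\ uniq t, {subset t <= s},
    forall p q w, p \in t -> q \in t -> F p w -> F q w -> p = q &
    forall p, p \in s -> exists2 q, q \in t & F p `&` F q !=set0].
Proof.
elim: s => [|a s IH] Fs; first by exists [::].
have Fa : F a a by apply: Fs; rewrite mem_head.
have [p ps|t [ut ts td tm]] := IH; first by apply: Fs; rewrite inE ps orbT.
have [[q qt aq]|none] := pselect (exists2 q, q \in t & F a `&` F q !=set0).
  exists t; split => //; first by move=> p /ts; rewrite inE => ->; rewrite orbT.
  by move=> p; rewrite inE => /predU1P[->|/tm]; [exists q|].
exists (a :: t); split => /=.
- by rewrite ut andbT; apply/negP => at_; apply: none; exists a => //; exists a.
- by move=> p; rewrite !inE => /orP[->//|/ts ->]; rewrite orbT.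
- move=> p q w; rewrite !inE => /predU1P[->|pt] /predU1P[->|qt] // Fp Fq.
  + by case: none; exists q => //; exists w.
  + by case: none; exists p => //; exists w.
  + exact: td Fp Fq.
- move=> p; rewrite inE => /predU1P[->|ps].
    by exists a; [rewrite mem_head|exists a].
  by have [q qt pq] := tm p ps; exists q => //; rewrite inE qt orbT.
Qed.

(** * Coordinate boxes as substitutes for metric balls *)

Section NormalBalls.
Context {R : realType} {S : closed_surface R} (g : riemannian_metric S).
Variables (K : R) (ch : S -> 'I_(atlas_size S)).
Hypotheses (K1 : 1 <= K) (chP : forall p, good_chart g K p (ch p)).
Implicit Types (x y : R * R) (p q w a b : S) (r s t : R).

Definition chart_coord p q : R * R := chart_map (atlas (ch p)) q.
(** A square in the coordinates chosen at its own centre. Balls with different centres live in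
    unrelated charts and are compared through [riemannian_dist]. *)
Definition nball p r : set S := chart_box (ch p) (chart_coord p p) r.

Let K0 : 0 < K. Proof. by apply: lt_le_trans K1. Qed.
Let KV0 : 0 < K^-1. Proof. by rewrite invr_gt0. Qed.

Lemma nball_open p r : open (nball p r).
Proof. exact: chart_box_open. Qed.

Lemma nball_center p r : 0 < r -> nball p r p.
Proof. by move=> r0; split; [have [] := chP p|rewrite subrr normr0]. Qed.

Lemma nball_mono p r s : r <= s -> nball p r `<=` nball p s.
Proof. by move=> rs q [ip qr]; split => //; exact: lt_le_trans qr rs. Qed.

Lemma riemannian_dist_ge0 p q : (0 <= riemannian_dist g p q)%E.
Proof.
apply: le_ereal_inf_tmp => _ [c _ <-]; apply: integral_ge0 => t _.
by rewrite lee_fin speed_ge0.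
Qed.

Lemma dist_chart_le p a b : chart_dom (atlas (ch p)) a -> chart_dom (atlas (ch p)) b ->
  `|chart_coord p a - chart_coord p p| <= K^-1 ->
  `|chart_coord p b - chart_coord p p| <= K^-1 ->
  (riemannian_dist g a b <= (4 * K * `|chart_coord p b - chart_coord p a|)%:E)%E.
Proof.
move=> ia ib ha hb; have [_ gb] := chP p.
by have := riemannian_dist_le K1 gb ha hb; rewrite !chart_mapK.
Qed.

Lemma nball_dist p r a b : r <= K^-1 -> nball p r a -> nball p r b ->
  (riemannian_dist g a b <= (8 * K * r)%:E)%E.
Proof.
move=> rK [ia ha] [ib hb].
apply: le_trans (dist_chart_le ia ib _ _) _; [exact: le_trans (ltW ha) rK|exact: le_trans (ltW hb) rK|].
rewrite lee_fin.
have : `|chart_coord p b - chart_coord p a| <= 2 * r.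
  rewrite -[X in `|X|](subrKA (chart_coord p p)); apply: le_trans (ler_normD _ _) _.
  by rewrite (distrC (chart_coord p p)); rewrite /chart_coord in ha hb *; lra.
move=> h; apply: (@le_trans _ _ (4 * K * (2 * r))); last by lra.
by rewrite ler_wpM2l // mulr_ge0 // ltW.
Qed.

(** By [riemannian_dist_ge], leaving the box of radius [t] around [a] costs at least [t / (2 K)]. *)
Lemma nball_near p r t a b : 0 < t -> r + t <= K^-1 -> nball p r a ->
  (riemannian_dist g a b < (t / (2 * K))%:E)%E -> nball p (r + t) b.
Proof.
move=> t0 rtK [ia ha] ab; have [_ gb] := chP p.
have : chart_box (ch p) (chart_coord p a) t b.
  apply: contrapT => nb; move: ab; rewrite ltNge => /negP; apply.
  apply: (riemannian_dist_ge K1 t0 ia) nb => w wa; apply: gb.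
  rewrite -[X in `|X|](subrKA (chart_coord p a)); apply: le_trans (ler_normD _ _) _.
  by rewrite /chart_coord in ha wa *; lra.
move=> [ib hb]; split => //.
rewrite -[X in `|X|](subrKA (chart_coord p a)); apply: le_lt_trans (ler_normD _ _) _.
by rewrite /chart_coord in ha hb *; lra.
Qed.

Lemma nball_dist_ge p r a b : 3 * r <= K^-1 -> nball p r a -> nball p r b ->
  ((`|chart_coord p b - chart_coord p a| / (2 * K))%:E <= riemannian_dist g a b)%E.
Proof.
move=> rK [ia ha] [ib hb]; have [_ gb] := chP p.
have lt2 : `|chart_coord p b - chart_coord p a| < 2 * r.
  rewrite -[X in `|X|](subrKA (chart_coord p p)); apply: le_lt_trans (ler_normD _ _) _.
  by rewrite (distrC (chart_coord p p)); rewrite /chart_coord in ha hb *; lra.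
have := normr_ge0 (chart_coord p b - chart_coord p a); rewrite le_eqVlt => /predU1P[<-|h0].
  by rewrite mul0r; exact: riemannian_dist_ge0.
apply: (riemannian_dist_ge K1 h0 ia).
  move=> w wa; apply: gb.
  rewrite -[X in `|X|](subrKA (chart_coord p a)); apply: le_trans (ler_normD _ _) _.
  by rewrite /chart_coord in ha lt2 wa *; lra.
by move=> [_]; rewrite ltxx.
Qed.

(** Vitali enlargement across two charts: points of [nball p' r] are within distance [8 K r], less
    than [17 K^2 r / (2 K)], so in the chart of [p] the point [q] lies within
    [r + 17 K^2 r <= 18 K^2 r]. *)
Lemma nball_enlarge p p' r w q : 0 < r -> 18 * K ^+ 2 * r <= K^-1 ->
  nball p r w -> nball p' r w -> nball p' r q -> nball p (18 * K ^+ 2 * r) q.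
Proof.
move=> r0 rK pw p'w p'q.
have KK : 1 <= K ^+ 2 by rewrite exprn_ege1.
have rKK : r <= K ^+ 2 * r by rewrite ler_peMl // ltW.
apply: (@nball_mono p (r + 17 * K ^+ 2 * r)); first by lra.
apply: (nball_near _ _ pw); [by rewrite !mulr_gt0 // exprn_gt0|by lra|].
apply: le_lt_trans (nball_dist _ p'w p'q) _; first by lra.
rewrite lte_fin (_ : 17 * K ^+ 2 * r / (2 * K) = 17 / 2 * (K * r)).
  by have : 0 < K * r by [rewrite mulr_gt0]; lra.
by field; rewrite gt_eqF.
Qed.

Lemma nball_net A r : compact A -> 0 < r -> 18 * K ^+ 2 * r <= K^-1 ->
  exists s : seq S, [/\ uniq s, forall p, p \in s -> A p,
    forall p q w, p \in s -> q \in s -> nball p r w -> nball q r w -> p = q &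
    forall q, A q -> exists2 p, p \in s & nball p (18 * K ^+ 2 * r) q].
Proof.
move=> cA r0 rK.
have [|s sA sc] := compact_finite_subcover (F := fun p => nball p r) cA.
  by move=> p _; split; [exact: nball_open|exact: nball_center].
have [p _|t [ut ts td tm]] := @disjoint_subfamily _ (fun p => nball p r) s; first exact: nball_center.
exists t; split => // [p /ts /sA //|q /sc[p' p's p'q]].
have [p pt [w [p'w pw]]] := tm p' p's.
by exists p => //; exact: nball_enlarge r0 rK pw p'w p'q.
Qed.

Lemma nball_area_le p r : 0 < r -> r <= K^-1 ->
  (riemannian_area g (nball p r) <= ((atlas_size S)%:R * (512 * K) * r ^+ 2)%:E)%E.
Proof.
move=> r0 rK; have [_ gb] := chP p; apply: box_area_le => // w wr.
by apply: gb; exact: le_trans wr rK.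
Qed.

Lemma box_nball_area_ge p x r : 0 < r -> `|x - chart_coord p p| + r <= K^-1 ->
  ((r ^+ 2 / (128 * K))%:E <= riemannian_area g (chart_box (ch p) x r))%E.
Proof.
move=> r0 rK; have [_ gb] := chP p; apply: box_area_ge => // w wr; apply: gb.
rewrite -[X in `|X|](subrKA x); apply: le_trans (ler_normD _ _) _.
by rewrite /chart_coord in rK *; lra.
Qed.

(** Finiteness comes from a finite net of boxes, positivity from a single box of radius [1 / K]. The
    value of [r] makes the enlarged radius exactly [1 / K]. *)
Lemma total_area p : exists2 V, 0 < V & riemannian_area g [set: S] = V%:E.
Proof.
pose r := (18 * K ^+ 2)^-1 * K^-1.
have r0 : 0 < r by rewrite mulr_gt0 ?invr_gt0 ?mulr_gt0 // exprn_gt0.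
have rK : 18 * K ^+ 2 * r = K^-1.
  by rewrite /r mulrA mulfV ?mul1r // mulf_neq0 // expf_neq0 // gt_eqF.
have [|s [_ _ _ sc]] := nball_net (@surface_compact _ S) r0; first by rewrite rK.
have down := box_nball_area_ge (p := p) (x := chart_coord p p) KV0.
rewrite subrr normr0 add0r in down.
have {}down := le_trans (down (lexx _)) (riemannian_area_mono g (@subsetT _ _)).
have up : (riemannian_area g [set: S] < +oo)%E.
  apply: le_lt_trans (@area_cover_le _ _ g _ (fun q => nball q (18 * K ^+ 2 * r)) s _
    ((atlas_size S)%:R * (512 * K) * (18 * K ^+ 2 * r) ^+ 2) _ _ _) (ltry _).
  - by move=> k _; exact: nball_open.
  - by move=> k _; apply: nball_area_le; rewrite rK.
  - by move=> q _; exact: sc.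
move: down up; case: (riemannian_area g [set: S]) => [V||] //=.
rewrite lee_fin => h _; exists V => //; apply: lt_le_trans h.
by rewrite divr_gt0 ?mulr_gt0 // exprn_gt0.
Qed.

(** The value [s = 0] is allowed, with [p] itself as witness, so that families of radii may start at
    the centre. *)
Lemma nodal_sphere mu phi p s : eigenfunction g mu phi -> phi p = 0 -> 0 <= s ->
  s <= K^-1 -> 4 * (K * K) * s <= 1 -> mu ^+ 2 * (s * s) * (8 * K) <= 1 ->
  exists q, [/\ chart_dom (atlas (ch p)) q, `|chart_coord p q - chart_coord p p| = s & phi q = 0].
Proof.
move=> ef pz; have [ip gb] := chP p.
rewrite le_eqVlt => /predU1P[<- _ _ _|s0 sK s4 ms].
  by exists p; rewrite subrr normr0.
have [y ys||y ys yz] := helmholtz_boundary_zero (i := ch p) (g := g) (mu := mu)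
  (u := phi \o chart_inv (atlas (ch p))) (x := chart_coord p p) K1 s0 s4 ms.
- have gy := gb y (le_trans ys sK); split => //.
  by apply: eigenfunction_helmholtz ef _; case: gy.
- by rewrite /= chart_mapK.
have [|iy yE] := @chart_invK _ _ (atlas (ch p)) y.
  by have [|] := gb y => //; rewrite -/(chart_coord p p) ys.
by exists (chart_inv (atlas (ch p)) y); rewrite /chart_coord yE; split.
Qed.

Lemma nodal_near mu phi p s : eigenfunction g mu phi -> 0 < s -> s <= K^-1 ->
  26 * K ^+ 5 <= mu ^+ 2 * (s * s) ->
  exists q, [/\ chart_dom (atlas (ch p)) q, `|chart_coord p q - chart_coord p p| <= s & phi q = 0].
Proof.
move=> ef s0 sK ms; have [ip gb] := chP p.
have s1 : s <= 1 by apply: le_trans sK _; rewrite invf_le1.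
have [y ys|y ys yz] := helmholtz_zero (i := ch p) (g := g) (mu := mu)
  (u := phi \o chart_inv (atlas (ch p))) (x := chart_coord p p) K1 s0 s1 ms.
  have gy := gb y (le_trans ys sK); split => //.
  by apply: eigenfunction_helmholtz ef _; case: gy.
have [|iy yE] := @chart_invK _ _ (atlas (ch p)) y.
  by have [|] := gb y => //; rewrite -/(chart_coord p p) (le_trans ys).
by exists (chart_inv (atlas (ch p)) y); rewrite /chart_coord yE; split.
Qed.

Lemma nodal_set_compact mu phi : eigenfunction g mu phi -> compact (nodal_set phi).
Proof.
move=> [sphi _ _]; apply: (subclosed_compact _ (@surface_compact _ S)) => //.
rewrite (_ : nodal_set phi = phi @^-1` [set t | t = 0]) //.
apply: closed_comp => [y _|]; [exact: smooth_function_continuous|exact: closed_eq].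
Qed.

End NormalBalls.

(** * Estimates for the nodal tube *)

Lemma interval_cover_le (R : realType) (L : R) (c l : nat -> R) : 0 <= L ->
  (forall n, 0 <= l n) -> (forall t, 0 <= t < L -> exists n, `|t - c n| <= l n) ->
  (L%:E <= \sum_(0 <= n <oo) (2 * l n)%:E)%E.
Proof.
move=> L0 l0 cov.
have E (a b : R) : a <= b -> (@lebesgue_measure R) (`[a, b]%classic : set R) = (b - a)%:E.
  move=> ab; rewrite lebesgue_measure_itv /= lte_fin -EFinB.
  by case: ltgtP ab => // -> _; rewrite subrr.
have EL : (@lebesgue_measure R) (`[0, L[%classic : set R) = L%:E.
  rewrite lebesgue_measure_itv /= lte_fin -EFinB subr0.
  by move: L0; rewrite le_eqVlt => /predU1P[<-|->] //; rewrite ltxx.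
pose I n : set R := `[c n - l n, c n + l n]%classic.
apply: (@le_trans _ _ (\sum_(0 <= n <oo) (@lebesgue_measure R) (I n))%E).
  rewrite -EL; apply: measure_sigma_subadditive.
  - by move=> n; exact: measurable_itv.
  - exact: measurable_itv.
  - move=> t /=; rewrite in_itv /= => /cov[n tn]; exists n => //=.
    by rewrite /I /= in_itv /=; move: tn; rewrite ler_norml => /andP[h1 h2]; apply/andP; split; lra.
apply: lee_nneseries => [n *|n _]; first exact: (measure_ge0 (@lebesgue_measure R) (I n)).
rewrite /I E; last by have := l0 n; lra.
by rewrite lee_fin; lra.
Qed.

Section NodalEstimates.
Context {R : realType} {S : closed_surface R} (g : riemannian_metric S).
Variables (K : R) (ch : S -> 'I_(atlas_size S)).
Hypotheses (K1 : 1 <= K) (chP : forall p, good_chart g K p (ch p)).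
Notation nball := (nball ch).
Notation chart_coord := (chart_coord ch).
Implicit Types (x y : R * R) (p q w a b : S) (r s t d : R).

Let K0 : 0 < K. Proof. by apply: lt_le_trans K1. Qed.
Let KV0 : 0 < K^-1. Proof. by rewrite invr_gt0. Qed.

Lemma dist_le_diam (U : set S) a b : U a -> U b -> (riemannian_dist g a b <= diam g U)%E.
Proof.
move=> Ua Ub; rewrite /diam le_max; apply/orP; right.
by apply: ereal_sup_ubound; exists (a, b).
Qed.

(* Laying the radial coordinates of the disjoint balls end to end turns a cover of
   the nodal set by small sets into a cover of one interval of length
   [size s * (d / 2)] by twice as long intervals. *)
Lemma hausdorff1_ge (N : set S) (s : seq S) d : 0 < d -> 3 * d <= K^-1 -> uniq s ->
  (forall p q w, p \in s -> q \in s -> nball p d w -> nball q d w -> p = q) ->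
  (forall p t, p \in s -> 0 <= t < d / 2 -> exists q,
     [/\ nball p (d / 2) q, `|chart_coord p q - chart_coord p p| = t & N q]) ->
  (((size s)%:R * (d / (8 * K)))%:E <= hausdorff1 g N)%E.
Proof.
move=> d0 dK us ds hs.
have e0 : 0 < d / (8 * K) by rewrite divr_gt0 // mulr_gt0.
(* A set of diameter at most [d / (8 K)], which is below [(d / 2) / (2 K)], stays in a ball of
   radius [d] once it meets the concentric half ball. *)
apply: (@le_trans _ _ (hausdorff1_pre g (d / (8 * K)) N)); last first.
  by apply: ereal_sup_ubound; exists (d / (8 * K)).
apply: le_ereal_inf_tmp => _ [U [cov dU] <-].
have dU0 n : (0 <= diam g (U n))%E by rewrite /diam le_max lexx.
pose D n := fine (diam g (U n)).
have DE n : diam g (U n) = (D n)%:E.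
  by rewrite fineK // ge0_fin_numE //; exact: le_lt_trans (dU n) (ltry _).
have D0 n : 0 <= D n by rewrite -lee_fin -DE.
have De n : D n <= d / (8 * K) by rewrite -lee_fin -DE.
have [[p0 p0s]|sz] := pselect (exists p0, p0 \in s); last first.
  case: s us ds hs sz => [|p0 s] us ds hs sz; last by case: sz; exists p0; rewrite mem_head.
  by rewrite mul0r; apply: nneseries_ge0 => n _ _.
pose pos j b := j%:R * (d / 2) + `|chart_coord (nth p0 s j) b - chart_coord (nth p0 s j) (nth p0 s j)|.
(* By disjointness [U n] meets the half ball of at most one index, and there the radial coordinate
   varies by at most [2 K] times the diameter. A set that meets none gets the arbitrary centre 0. *)
have key n : exists c : R, forall j b, (j < size s)%N -> U n b -> nball (nth p0 s j) (d / 2) b ->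
    `|pos j b - c| <= 2 * K * D n.
  have [[j [a [js Ua ja]]]|none] := pselect (exists j a,
      [/\ (j < size s)%N, U n a & nball (nth p0 s j) (d / 2) a]); last first.
    by exists 0 => j b js Ub jb; case: none; exists j, b.
  exists (pos j a) => j' b j's Ub j'b.
  have ab : (riemannian_dist g a b <= (D n)%:E)%E by rewrite -DE; exact: dist_le_diam.
  have jb : nball (nth p0 s j) d b.
    have -> : d = d / 2 + d / 2 by lra.
    apply: (nball_near K1 chP _ _ ja); [lra|lra|].
    apply: le_lt_trans ab _; rewrite lte_fin; apply: le_lt_trans (De n) _.
    rewrite (_ : d / 2 / (2 * K) = 2 * (d / (8 * K))); last by field; rewrite gt_eqF.
    by rewrite ltr_pMl // ltr1n.
  have jj' : j = j'.
    apply/eqP; rewrite -(nth_uniq p0 js j's us); apply/eqP.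
    apply: (ds _ _ b) => //; [exact: mem_nth|exact: mem_nth|].
    by apply: nball_mono j'b; lra.
  subst j'; rewrite /pos opprD addrACA subrr add0r.
  apply: le_trans (ler_dist_dist _ _) _; rewrite opprB addrA subrK.
  have ja' : nball (nth p0 s j) d a by apply: nball_mono ja; lra.
  have := le_trans (nball_dist_ge K1 chP dK ja' jb) ab.
  by rewrite lee_fin ler_pdivrMr ?mulr_gt0 // mulrC.
have {key}[c Hc] := choice key.
have d20 : 0 < d / 2 by rewrite divr_gt0.
have l0 n : 0 <= 2 * K * D n by rewrite mulr_ge0 // mulr_ge0 // ltW.
have L0 : 0 <= (size s)%:R * (d / 2) by rewrite mulr_ge0 // ltW.
have := interval_cover_le (c := c) L0 l0.
have covL t : 0 <= t < (size s)%:R * (d / 2) -> exists n, `|t - c n| <= 2 * K * D n.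
  (* The integer part of [t / (d / 2)] is the index of the ball, and the remainder is the radius
     inside it. *)
  move=> /andP[t0 tL]; pose j := Num.truncn (t / (d / 2)).
  have td0 : 0 <= t / (d / 2) by rewrite divr_ge0 // ltW.
  have /andP[j1 j2] := truncn_itv td0; rewrite -/j in j1 j2.
  rewrite ler_pdivlMr // in j1; rewrite ltr_pdivrMr // -natr1 mulrDl mul1r in j2.
  have js : (j < size s)%N.
    by rewrite -(ltr_nat R) -(ltr_pM2r d20); exact: le_lt_trans tL.
  have [||q [qb qt Nq]] := hs (nth p0 s j) (t - j%:R * (d / 2)); first exact: mem_nth.
    by rewrite subr_ge0 j1 /= ltrBlDr addrC.
  have [n _ Uq] := cov q Nq; exists n.
  by have := Hc n j q js Uq qb; rewrite /pos qt [_ + (t - _)]addrC subrK.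
move=> /(_ covL) h.
have KE : (\sum_(0 <= n <oo) (2 * (2 * K * D n))%:E = (4 * K)%:E * \sum_(0 <= n <oo) diam g (U n))%E.
  rewrite -nneseriesZl //; apply: eq_eseriesr => n _.
  by rewrite DE -EFinM; congr EFin; ring.
rewrite KE in h.
have s0 : (0 <= \sum_(0 <= n <oo) diam g (U n))%E by apply: nneseries_ge0.
move: h s0; case: (\sum_(0 <= n <oo) diam g (U n))%E => [v||] //= h _; last by rewrite leey.
move: h; rewrite -EFinM !lee_fin => h.
rewrite (_ : _ * (d / (8 * K)) = (size s)%:R * (d / 2) / (4 * K)); last by field; rewrite gt_eqF.
by rewrite ler_pdivrMr ?mulr_gt0 // [leRHS]mulrC.
Qed.

Lemma nodal_tubeP (phi : S -> R) d q :
  nodal_tube g phi d q <-> exists2 z, phi z = 0 & (riemannian_dist g q z < d%:E)%E.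
Proof.
rewrite /nodal_tube /dist_to_set /=; split=> [/ereal_inf_lt[_ [z zN <-] zd]|[z zN zd]].
  by exists z.
by apply: le_lt_trans zd; apply: ereal_inf_lbound; exists z.
Qed.

Lemma nodal_tube_mono (phi : S -> R) d d' : d <= d' -> nodal_tube g phi d `<=` nodal_tube g phi d'.
Proof. by move=> dd' q; rewrite /nodal_tube /= => h; apply: lt_le_trans h _; rewrite lee_fin. Qed.

Let le_KV t : K * t <= 1 -> t <= K^-1.
Proof. by move=> h; rewrite -[K^-1]mul1r ler_pdivlMr // mulrC. Qed.

Let frequency_small mu s : 0 < mu -> 0 <= s -> mu * s <= (4 * K)^-1 ->
  mu ^+ 2 * (s * s) * (8 * K) <= 1.
Proof.
move=> mu0 s0 ms; rewrite (_ : mu ^+ 2 * (s * s) = (mu * s) * (mu * s)); last by ring.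
have ms0 : 0 <= mu * s by rewrite mulr_ge0 // ltW.
have h : mu * s * (4 * K) <= 1 by rewrite -ler_pdivlMr ?mulr_gt0 // div1r.
apply: (@le_trans _ _ ((mu * s * (4 * K)) * (mu * s * (4 * K)))); last first.
  by apply: mulr_ile1 => //; rewrite mulr_ge0 // mulr_ge0 // ltW.
rewrite (_ : _ * (mu * s * (4 * K)) = mu * s * (mu * s) * (8 * K) * (2 * K)); last by ring.
by rewrite ler_peMr //; [rewrite !mulr_ge0 // ltW|move: K1; lra].
Qed.

Definition box_constant : R := (atlas_size S)%:R * (512 * K).

(** [m] counts the centres of a net of the nodal set. The factor 67 is 18 from the net plus 49 from
    the width of the tube, and [100 K^4 d <= 1] keeps the radii that occur below [1 / K]. *)
Lemma tube_area_le mu phi d : 0 < mu -> eigenfunction g mu phi -> 0 < d ->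
  100 * K ^+ 4 * d <= 1 -> mu * d <= (4 * K)^-1 -> exists m : nat, [/\ (0 < m)%N,
    (riemannian_area g (nodal_tube g phi d) <=
       (m%:R * (box_constant * (67 * K ^+ 3 * d) ^+ 2))%:E)%E &
    ((m%:R * (d / (8 * K)))%:E <= hausdorff1 g (nodal_set phi))%E].
Proof.
move=> mu0 ef d0 dK md.
have d3 : 100 * (K ^+ 3 * d) <= K^-1.
  by apply: le_KV; apply: le_trans dK; rewrite le_eqVlt; apply/orP; left; apply/eqP; ring.
have [dd1 [d12 d23]] : d <= K * d /\ K * d <= K ^+ 2 * d /\ K ^+ 2 * d <= K ^+ 3 * d.
  split; first by rewrite ler_peMl // ltW.
  split; first by rewrite expr2 -mulrA ler_peMl // mulr_ge0 // ltW.
  by rewrite [K ^+ 3]exprS -mulrA ler_peMl // mulr_ge0 ?exprn_ge0 // ltW.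
have KV1 : K^-1 <= 1 by rewrite invf_le1.
have [|s [us sN ds sc]] := nball_net K1 chP (nodal_set_compact ef) d0; first by lra.
exists (size s); split.
- have [z zN] := eigenfunction_has_zero mu0 ef.
  by have [p ps _] := sc z zN; case: (s) ps.
- apply: (@area_cover_le _ _ g _ (fun p => nball p (67 * K ^+ 3 * d))).
  + by move=> p _; exact: nball_open.
  + by move=> p _; apply: nball_area_le => //; lra.
  move=> q /nodal_tubeP[z zN qz].
  have [p ps pz] := sc z zN; exists p => //.
  (* The coordinates at [q] turn the bound on the distance from [q] to [z] into one on the distance
     from [z] to [q]: at most [8 K (3 K d)], just below [49 K^3 d / (2 K)]. *)
  have qz' : nball q (3 * K * d) z.
    apply: (@nball_mono _ _ _ q (d + 2 * K * d)); first by lra.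
    apply: (nball_near K1 chP (a := q)); [by rewrite !mulr_gt0|by lra|exact: nball_center|].
    by rewrite mulrAC mulfV ?mul1r // mulf_neq0 // gt_eqF.
  have qq : nball q (3 * K * d) q by apply: nball_center => //; rewrite !mulr_gt0.
  apply: (@nball_mono _ _ _ p (18 * K ^+ 2 * d + 49 * K ^+ 3 * d)); first by lra.
  apply: (nball_near K1 chP _ _ pz); [by rewrite !mulr_gt0 // exprn_gt0|by lra|].
  have := nball_dist K1 chP _ qz' qq; move=> /(_ ltac:(lra)) h; apply: le_lt_trans h _.
  rewrite lte_fin (_ : 8 * K * (3 * K * d) = 48 * (K ^+ 2 * d) / 2); last by field.
  rewrite (_ : 49 * K ^+ 3 * d / (2 * K) = 49 * (K ^+ 2 * d) / 2); last by field; rewrite gt_eqF.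
  have : 0 < K ^+ 2 * d by rewrite mulr_gt0 // exprn_gt0.
  by lra.
- apply: (hausdorff1_ge d0) => //; first by lra.
  move=> p t ps /andP[t0 td].
  have [|||q [ip pq qz]] := @nodal_sphere _ _ _ _ _ K1 chP _ _ _ t ef (sN p ps) t0.
  + lra.
  + have : K ^+ 2 * t <= K ^+ 2 * d by rewrite ler_wpM2l ?exprn_ge0 // ?(ltW K0) //; lra.
    by rewrite -expr2 -mulrA; lra.
  + apply: frequency_small => //; apply: le_trans md; rewrite ler_wpM2l //; first exact: ltW.
    by lra.
  by exists q; split => //; split => //; rewrite -/(chart_coord p q) -/(chart_coord p p) pq.
Qed.

(** Nodal points at the radii [k h] up to [s / 2] give boxes of radius [r = h / 2], separated by
    their radial coordinates. At least [s / (2 h)] boxes of area at least [r^2 / (128 K)] produce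
    the constant 4096. *)
Lemma tube_ball_area_ge mu phi z d s : 0 < mu -> eigenfunction g mu phi -> phi z = 0 ->
  0 < d -> d <= s -> s <= K^-1 -> 4 * (K * K) * s <= 1 -> mu * s <= (4 * K)^-1 ->
  exists O : set S, [/\ open O, O `<=` nodal_tube g phi d, O `<=` nball z s &
    ((s * d / (4096 * K ^+ 2))%:E <= riemannian_area g O)%E].
Proof.
move=> mu0 ef zz d0 ds sK s4 ms; have s0 : 0 < s by lra.
(* A box of radius [r] lies within distance [4 K r = d / 2] of its nodal centre, hence in the
   tube. *)
pose h := d / (4 * K); pose r := d / (8 * K).
have h0 : 0 < h by rewrite divr_gt0 // mulr_gt0.
have r0 : 0 < r by rewrite divr_gt0 // mulr_gt0.
have hr : h = 2 * r by rewrite /h /r; field; rewrite gt_eqF.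
have rs : r <= s / 8.
  rewrite /r ler_pdivrMr ?mulr_gt0 // (_ : s / 8 * (8 * K) = K * s); last by field.
  by apply: le_trans ds _; rewrite ler_peMl // ltW.
(* With the successor, the indices [k < M] satisfy [k h <= s / 2] and [M] exceeds [s / (2 h)]. *)
pose M := (Num.truncn (s / (2 * h))).+1.
have sh0 : 0 <= s / (2 * h) by apply: divr_ge0; [exact: ltW|apply: mulr_ge0 => //; exact: ltW].
have /andP[M1 M2] := truncn_itv sh0; rewrite -/M in M2.
have kM k : (k < M)%N -> k%:R * h <= s / 2.
  rewrite ltnS -(ler_nat R) => kM; have := le_trans kM M1.
  by rewrite ler_pdivlMr ?mulr_gt0 //; lra.
have /choice[q Hq] k : exists q, (k < M)%N ->
    [/\ chart_dom (atlas (ch z)) q, `|chart_coord z q - chart_coord z z| = k%:R * h & phi q = 0].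
  have [km|] := boolP (k < M)%N; last by exists z.
  have kh := kM k km; have kh0 : 0 <= k%:R * h by rewrite mulr_ge0 // ltW.
  have [|||q Hq] := @nodal_sphere _ _ _ _ _ K1 chP _ _ _ (k%:R * h) ef zz kh0; last by exists q.
  - lra.
  - apply: le_trans s4; rewrite ler_wpM2l ?mulr_ge0 // ?(ltW K0) //; lra.
  - apply: frequency_small => //; apply: le_trans ms; rewrite ler_wpM2l ?(ltW mu0) //; lra.
pose F k := chart_box (ch z) (chart_coord z (q k)) r.
have mI k : (k \in iota 0 M) = (k < M)%N by rewrite mem_iota add0n.
have Frad k w : (k < M)%N -> F k w -> chart_dom (atlas (ch z)) w /\
    `| `|chart_coord z w - chart_coord z z| - k%:R * h| < r.
  move=> km [iw wq]; have [_ qz _] := Hq k km; split => //.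
  rewrite -qz; apply: le_lt_trans (ler_dist_dist _ _) _.
  by rewrite opprB addrA subrK.
exists (\bigcup_(k in [set` iota 0 M]) F k); split.
- by apply: bigcup_open => k _; exact: chart_box_open.
- move=> w [k /=]; rewrite mI => km Fw; have [iw wq] := Fw; have [iq qz zq] := Hq k km.
  have [_] := Frad k w km Fw; rewrite ltr_norml => /andP[w1 w2].
  have kh := kM k km.
  apply/nodal_tubeP; exists (q k) => //.
  apply: le_lt_trans (dist_chart_le K1 chP iw iq _ _) _; [by lra|by lra|].
  rewrite lte_fin distrC; apply: le_lt_trans (_ : 4 * K * r < d).
    by rewrite ler_wpM2l ?mulr_ge0 // ltW.
  rewrite /r (_ : 4 * K * (d / (8 * K)) = d / 2); last by field; rewrite gt_eqF.
  by lra.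
- move=> w [k /=]; rewrite mI => km Fw; have [iw] := Frad k w km Fw.
  by rewrite ltr_norml => /andP[w1 w2]; have kh := kM k km; split => //; rewrite -/(chart_coord z w); lra.
apply: le_trans (@area_packing_ge _ _ g _ F (iota 0 M) _ (r ^+ 2 / (128 * K)) _ _ _ _ _).
- rewrite lee_fin size_iota.
  apply: (@le_trans _ _ (s / (2 * h) * (r ^+ 2 / (128 * K)))); last first.
    apply: ler_wpM2r; last exact: ltW.
    by apply: divr_ge0; [exact/exprn_ge0/ltW|apply: mulr_ge0 => //; exact: ltW].
  rewrite le_eqVlt; apply/orP; left; apply/eqP; rewrite /h /r; field.
  by rewrite !gt_eqF.
- exact: iota_uniq.
- by move=> k _; exact: chart_box_open.
- move=> k; rewrite mI => km; apply: (box_nball_area_ge K1 chP) => //.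
  by have [_ -> _] := Hq k km; have kh := kM k km; lra.
- move=> k l w; rewrite !mI => km lm /(Frad _ _ km)[_ k1] /(Frad _ _ lm)[_ l1].
  apply: contrapT => /eqP; rewrite neq_ltn => /orP[] kl.
    have : k.+1%:R * h <= l%:R * h by rewrite ler_wpM2r ?(ltW h0) // ler_nat.
    by move: k1 l1; rewrite !ltr_norml -natr1 mulrDl mul1r => /andP[a1 a2] /andP[b1 b2]; lra.
  have : l.+1%:R * h <= k%:R * h by rewrite ler_wpM2r ?(ltW h0) // ler_nat.
  by move: k1 l1; rewrite !ltr_norml -natr1 mulrDl mul1r => /andP[a1 a2] /andP[b1 b2]; lra.
- by move=> k km w Fw; exists k.
Qed.

End NodalEstimates.

(** * Bounds for the area of the tube at all frequencies *)

Section TubeArea.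
Context {R : realType} {S : closed_surface R} (g : riemannian_metric S).
Variables (K : R) (ch : S -> 'I_(atlas_size S)).
Hypotheses (K1 : 1 <= K) (chP : forall p, good_chart g K p (ch p)).
Notation nball := (nball ch).
Notation chart_coord := (chart_coord ch).
Implicit Types (p q w z : S) (r s t d mu V : R).

Let K0 : 0 < K. Proof. by apply: lt_le_trans K1. Qed.
Let KV0 : 0 < K^-1. Proof. by rewrite invr_gt0. Qed.

(** Explicit constants are hidden behind an existential, here and in [tube_ball_bound], to keep the
    later arithmetic short. The added 1 makes [C] positive whatever the number of charts. *)
Lemma nball_area_bound : exists2 C, 0 < C & forall p r, 0 < r -> r <= K^-1 ->
  (riemannian_area g (nball p r) <= (C * r ^+ 2)%:E)%E.
Proof.
have C0 : 0 <= box_constant (S := S) K.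
  exact: mulr_ge0 (ler0n _ _) (mulr_ge0 (ler0n _ _) (ltW K0)).
exists (box_constant (S := S) K + 1); first exact: ltr_wpDl.
move=> p r r0 rK; apply: le_trans (nball_area_le K1 chP p r0 rK) _.
by rewrite lee_fin; apply: ler_wpM2r; [exact/exprn_ge0/ltW|rewrite lerDl].
Qed.

Lemma tube_ball_bound : exists2 c, 0 < c & forall mu (phi : S -> R) z d s,
  0 < mu -> eigenfunction g mu phi -> phi z = 0 ->
  0 < d -> d <= s -> s <= K^-1 -> 4 * (K * K) * s <= 1 -> mu * s <= (4 * K)^-1 ->
  exists O : set S, [/\ open O, O `<=` nodal_tube g phi d, O `<=` nball z s &
    ((c * s * d)%:E <= riemannian_area g O)%E].
Proof.
exists (4096 * K ^+ 2)^-1.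
  by rewrite invr_gt0; exact: mulr_gt0 (ltr0Sn _ _) (exprn_gt0 _ K0).
move=> mu phi z d s mu0 ef zz d0 ds sK s4 ms.
have [W [oW WT Wz aW]] := tube_ball_area_ge K1 chP mu0 ef zz d0 ds sK s4 ms.
by exists W; split => //; apply: le_trans aW; rewrite lee_fin -mulrA mulrC.
Qed.

(** The threshold [M] makes the enlarged balls of the net, of radius [E A / mu], fit in the charts.
    They cover the surface, so the total area bounds their number from below. *)
Lemma high_frequency_tube V : 0 < V -> riemannian_area g [set: S] = V%:E ->
  exists M c, [/\ K <= M, 0 < c & forall mu (phi : S -> R) d,
    eigenfunction g mu phi -> M <= mu -> 0 < d -> mu * d <= (4 * K)^-1 ->
    ((c * mu * d)%:E <= riemannian_area g (nodal_tube g phi d))%E].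
Proof.
move=> V0 VE.
have [C C0 upC] := nball_area_bound; have [c c0 low] := tube_ball_bound.
have Kn n : 1 <= K ^+ n by exact: exprn_ege1.
have [E E18 net] : exists2 E : R, 18 <= E & forall r, 0 < r -> E * r <= K^-1 ->
    exists s : seq S, [/\ uniq s,
      forall p q w, p \in s -> q \in s -> nball p r w -> nball q r w -> p = q &
      forall q, exists2 p, p \in s & nball p (E * r) q].
  exists (18 * K ^+ 2); first by have := Kn 2%N; lra.
  move=> r r0 rK; have [s [us _ ds sc]] := nball_net K1 chP (@surface_compact _ S) r0 rK.
  by exists s; split => // q; exact: sc.
(* [A5] is the hypothesis of [nodal_near] at radius [A / (4 mu)]; [AK] leaves room for the box of
   radius [b / mu] around the nodal point inside the ball of radius [A / mu]. *)
have [A AK A5] : exists2 A : R, 24 * K <= A & 26 * K ^+ 5 <= A / 4 * (A / 4).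
  exists (24 * K ^+ 3).
    have : K <= K ^+ 3 by rewrite exprS ler_peMr // ltW.
    by lra.
  rewrite (_ : 24 * K ^+ 3 / 4 * (24 * K ^+ 3 / 4) = 36 * (K ^+ 5 * K)); last by field.
  have : K ^+ 5 <= K ^+ 5 * K by rewrite ler_peMr // exprn_ge0 // ltW.
  by have := Kn 5%N; lra.
have E0 : 0 < E by lra.
have A0 : 0 < A by move: K1; lra.
have EA1 : 1 <= E * A by apply: mulr_ege1; move: K1; lra.
have [b b0 bE] : exists2 b : R, 0 < b & b = (4 * K)^-1.
  by exists (4 * K)^-1; rewrite ?invr_gt0 ?mulr_gt0.
have b4 : 4 * K * b = 1 by rewrite bE mulfV // mulf_neq0 // gt_eqF.
rewrite -bE in low *.
exists (E * A * K), (c * b * (V / (C * (E * A) ^+ 2))); split.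
- by rewrite ler_peMl // ltW.
- by apply: mulr_gt0; [exact: mulr_gt0|apply: divr_gt0 => //; apply: mulr_gt0 => //; apply: exprn_gt0; exact: mulr_gt0].
move=> mu phi d ef muM d0 md.
have Kmu : K <= mu by apply: le_trans muM; rewrite ler_peMl // ltW.
have mu0 : 0 < mu by exact: lt_le_trans Kmu.
pose v := mu^-1.
have v0 : 0 < v by rewrite invr_gt0.
have muv : mu * v = 1 by rewrite mulfV // gt_eqF.
have vK : v <= K^-1 by rewrite lef_pV2.
have EAv : E * (A * v) <= K^-1.
  by rewrite mulrA -[K^-1]mul1r ler_pdivlMr // mulrAC ler_pdivrMr // mul1r.
have Av0 : 0 < A * v by rewrite mulr_gt0.
have Av18 : 18 * (A * v) <= K^-1 by apply: le_trans EAv; rewrite ler_pM2r.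
have bv0 : 0 < b * v by rewrite mulr_gt0.
have dbv : d <= b * v by rewrite ler_pdivlMr // mulrC.
have Kbv : 4 * K * (b * v) = v by rewrite mulrA b4 mul1r.
have bvK : b * v <= K^-1.
  apply: le_trans vK; rewrite -{2}Kbv; apply: ler_peMl; first exact: ltW.
  by move: K1; lra.
have [s [us ds sc]] := net _ Av0 EAv.
have upV : V <= (size s)%:R * (C * (E * (A * v)) ^+ 2).
  rewrite -lee_fin -VE; apply: (@area_cover_le _ _ g _ (fun p => nball p (E * (A * v)))).
  - by move=> p _; exact: nball_open.
  - by move=> p _; apply: upC => //; exact: mulr_gt0.
  - by move=> q _; exact: sc.
have /choice[W HW] p : exists O : set S, [/\ open O, O `<=` nodal_tube g phi d, O `<=` nball p (A * v) &
    ((c * (b * v) * d)%:E <= riemannian_area g O)%E].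
  have [|||z [iz zp zz]] := @nodal_near _ _ _ _ _ K1 chP _ _ p (A * v / 4) ef.
  - by rewrite divr_gt0.
  - by lra.
  - rewrite (_ : mu ^+ 2 * _ = A / 4 * (A / 4) * (mu * v) ^+ 2); last by field.
    by rewrite muv expr1n mulr1.
  have [||W [oO OT Oz aO]] := low mu phi z d (b * v) mu0 ef zz d0 dbv bvK.
  - rewrite (_ : 4 * (K * K) * (b * v) = K * (4 * K * (b * v))); last by ring.
    by rewrite Kbv -(@mulfV _ K) ?gt_eqF // ler_pM2l.
  - by rewrite mulrCA muv mulr1.
  exists W; split => // w /Oz zw.
  have -> : A * v = A * v / 2 + A * v / 2 by lra.
  apply: (nball_near K1 chP (a := z)); [by rewrite divr_gt0|by lra| |].
    by split => //; rewrite -/(chart_coord p z); lra.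
  apply: le_lt_trans (nball_dist K1 chP bvK (nball_center chP _ bv0) zw) _.
  rewrite lte_fin (_ : 8 * K * (b * v) = 2 * (4 * K * (b * v))); last by ring.
  rewrite Kbv.
  rewrite ltr_pdivlMr ?mulr_gt0 // (_ : 2 * v * (2 * K) = 4 * K * v); last by ring.
  by rewrite [ltRHS]mulrAC ltr_pM2r //; move: AK K1; lra.
apply: le_trans (@area_packing_ge _ _ g _ W s _ (c * (b * v) * d) us _ _ _ _); first last.
- by move=> k _; have [] := HW k.
- by move=> k l w ks ls Ok Ol; apply: (ds k l w) => //; [have [_ _ h _] := HW k|have [_ _ h _] := HW l]; exact: h.
- by move=> k _; have [] := HW k.
- by move=> k _; have [] := HW k.
have D0 : 0 < C * (E * A) ^+ 2.
  by apply: mulr_gt0 => //; apply: exprn_gt0; exact: mulr_gt0.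
have Vs : V / (C * (E * A) ^+ 2) <= (size s)%:R * v ^+ 2.
  by rewrite ler_pdivrMr //; apply: le_trans upV _; rewrite le_eqVlt; apply/orP; left; apply/eqP; ring.
rewrite lee_fin; apply: (@le_trans _ _ (c * b * ((size s)%:R * v ^+ 2) * mu * d)).
  rewrite ler_pM2r // ler_pM2r //; apply: ler_wpM2l => //.
  by apply: ltW; exact: mulr_gt0.
rewrite (_ : c * b * _ * mu * d = (size s)%:R * (c * (b * v) * d) * (mu * v)); last by ring.
by rewrite muv mulr1.
Qed.

(** One nodal point is enough, with the fixed radius [b / M]. Beyond this radius the tube only
    grows, while [mu d <= b] keeps the left side bounded. *)
Lemma low_frequency_tube M : K <= M -> exists2 c, 0 < c & forall mu (phi : S -> R) d,
    0 < mu -> eigenfunction g mu phi -> mu <= M -> 0 < d -> mu * d <= (4 * K)^-1 ->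
    ((c * mu * d)%:E <= riemannian_area g (nodal_tube g phi d))%E.
Proof.
move=> KM; have [c c0 low] := tube_ball_bound.
have M0 : 0 < M by apply: lt_le_trans KM.
have [b b0 bE] : exists2 b : R, 0 < b & b = (4 * K)^-1.
  by exists (4 * K)^-1; rewrite ?invr_gt0 ?mulr_gt0.
have b4 : 4 * K * b = 1 by rewrite bE mulfV // mulf_neq0 // gt_eqF.
rewrite -bE in low *.
have [v v0 Mv] : exists2 v : R, 0 < v & M * v = 1.
  by exists M^-1; rewrite ?invr_gt0 // mulfV // gt_eqF.
have Kv : K * v <= 1 by rewrite -Mv ler_pM2r.
have bv0 : 0 < b * v by rewrite mulr_gt0.
have Kbv : 4 * K * (b * v) = v by rewrite mulrA b4 mul1r.
have bv4 : 4 * (K * K) * (b * v) <= 1.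
  by rewrite (_ : 4 * (K * K) * (b * v) = K * (4 * K * (b * v))); [rewrite Kbv|ring].
have bvK : b * v <= K^-1.
  rewrite -[K^-1]mul1r ler_pdivlMr //; apply: le_trans Kv; rewrite -{2}Kbv.
  rewrite (_ : K * (4 * K * (b * v)) = 4 * K * (b * v * K)); last by ring.
  apply: ler_peMl; last by move: K1; lra.
  by apply: ltW; exact: mulr_gt0.
exists (c * (b * v) * v); first by apply: mulr_gt0 => //; exact: mulr_gt0.
move=> mu phi d mu0 ef muM d0 md.
have muv : mu * v <= 1 by rewrite -Mv ler_pM2r.
have [z zz] := eigenfunction_has_zero mu0 ef.
have mbv : mu * (b * v) <= b by rewrite mulrCA ler_piMr // ltW.
have small e : 0 < e -> e <= b * v ->
    ((c * (b * v) * e)%:E <= riemannian_area g (nodal_tube g phi e))%E.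
  move=> e0 es; have [W [_ OT _ aO]] := low mu phi z e (b * v) mu0 ef zz e0 es bvK bv4 mbv.
  by apply: le_trans aO _; exact: riemannian_area_mono.
have cbv0 : 0 < c * (b * v) by exact: mulr_gt0.
have [ds|sd] := leP d (b * v).
  apply: le_trans (small d d0 ds); rewrite lee_fin.
  rewrite (_ : c * (b * v) * v * mu * d = c * (b * v) * (mu * v * d)); last by ring.
  by rewrite ler_pM2l // ler_piMl // ltW.
apply: le_trans (riemannian_area_mono g (@nodal_tube_mono _ _ g phi _ _ (ltW sd))).
apply: le_trans (small (b * v) bv0 (lexx _)); rewrite lee_fin.
rewrite (_ : c * (b * v) * v * mu * d = c * (b * v) * (mu * d * v)); last by ring.
by rewrite ler_pM2l // ler_pM2r.
Qed.

(** For small [d] the number [m] of centres is eliminated between the two bounds of [tube_area_le].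
    For [d > 1 / D], possible only at low frequency, the tube has at most the total area, and the
    length is bounded below by its estimate at [1 / D], where [m >= 1]. *)
Lemma tube_hausdorff_upper V : 0 < V -> riemannian_area g [set: S] = V%:E ->
  exists2 C, 0 < C & forall mu (phi : S -> R) d,
  0 < mu -> eigenfunction g mu phi -> 0 < d -> mu * d <= (4 * K)^-1 ->
  (riemannian_area g (nodal_tube g phi d) <=
    C%:E * hausdorff1 g (nodal_set phi) * d%:E)%E.
Proof.
move=> V0 VE.
have [A [D [a [A0 D0 a0 H]]]] : exists A D a : R, [/\ 0 <= A, 0 < D, 0 < a &
    forall mu (phi : S -> R) d, 0 < mu -> eigenfunction g mu phi -> 0 < d ->
    D * d <= 1 -> mu * d <= (4 * K)^-1 -> exists m : nat, [/\ (0 < m)%N,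
      (riemannian_area g (nodal_tube g phi d) <= (m%:R * (A * d ^+ 2))%:E)%E &
      ((m%:R * (a * d))%:E <= hausdorff1 g (nodal_set phi))%E]].
  exists (box_constant (S := S) K * (67 * K ^+ 3) ^+ 2), (100 * K ^+ 4), (8 * K)^-1; split.
  - apply: mulr_ge0; last by apply: exprn_ge0; exact: mulr_ge0 (ler0n _ _) (exprn_ge0 _ (ltW K0)).
    exact: mulr_ge0 (ler0n _ _) (mulr_ge0 (ler0n _ _) (ltW K0)).
  - exact: mulr_gt0 (ltr0Sn _ _) (exprn_gt0 _ K0).
  - by rewrite invr_gt0; exact: mulr_gt0 (ltr0Sn _ _) K0.
  move=> mu phi d mu0 ef d0 dD md.
  have [m [m0 up low]] := tube_area_le K1 chP mu0 ef d0 dD md.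
  exists m; split => //; last by rewrite [_ * d]mulrC.
  by rewrite -mulrA -exprMn.
have VD0 : 0 < V * D ^+ 2 by apply: mulr_gt0 => //; exact: exprn_gt0.
have AV0 : 0 < A + V * D ^+ 2 by exact: ltr_wpDl.
exists (a^-1 * (A + V * D ^+ 2)); first by apply: mulr_gt0; rewrite ?invr_gt0.
move=> mu phi d mu0 ef d0 md.
suff [h h0 [hH Th]] : exists2 h, 0 <= h & (h%:E <= hausdorff1 g (nodal_set phi))%E /\
    (riemannian_area g (nodal_tube g phi d) <= (a^-1 * (A + V * D ^+ 2) * h * d)%:E)%E.
  apply: le_trans Th _; rewrite !EFinM; apply: lee_wpmul2r; first by rewrite lee_fin ltW.
  by apply: lee_wpmul2l => //; rewrite -EFinM lee_fin ltW // mulr_gt0 // invr_gt0.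
have [dD|Dd] := leP d D^-1.
  have dD' : D * d <= 1 by rewrite -(@mulfV _ D) ?gt_eqF // ler_pM2l.
  have [m [_ up low]] := H mu phi d mu0 ef d0 dD' md.
  exists (m%:R * (a * d)); first by apply: mulr_ge0 => //; apply: mulr_ge0; exact: ltW.
  split=> //; apply: le_trans up _; rewrite lee_fin.
  have -> : a^-1 * (A + V * D ^+ 2) * (m%:R * (a * d)) * d = m%:R * ((A + V * D ^+ 2) * d ^+ 2).
    by field; rewrite gt_eqF.
  apply: ler_wpM2l => //; apply: ler_wpM2r; first exact/exprn_ge0/ltW.
  by rewrite lerDl ltW.
have DV0 : 0 < D^-1 by rewrite invr_gt0.
have DD : D * D^-1 <= 1 by rewrite mulfV // gt_eqF.
have mD : mu * D^-1 <= (4 * K)^-1 by apply: le_trans md; rewrite ler_pM2l // ltW.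
have [m [m0 _ low]] := H mu phi D^-1 mu0 ef DV0 DD mD.
have aD0 : 0 < a * D^-1 by exact: mulr_gt0.
exists (a * D^-1); first exact: ltW.
split.
  by apply: le_trans low; rewrite lee_fin ler_peMl ?(ltW aD0) // ler1n.
apply: (@le_trans _ _ V%:E); first by rewrite -VE; exact: riemannian_area_mono.
rewrite lee_fin; have -> : a^-1 * (A + V * D ^+ 2) * (a * D^-1) * d =
    A * (D^-1 * d) + V * (D * d) by field; rewrite !gt_eqF.
apply: (@le_trans _ _ (V * (D * d))).
  by rewrite ler_peMr ?(ltW V0) // mulrC -ler_pdivrMr // div1r ltW.
by rewrite lerDr mulr_ge0 // mulr_ge0 // ltW.
Qed.

End TubeArea.

Theorem theorem10p1 (R : realType) (S : closed_surface R)
    (g : riemannian_metric S) (Sconn : connected [set: S]) :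
  exists C1 C2 C3 : R,
    [/\ 0 < C1, 0 < C2, 0 < C3 &
      forall (mu : R) (phi : S -> R) (delta : R),
        0 < mu -> eigenfunction g mu phi -> 0 < delta -> mu * delta <= C3 ->
        ((C1 * mu * delta)%:E <= riemannian_area g (nodal_tube g phi delta)
         /\ riemannian_area g (nodal_tube g phi delta)
            <= C2%:E * hausdorff1 g (nodal_set phi) * delta%:E)%E].
Proof.
(* On an empty surface there is no eigenfunction, and any constants will do; otherwise a point is at
   hand for the total area. *)
have [[p0 _]|noS] := pselect (exists p0 : S, True); last first.
  exists 1, 1, 1; split => // mu phi d _ [_ [p _] _].
  by case: noS; exists p.
have [K K1 /choice[ch chP]] := uniform_good_chart g.
have K0 : 0 < K by apply: lt_le_trans K1.
have [V V0 VE] := total_area K1 chP p0.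
have [M [a [KM a0 high]]] := high_frequency_tube K1 chP V0 VE.
have [b b0 low] := low_frequency_tube K1 chP KM.
have [c c0 up] := tube_hausdorff_upper K1 chP V0 VE.
exists (Num.min a b), c, (4 * K)^-1; split => //.
- by rewrite lt_min a0.
- by rewrite invr_gt0 mulr_gt0.
move=> mu phi d mu0 ef d0 md; split; last exact: up mu0 ef d0 md.
have le_min e : Num.min a b <= e -> ((Num.min a b * mu * d)%:E <= (e * mu * d)%:E)%E.
  by move=> h; rewrite lee_fin ler_pM2r // ler_pM2r.
have [muM|Mmu] := leP mu M.
  apply: le_trans (le_min b _) _; first by rewrite ge_min lexx orbT.
  exact: low mu0 ef muM d0 md.
apply: le_trans (le_min a _) _; first by rewrite ge_min lexx.
exact: high ef (ltW Mmu) d0 md.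
Qed.
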